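(* Let $\alpha\in(0,1)$ and $u_\pm=(1\pm\alpha)/2$. Let $\mathcal X,\mathcal G_\ell,\mathcal G,\bar u,\bar\varphi$ be as defined in the context, and define $\hat{\mathcal G}_\ell:\mathcal X\to(-\infty,+\infty]$ by $$\hat{\mathcal G}_\ell(u,\varphi)=e^{\alpha\ell}\big[\mathcal G_\ell(u,\varphi)-\min\mathcal G\big].$$ (i) Let $\{(u_\ell,\varphi_\ell)\}\subset\mathcal X$ be a sequence such that $\limsup_{\ell\to\infty}\hat{\mathcal G}_\ell(u_\ell,\varphi_\ell)<+\infty$. Then, up to a subsequence, $(u_\ell,\varphi_\ell)\to(\tau_z\bar u,\tau_z\bar\varphi)$ in $\mathcal X$ for some $z\in\mathbb R$. In particular, the family of functionals $\{\hat{\mathcal G}_\ell\}$ is equi-coercive. (ii) As $\ell\to\infty$ the family $\{\hat{\mathcal G}_\ell\}$ $\Gamma$-converges on $\mathcal X$ to the functional $\hat{\mathcal G}:\mathcal X\to(-\infty,+\infty]$ defined by $$\hat{\mathcal G}(u,\varphi)=\begin{cases}\dfrac{8\alpha}{1-\alpha^2}\cosh(\alpha z)&\text{if }(u,\varphi)=(\tau_z\bar u,\tau_z\bar\varphi)\text{ for some }z\in\mathbb R,\\[2mm]+\infty&\text{otherwise.}\end{cases}$$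
   Context: Notation. $s:[0,1]\to\mathbb R$, $s(u)=u\log u+(1-u)\log(1-u)$ with $0\log 0=0$; thus $s'(u)=\log\frac{u}{1-u}$ on $(0,1)$. $g:[0,1]\times\mathbb R\times[0,1]\to\mathbb R$ is $$g(u,\varphi,p)=s(u)+s(p)+(1-u)\varphi-\log(1+e^\varphi).$$ Set $\varphi_\pm=s'(u_\pm)=\log\frac{u_\pm}{1-u_\pm}$; since $u_-+u_+=1$, $g(u_-,\varphi_-,0)=g(u_+,\varphi_+,0)$. For $a_\pm\in\mathbb R$, $\vartheta_{a_-,a_+}$ is the step function equal to $a_-$ on $(-\infty,0)$ and $a_+$ on $(0,+\infty)$. Translations: $(\tau_zu)(x)=u(x-z)$. Spaces. $\mathcal C$ is the set of (locally) absolutely continuous $\varphi:\mathbb R\to\mathbb R$ with $0\le\varphi'\le1$ a.e., $\lim_{x\to-\infty}\varphi(x)=\varphi_-$, $\lim_{x\to+\infty}\varphi(x)=\varphi_+$, with the topology of uniform convergence. $L^\infty(\mathbb R;[0,1])$ carries the weak* topology. $\mathcal X=L^\infty(\mathbb R;[0,1])\times\mathcal C$ with the product topology (it is metrizable). $\mathcal D$ is the set of $(u,\varphi)\in\mathcal X$ with $\|u-\vartheta_{u_-,u_+}\|_{L^2(\mathbb R)}+\|\varphi-\vartheta_{\varphi_-,\varphi_+}\|_{L^1(\mathbb R)}<+\infty$. Functionals. For $\ell>0$ let $B_\ell$ be the set of $(u,\varphi)\in\mathcal X$ with $u=u_-$ (a.e.), $\varphi=\varphi_-$ on $(-\infty,-\ell]$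 and $u=u_+$ (a.e.), $\varphi=\varphi_+$ on $[\ell,+\infty)$. Define $\mathcal G_\ell:\mathcal X\to(-\infty,+\infty]$ by $$\mathcal G_\ell(u,\varphi)=\int_{-\ell}^{\ell}\big[g(u,\varphi,\varphi')-g(u_+,\varphi_+,0)\big]dx\ \text{ if }(u,\varphi)\in B_\ell,\qquad+\infty\text{ otherwise},$$ and $\mathcal G:\mathcal X\to(-\infty,+\infty]$ by $$\mathcal G(u,\varphi)=\int_{\mathbb R}\big[g(u,\varphi,\varphi')-g(u_+,\varphi_+,0)\big]dx\ \text{ if }(u,\varphi)\in\mathcal D,\qquad+\infty\text{ otherwise}$$ (the integrand is in $L^1(\mathbb R)$ for $(u,\varphi)\in\mathcal D$, and $\mathcal G$ attains its minimum on $\mathcal X$). Standing wave. $\bar u(x)=\frac12+\frac\alpha2\tanh\big(\frac{\alpha x}2\big)$ and $\bar\varphi=s'(\bar u)$. Definitions. A sequence $F_n:X\to(-\infty,+\infty]$ on a metric space $X$ is equi-coercive if every sequence $\{x_n\}$ with $\limsup_nF_n(x_n)<+\infty$ is precompact; it $\Gamma$-converges to $F$ if for every $x\in X$: (a) $\liminf_nF_n(x_n)\ge F(x)$ for every $x_n\to x$; (b) there is $x_n\to x$ with $\limsup_nF_n(x_n)\le F(x)$. For families indexed by $\ell\to\infty$, these properties are understood along every sequence $\ell_n\to\infty$. *)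

(* Defs.v *)
From HB Require Import structures.
From mathcomp Require Import all_boot all_order all_algebra.
From mathcomp Require Import all_classical all_reals all_analysis.
Set Implicit Arguments.
Unset Strict Implicit.
Unset Printing Implicit Defensive.
Import Order.TTheory GRing.Theory Num.Theory.
Import numFieldNormedType.Exports.
Local Open Scope classical_set_scope.
Local Open Scope ring_scope.

Section RealFunctions.
Context {R : realType}.
Implicit Types (u p x z : R) (phi : R -> R).

Definition cosh x : R := (expR x + expR (- x)) / 2.
Definition tanh x : R := (expR x - expR (- x)) / (expR x + expR (- x)).

Definition translate z (f : R -> R) : R -> R := fun x => f (x - z).

(* The value at 0 is arbitrary. *)
Definition step (am ap : R) : R -> R := fun x => if x < 0 then am else ap.

Definition absolutely_continuous_on (a b : R) phi : Prop :=
  forall e : R, 0 < e -> exists2 d : R, 0 < d &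
    forall (n : nat) (c : 'I_n -> R * R),
      (forall i, a <= (c i).1 /\ (c i).1 <= (c i).2 /\ (c i).2 <= b) ->
      trivIset setT (fun i => `](c i).1, (c i).2[%classic) ->
      \sum_(i < n) ((c i).2 - (c i).1) < d ->
      \sum_(i < n) `|phi (c i).2 - phi (c i).1| < e.

Definition locally_absolutely_continuous phi : Prop :=
  forall a b : R, a <= b -> absolutely_continuous_on a b phi.

(* [ln 0 = 0] in the library, so that the convention [0 log 0 = 0] holds. *)
Definition s u : R := u * ln u + (1 - u) * ln (1 - u).

(* The derivative of [s] on (0,1). *)
Definition ds u : R := ln (u / (1 - u)).

Definition g u (f : R) p : R :=
  s u + s p + (1 - u) * f - ln (1 + expR f).

End RealFunctions.

Section GammaConvergence.
Context {R : realType} {T : topologicalType}.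

Definition equi_coercive (F_ : nat -> T -> \bar R) : Prop :=
  forall x_ : nat -> T,
    (limn_esup (fun n => F_ n (x_ n)) < +oo)%E -> precompact (range x_).

Definition gamma_cvg (F_ : nat -> T -> \bar R) (F : T -> \bar R) : Prop :=
  forall x : T,
    (forall x_ : nat -> T, x_ @ \oo --> x ->
       (F x <= limn_einf (fun n => F_ n (x_ n)))%E) /\
    (exists2 x_ : nat -> T, x_ @ \oo --> x &
       (limn_esup (fun n => F_ n (x_ n)) <= F x)%E).

End GammaConvergence.

Section Linf01.
Context (R : realType).
Local Notation mu := (@lebesgue_measure R).

(* The elements are classes of measurable functions modulo a.e. equality; the
   coercion to functions picks a representative. *)
Definition Linf01 : Type :=
  [set u : {mfun_ mu, measurableTypeR R >-> measurableTypeR R} |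
     \forall x \ae mu, 0 <= u x <= 1].

HB.instance Definition _ := Choice.on Linf01.

Definition Linf01_fun (u : Linf01) : R -> R := val u.

Definition pairing (u : Linf01) :
    {ptws LfunType mu (@lexx _ _ 1%E) -> R} :=
  fun f => (\int[mu]_x (Linf01_fun u x * f x))%R.

(* The weak* topology is the coarsest one for which the pairings with the
   functions of L^1 are continuous. *)
HB.instance Definition _ := Topological.copy Linf01 (initial_topology pairing).

End Linf01.

Section Functionals.
Context {R : realType}.
Variable alpha : R.
Local Notation mu := (@lebesgue_measure R).

Definition um : R := (1 - alpha) / 2.
Definition up : R := (1 + alpha) / 2.
Definition phim : R := ds um.
Definition phip : R := ds up.

Definition in_C (phi : R -> R) : Prop :=
  [/\ locally_absolutely_continuous phi,
      \forall x \ae mu, derivable phi x 1 /\ 0 <= derive1 phi x <= 1,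
      phi x @[x --> -oo] --> phim &
      phi x @[x --> +oo] --> phip].

(* As a subset of [{uniform R -> R}], its topology is the one of uniform
   convergence. *)
Definition C_set : set {uniform R -> R} := [set phi | in_C phi].

Definition X : topologicalType := (Linf01 R * C_set)%type.

Definition Xu (x : X) : R -> R := Linf01_fun x.1.
Definition Xphi (x : X) : R -> R := val x.2.

Definition domD (x : X) : Prop :=
  ('N[mu]_2%:E [EFin \o (fun y => Xu x y - step um up y)%R] +
   'N[mu]_1 [EFin \o (fun y => Xphi x y - step phim phip y)%R] < +oo)%E.

Definition domB (l : R) (x : X) : Prop :=
  [/\ \forall y \ae mu, y <= - l -> Xu x y = um,
      forall y, y <= - l -> Xphi x y = phim,
      \forall y \ae mu, l <= y -> Xu x y = up &
      forall y, l <= y -> Xphi x y = phip].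

Definition integrand (x : X) (y : R) : R :=
  g (Xu x y) (Xphi x y) (derive1 (Xphi x) y) - g up phip 0.

Definition G_ell (l : R) (x : X) : \bar R :=
  if `[< domB l x >] then (\int[mu]_(y in `[(- l)%R, l]) (integrand x y)%:E)%E
  else +oo%E.

Definition G (x : X) : \bar R :=
  if `[< domD x >] then (\int[mu]_y (integrand x y)%:E)%E else +oo%E.

(* This infimum is attained. *)
Definition minG : \bar R := ereal_inf (range G).

Definition ubar (x : R) : R := 1 / 2 + alpha / 2 * tanh (alpha * x / 2).
Definition phibar (x : R) : R := ds (ubar x).

Definition is_wave (z : R) (x : X) : Prop :=
  (Xu x = translate z ubar %[ae mu]) /\ Xphi x = translate z phibar.

Definition Ghat_ell (l : R) (x : X) : \bar R :=
  ((expR (alpha * l))%:E * (G_ell l x - minG))%E.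

(* For [0 < alpha < 1] there is at most one [z] with [is_wave z x], as [phibar]
   is strictly increasing. *)
Definition Ghat (x : X) : \bar R :=
  if pselect (exists z, is_wave z x) is left h then
    (8 * alpha / (1 - alpha ^+ 2) * cosh (alpha * sval (cid h)))%:E
  else +oo%E.

End Functionals.

(* Main.v *)
(** Write [P_b phi = 1 - (1 - b^2) (2 + e^phi + e^-phi) / 4] for [alpha < b < 1] and let
    [sg] be the logistic function.  Up to its end value the integrand is
      [H (u | sg phi) + H (phi' | P_b phi) + f_b phi * phi' - e_b],
    with [H] the relative entropy of Bernoulli laws, [f_b = ln (P_b / (1 - P_b))] and
    [e_b = ln ((1 - alpha^2) / (1 - b^2))].  On an interval of length [T] where [phi] goes
    from its zero to an end value, the energy is thus at least [m_b - e_b T], where [m_b] is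
    the integral of [f_b] over [[0, phi_+]], with equality along [phi' = P_b phi],
    [u = sg phi].  Letting [b] tend to [alpha] gives [min G = 2 inf m_b].  Since
    [d m_b = tau_b d e_b], where [tau_b] is the time needed by [phi' = P_b phi] to go from [0]
    to [phi_+], [m_b - inf m_b] is explicit to leading order in [b - alpha]; choosing
    [b - alpha] of order [2 alpha e^(- alpha T)] yields the cost
    [4 alpha / (1 - alpha^2) * e^(- alpha T)], both from below and, by gluing two extremals,
    from above.  For a zero at [z] the two half-lines have [T = l - z] and [T = l + z], whence
    the hyperbolic cosine.
      For compactness, the entropies control the squares of [u - sg phi] and
    [phi' - P_alpha phi].  As [P_alpha] decreases in [|phi|], an approximate solution of
    [phi' = P_alpha phi] is uniformly close to the standing wave with the same zero, and the
    zeros remain bounded by the lower bound above. *)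
Require Import Defs.
From mathcomp Require Import all_boot all_order all_algebra.
From mathcomp Require Import all_classical all_reals all_analysis.
From mathcomp Require Import measurable_realfun ring lra.
Import Order.TTheory GRing.Theory Num.Theory.
Import numFieldNormedType.Exports.
Import HBNNSimple.
Local Open Scope classical_set_scope.
Local Open Scope ring_scope.
Set Implicit Arguments.
Unset Strict Implicit.
Unset Printing Implicit Defensive.

(** * Calculus for Lipschitz functions *)

(** The form of [P_b] is dictated by the remainder of the calibration: the part of the integrand
    that depends on [phi] alone is, up to a constant, minus the logarithm of
    [(2 + e^phi + e^-phi) / 4], and it is cancelled by [ln (1 - P_b)] exactly when [1 - P_b] is a
    multiple of that function. The multiple is the free parameter. At [b = alpha] the velocity
    vanishes at the end values, the transition takes infinite time and [f_b] is unbounded; every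
    argument therefore works at [b > alpha], at the price [e_b] per unit length. For given [T] the
    lower bound is the supremum over [b] of [m_b - e_b T]. By [d m_b = tau_b d e_b] it is stationary
    where [tau_b = T], that is, where the extremal uses up the available time; this is why upper and
    lower bounds agree, and solving it to leading order gives [b - alpha = 2 alpha e^(- alpha T)].
    The difficulty is a cancellation: [m_b - inf m_b] and [e_b T] are both of order
    [T e^(- alpha T)], larger than the cost sought, so both need explicit errors of smaller order
    than [e^(- alpha T)]. *)

Section AbsolutelyContinuous.
Context {R : realType}.
Local Notation mu := (@lebesgue_measure R).
Implicit Types (f : R -> R) (U : set R) (a b x : R) (t : seq (R * R)).

(** The intervals are listed from right to left, so that prolonging a chain to the right is a
    [cons]. Neighbours may share an end point. *)
Fixpoint chain U a x t : Prop :=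
  if t is c :: t' then
    [/\ c.1 <= c.2, c.2 <= x, `[c.1, c.2] `<=` U & chain U a c.1 t']
  else a <= x.

Lemma chain_ge U a x t : chain U a x t -> a <= x.
Proof.
elim: t x => [//|c t IH] x /= [c12 c2 _ /IH ac].
by apply: (le_trans ac); apply: le_trans c2.
Qed.

Lemma chain_mono U a x x' t : x <= x' -> chain U a x t -> chain U a x' t.
Proof.
case: t => [|c t] /= xx'; first by move=> /le_trans; apply.
by move=> [? h ? ?]; split => //; exact: le_trans xx'.
Qed.

Lemma chain_nth U a x t i : chain U a x t -> (i < size t)%N ->
  let c := nth (0, 0) t i in [/\ a <= c.1, c.1 <= c.2 & c.2 <= x].
Proof.
elim: t x i => [//|c t IH] x [|i] /= [c12 c2x _ ch] it.
  by split => //; exact: chain_ge ch.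
by have [h1 h2 h3] := IH _ _ ch it; split => //; lra.
Qed.

Lemma chain_sep U a x t i j : chain U a x t -> (i < j)%N -> (j < size t)%N ->
  (nth (0, 0) t j).2 <= (nth (0, 0) t i).1.
Proof.
elim: t x i j => [//|c t IH] x [|i] [|j] //= [c12 c2x _ ch] ij jt.
  by have [] := chain_nth ch jt.
by apply: IH ch _ _.
Qed.

(** The head is counted as the half-open [[c.1, c.2[], which is disjoint from the tail even when end
    points are shared. *)
Lemma chain_measure U a x t : measurable U -> chain U a x t ->
  ((\sum_(c <- t) (c.2 - c.1))%:E <= mu (U `&` `]-oo, x[))%E.
Proof.
move=> mU; elim: t x => [|c t IH] x /=; first by rewrite big_nil measure_ge0.
move=> [c12 c2x cU /IH le]; rewrite big_cons EFinD.
have mI : measurable (U `&` `]-oo, c.1[) by exact: measurableI.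
apply: (@le_trans _ _ (mu (`[c.1, c.2[ `|` (U `&` `]-oo, c.1[)))).
  rewrite measureU//; last first.
    apply/seteqP; split => // y [] /=; rewrite !in_itv /= => /andP[h1 _] [_ h2].
    by move: h1; rewrite leNgt h2.
  rewrite /= lebesgue_measure_itv/= lte_fin; case: ifPn => [_|].
    by rewrite EFinN leeD2l.
  rewrite -leNgt => c21; have c21E : c.1 = c.2 by lra.
  rewrite c21E in le *.
  move: le; rewrite subrr => le; by rewrite [X in (_ <= X)%E](_ : _ = mu (U `&` `]-oo, c.2[)) ?add0e//; exact: add0e.
apply: le_measure; rewrite ?inE.
- exact: measurableU.
- exact: measurableI.
- move=> y [|[Uy]] /=; rewrite !in_itv/=.
    move=> /andP[h1 h2]; split; last by lra.
    by apply: cU; rewrite /= in_itv/= h1 ltW.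
  by move=> h; split => //; lra.
Qed.

Lemma chain_variation f U a b t (d e : R) :
  (forall (n : nat) (c : 'I_n -> R * R),
      (forall i, a <= (c i).1 /\ (c i).1 <= (c i).2 /\ (c i).2 <= b) ->
      trivIset setT (fun i => `](c i).1, (c i).2[%classic) ->
      \sum_(i < n) ((c i).2 - (c i).1) < d ->
      \sum_(i < n) `|f (c i).2 - f (c i).1| < e) ->
  measurable U -> (mu U < d%:E)%E -> chain U a b t ->
  \sum_(c <- t) `|f c.2 - f c.1| < e.
Proof.
move=> fac mU Ud ch; have := fac (size t) (fun i => nth (0, 0) t i).
rewrite (big_nth (0, 0)) big_mkord; apply.
- by move=> i; have [] := chain_nth ch (ltn_ord i).
- move=> i j _ _ [y []] /=; rewrite !in_itv/= => /andP[i1 i2] /andP[j1 j2].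
  apply/val_inj/eqP; rewrite eqn_leq.
  apply/andP; split; rewrite leqNgt; apply/negP => ij.
    by have := chain_sep ch ij (ltn_ord i); lra.
  by have := chain_sep ch ij (ltn_ord j); lra.
- have := chain_measure mU ch; rewrite (big_nth (0, 0)) big_mkord.
  move=> h; rewrite -lte_fin; apply: (le_lt_trans h); apply: le_lt_trans Ud.
  by apply: le_measure; rewrite ?inE//; exact: measurableI.
Qed.


Lemma is_derive_epsP f x (D : R) :
  is_derive x (1 : R) f D <->
  forall e : R, 0 < e -> exists2 d : R, 0 < d &
    forall h, `|h| < d -> `|f (x + h) - f x - D * h| <= e * `|h|.
Proof.
have key (h : R) : h != 0 -> `|f (x + h) - f x - D * h| =
    `|D - h^-1 *: ((f \o shift x) (h *: (1 : R)) - f x)| * `|h|.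
  move=> h0; rewrite -normrM distrC; congr (`| _ |).
  rewrite mulrBl /= /GRing.scale/= mulr1 [h + x]addrC mulrAC mulVf// mul1r; ring.
split=> [[dv De] e e0|H].
  have : h^-1 *: ((f \o shift x) (h *: (1 : R)) - f x) @[h --> 0^'] --> D by rewrite -De.
  move=> /cvgrPdist_le /(_ _ e0)/nbhs_ballP[d/= d0 dP]; exists d => // h hd.
  have [->|h0] := eqVneq h 0; first by rewrite addr0 subrr mulr0 subr0 normr0 mulr0.
  rewrite key// ler_wpM2r//; apply: dP => //.
  by rewrite /ball/= sub0r normrN.
have cv : h^-1 *: ((f \o shift x) (h *: (1 : R)) - f x) @[h --> 0^'] --> D.
  apply/cvgrPdist_le => e e0; have [d d0 dP] := H _ e0.
  apply/nbhs_ballP; exists d => //= h; rewrite /ball/= sub0r normrN => hd h0.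
  have := dP _ hd; rewrite key// ler_pM2r// normr_gt0//.
apply: DeriveDef; first by apply/cvg_ex; exists D.
exact: cvg_lim cv.
Qed.

Lemma derivable_is_derive1 f x : derivable f x (1 : R) ->
  is_derive x (1 : R) f (derive1 f x).
Proof. by move=> dv; apply: DeriveDef => //; rewrite derive1E. Qed.

(** A continuous induction instead of a covering theorem. At points outside the null set the
    derivative limits the drop to [e] per unit length; points of the null set are crossed inside an
    open set of measure below [d], over which absolute continuity limits the total variation to
    [e]. *)
Lemma ac_nondecreasing f : locally_absolutely_continuous f ->
  (\forall x \ae mu, derivable f x 1 /\ 0 <= derive1 f x) ->
  {homo f : x y / x <= y}.
Proof.
move=> fac [N [mN N0 fN]] a b ab.
apply/ler_addgt0Pl => /= e0 e00; have {}e00 : (0 : R) < e0 by [].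
have [e [e0' e1]] : exists e : R, 0 < e /\ e * (b - a) + e <= e0.
  have ba : 0 < b - a + 1 by lra.
  exists (e0 / (b - a + 1)); split; first exact: divr_gt0.
  have : e0 / (b - a + 1) * (b - a + 1) = e0 by rewrite divfK// gt_eqF.
  by move: (e0 / _) => w; lra.
have [d d0 dP] := fac a b ab e e0'.
have [|U [oU NU mUN]] := lebesgue_regularity_outer mN _ d0.
  by apply: (le_lt_trans _ (ltry 0)); rewrite le_eqVlt; apply/orP; left; apply/eqP; exact: N0.
have mU : measurable U by exact: open_measurable.
have Ud : (mu U < d%:E)%E.
  by rewrite -(setDUK NU) measureU//= ?setDIK//; [rewrite [X in (X + _)%E]N0 add0e|exact: measurableD].
pose P x t := chain U a x t /\
  f x - f a >= - e * (x - a) - \sum_(c <- t) `|f c.2 - f c.1|.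
pose S := [set x | x <= b /\ exists t, P x t].
have Sa : S a by split => //; exists [::]; split => //=; rewrite big_nil; lra.
have supS : has_sup S by split; [exists a|exists b => x []].
have ac : a <= sup S by apply: ub_le_sup => //; case: supS.
have cb : sup S <= b by apply: ge_sup; [exists a|move=> x []].
set c := sup S in ac cb.
(* The step straddles [c = sup S]: taking [z > c] shows that [c] cannot be below [b], taking [z = c]
   that the supremum is reached. *)
have [eta eta0 loc] : exists2 eta : R, 0 < eta & forall y z, c - eta < y -> y <= c ->
    c <= z -> z < c + eta -> forall t, P y t -> exists t', P z t'.
  have [Nc|Nc] := pselect (N c).
    have /NU Uc := Nc.
    have /nbhs_ballP[eta/= eta0 etaU] : nbhs c U by exact: open_nbhs_nbhs.
    exists eta => // y z y1 y2 z1 z2 t [cht ft].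
    exists ((y, z) :: t); split => /=.
      split => //; first by lra.
      move=> w; rewrite /= in_itv/= => /andP[w1 w2]; apply: etaU.
      rewrite /ball/= ltr_norml; apply/andP; split; lra.
    rewrite big_cons /=.
    have := ler_norm (f y - f z); rewrite distrC => h.
    have : 0 <= e * (z - y) by apply: mulr_ge0; lra.
    lra.
  have [dc dc0] : derivable f c 1 /\ 0 <= derive1 f c.
    by apply: contrapT => /fN.
  have /is_derive_epsP /(_ _ e0') [eta eta0 etaP] := derivable_is_derive1 dc.
  exists eta => // y z y1 y2 z1 z2 t [cht ft].
  exists t; split; first by apply: chain_mono cht; lra.
  have := etaP (z - c); rewrite ger0_norm; last by lra.
  move=> /(_ ltac:(lra)); rewrite ler_norml => /andP[h1 _].
  have := etaP (y - c); rewrite ler0_norm; last by lra.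
  move=> /(_ ltac:(lra)); rewrite ler_norml => /andP[_ h2].
  rewrite !subrKC in h1 h2.
  have : 0 <= derive1 f c * (z - c) by apply: mulr_ge0; lra.
  have : 0 <= derive1 f c * (c - y) by apply: mulr_ge0; lra.
  lra.
have [y Sy cy] := sup_adherent eta0 supS.
have yc : y <= c by apply: ub_le_sup => //; case: supS.
case: Sy => yb [t Pt].
have [cb'|cb'] := ltP c b.
  have : S (Num.min b (c + eta / 2)).
    split; first by rewrite ge_min lexx.
    apply: (loc y _ _ _ _ _ t) => //; first by rewrite le_min cb; lra.
    by rewrite gt_min; apply/orP; right; lra.
  move=> /(ub_le_sup (proj2 supS)); rewrite -/c ge_min => /orP[|]; lra.
have cE : c = b by lra.
have [t' [ch ft]] : exists t, P b t.
  by apply: (loc y _ _ _ _ _ t) => //; lra.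
have := chain_variation dP mU Ud ch.
lra.
Qed.

End AbsolutelyContinuous.

Section NullSets.
Context d (T : measurableType d) (R : realType) (mu : {measure set T -> \bar R}).

(* The integrals of the library are defined for arbitrary functions, and null
   sets are negligible for them even without measurability. *)
Lemma integral_null_eq (D N : set T) (f g : T -> \bar R) :
  measurable N -> mu N = 0%E ->
  (forall x, D x -> ~ N x -> f x = g x) ->
  (\int[mu]_(x in D) f x = \int[mu]_(x in D) g x)%E.
Proof.
move=> mN N0 fg.
have key (p q : T -> \bar R) : (forall x, 0 <= q x)%E -> (forall x, ~ N x -> p x = q x) ->
  (ereal_sup [set sintegral mu k | k in [set k : {nnsfun T >-> R} | forall x, ((k x)%:E <= p x)%E]] <=
  ereal_sup [set sintegral mu k | k in [set k : {nnsfun T >-> R} | forall x, ((k x)%:E <= q x)%E]])%E.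
  move=> q0 pq; apply: ge_ereal_sup => _ [k kp <-].
  apply: ereal_sup_ubound.
  have mNC : measurable (~` N) by exact: measurableC.
  exists (proj_nnsfun k mNC).
    move=> x; rewrite /= mindicE; case: (boolP (x \in ~` N)) => xN.
      by rewrite mulr1 -pq//; exact/set_mem.
    by rewrite mulr0.
  rewrite -!integralT_nnsfun; apply: ae_eq_integral => //.
  - exact/measurable_EFinP.
  - exact/measurable_EFinP.
  - exists N; split => // x /= xN; apply: contrapT => Nx; apply: xN => _.
    by rewrite mindicE mem_set ?mulr1.
rewrite /integral; congr (_ - _)%E; apply/eqP; rewrite eq_le; apply/andP; split; apply: key => x.
all: try exact: funepos_ge0.
all: try exact: funeneg_ge0.
all: move=> Nx; rewrite ?funeposE ?funenegE !patchE; case: ifPn => // /set_mem Dx; by rewrite fg.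
Qed.



End NullSets.

Section Integrals.
Context {R : realType}.
Local Notation mu := (@lebesgue_measure R).
Local Notation "'I' a b f" := (\int[mu]_(x in `[a, b]) (f x))%R (at level 10, a, b, f at level 9).
Implicit Types (f g h d : R -> R) (a b c x : R).

Lemma ae_imp (P Q : R -> Prop) : (forall x, P x -> Q x) ->
  (\forall x \ae mu, P x) -> \forall x \ae mu, Q x.
Proof. by move=> PQ; apply: filterS => //; exact: (ae_filter_ringOfSetsType mu). Qed.

Lemma ae_imp2 (P Q S : R -> Prop) : (forall x, P x -> Q x -> S x) ->
  (\forall x \ae mu, P x) -> (\forall x \ae mu, Q x) -> \forall x \ae mu, S x.
Proof. by move=> PQ; apply: filterS2 => //; exact: (ae_filter_ringOfSetsType mu). Qed.

Lemma ae_all (P : R -> Prop) : (forall x, P x) -> \forall x \ae mu, P x.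
Proof. by move=> P1; apply: (ae_imp (fun x _ => P1 x)); exact: aeW. Qed.

Lemma isdD f g x a b : is_derive x (1 : R) f a -> is_derive x (1 : R) g b ->
  is_derive x (1 : R) (fun y => f y + g y) (a + b).
Proof. by move=> df dg; exact: is_deriveD. Qed.

Lemma isdB f g x a b : is_derive x (1 : R) f a -> is_derive x (1 : R) g b ->
  is_derive x (1 : R) (fun y => f y - g y) (a - b).
Proof. by move=> df dg; exact: is_deriveB. Qed.

Lemma isdM f g x a b : is_derive x (1 : R) f a -> is_derive x (1 : R) g b ->
  is_derive x (1 : R) (fun y => f y * g y) (a * g x + f x * b).
Proof.
move=> df dg; have := is_deriveM df dg; rewrite /GRing.scale/= => h.
by have -> : a * g x + f x * b = f x * b + g x * a by ring.
Qed.

Lemma isdZ k f x a : is_derive x (1 : R) f a -> is_derive x (1 : R) (fun y => k * f y) (k * a).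
Proof. by move=> df; exact: is_deriveZ. Qed.

Lemma isd_cst k x : is_derive x (1 : R) (fun=> k : R) 0.
Proof. exact: is_derive_cst. Qed.

Lemma isd_comp f g x a b : is_derive (g x) (1 : R) f a -> is_derive x (1 : R) g b ->
  is_derive x (1 : R) (fun y => f (g y)) (a * b).
Proof. by move=> df dg; exact: is_derive1_comp. Qed.

Lemma isdV f x a : is_derive x (1 : R) f a -> f x != 0 ->
  is_derive x (1 : R) (fun y => (f y)^-1) (- a / f x ^+ 2).
Proof.
move=> df fx; have := is_deriveV fx df; rewrite /GRing.scale/= => h.
by have -> : - a / f x ^+ 2 = - f x ^- 2 * a by rewrite mulrC mulrN mulNr.
Qed.

Lemma isdN f x a : is_derive x (1 : R) f a -> is_derive x (1 : R) (fun y => - f y) (- a).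
Proof. by move=> df; exact: is_deriveN. Qed.

Lemma isd_cast f x a b : is_derive x (1 : R) f a -> a = b -> is_derive x (1 : R) f b.
Proof. by move=> ? <-. Qed.

Lemma isd_exp x : is_derive x (1 : R) expR (expR x).
Proof. exact: is_derive_expR. Qed.

Lemma isd_ln x : 0 < x -> is_derive x (1 : R) (@ln R) x^-1.
Proof. exact: is_derive1_ln. Qed.

Lemma isd_id x : is_derive x (1 : R) (fun y => y) 1.
Proof. exact: is_derive_id. Qed.

Lemma isd_ln_comp f x a : is_derive x (1 : R) f a -> 0 < f x ->
  is_derive x (1 : R) (fun y => ln (f y)) ((f x)^-1 * a).
Proof. by move=> df f0; apply: (isd_comp (isd_ln f0) df). Qed.

Lemma isd_near f g x a (d : R) : 0 < d -> (forall y, `|y - x| < d -> f y = g y) ->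
  is_derive x (1 : R) f a -> is_derive x (1 : R) g a.
Proof.
move=> d0 fg /is_derive_epsP fa; apply/is_derive_epsP => e e0.
have [eta eta0 etaP] := fa e e0; exists (Num.min eta d); first by rewrite lt_min eta0.
move=> h; rewrite lt_min => /andP[h1 h2]; rewrite -!fg ?subrr ?normr0//; first exact: etaP.
by rewrite addrAC subrr add0r.
Qed.

Lemma isd_continuous f x a : is_derive x (1 : R) f a -> {for x, continuous f}.
Proof. by move=> [/derivable1_diffP/differentiable_continuous]. Qed.

Lemma isd_ge0_le f d a b : a <= b -> (forall x, a <= x <= b -> is_derive x (1 : R) f (d x)) ->
  (forall x, a < x < b -> 0 <= d x) -> f a <= f b.
Proof.
move=> ab fd d0.
have cf : {within `[a, b], continuous f}.
  apply: derivable_within_continuous => x /[!in_itv]/= xab.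
  by have [] := fd _ xab.
apply: (@ger0_derive1_ndecr R f a b) => // x.
- by move=> /[!in_itv]/= /andP[ax xb]; have [] : is_derive x (1 : R) f (d x) by apply: fd; lra.
- move=> /[!in_itv]/= /andP[ax xb]; have [_ e] : is_derive x (1 : R) f (d x) by apply: fd; lra.
  by rewrite derive1E e; apply: d0; rewrite ax.
Qed.

Lemma is_derive_primitive f a x : continuous f -> a < x ->
  is_derive x (1 : R) (fun y => I a y f) (f x).
Proof.
move=> cf ax; have xx : x < x + 1 by rewrite ltrDl.
have fi : mu.-integrable `[a, x + 1] (EFin \o f).
  apply: continuous_compact_integrable; first exact: segment_compact.
  by apply: continuous_subspaceT => y; exact: cf.
have [dF eF] := continuous_FTC1_closed xx fi ax (cf x).
by rewrite -eF; apply: derivable_is_derive1.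
Qed.

(** These functions form an algebra and are integrable on every segment, so that integrals over
    segments need no separate integrability proofs. *)
Definition bmeas f := measurable_fun setT f /\ exists M : R, forall x, `|f x| <= M.

Lemma bmeas_integrable f a b : bmeas f -> mu.-integrable `[a, b] (EFin \o f).
Proof.
move=> [mf [M fM]]; apply: measurable_bounded_integrable => //.
- by rewrite /= lebesgue_measure_itv/=; case: ifP => _; rewrite ?ltry // -EFinB ltry.
- exact: measurable_funS mf.
- exists M; split; first exact: num_real.
  by move=> K MK x _ /=; apply: (le_trans (fM x)); exact: ltW.
Qed.

Lemma itg_EFin f a b : bmeas f -> (\int[mu]_(x in `[a, b]) (f x)%:E = (I a b f)%:E)%E.
Proof.
by move=> bf; rewrite fineK//; apply: integrable_fin_num => //; exact: bmeas_integrable.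
Qed.

Lemma bmeasD f g : bmeas f -> bmeas g -> bmeas (fun x => f x + g x).
Proof.
move=> [mf [M fM]] [mg [M' gM]]; split; first exact: measurable_funD.
exists (M + M') => x; apply: (le_trans (ler_normD _ _)); exact: lerD.
Qed.

Lemma bmeasM f g : bmeas f -> bmeas g -> bmeas (fun x => f x * g x).
Proof.
move=> [mf [M fM]] [mg [M' gM]]; split; first exact: measurable_funM.
by exists (M * M') => x; rewrite normrM; apply: ler_pM.
Qed.

Lemma bmeas_cst a : bmeas (fun=> a).
Proof. by split => //; exists `|a|. Qed.

Lemma bmeasZ a f : bmeas f -> bmeas (fun x => a * f x).
Proof. by move=> bf; apply: bmeasM => //; exact: bmeas_cst. Qed.

Lemma bmeasN f : bmeas f -> bmeas (fun x => - f x).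
Proof.
move=> bf; have -> : (fun x => - f x) = (fun x => -1 * f x) by apply/funext => x; rewrite mulN1r.
exact: bmeasZ.
Qed.

Lemma bmeasB f g : bmeas f -> bmeas g -> bmeas (fun x => f x - g x).
Proof. by move=> bf bg; apply: bmeasD => //; exact: bmeasN. Qed.

Lemma bmeas_norm f : bmeas f -> bmeas (fun x => `|f x|).
Proof.
move=> [mf [M fM]]; split; first exact: measurableT_comp.
by exists M => x; rewrite normr_id.
Qed.

Lemma itgD f g a b : bmeas f -> bmeas g ->
  I a b (fun x => f x + g x) = I a b f + I a b g.
Proof. by move=> bf bg; rewrite RintegralD//; exact: bmeas_integrable. Qed.

Lemma itgB f g a b : bmeas f -> bmeas g ->
  I a b (fun x => f x - g x) = I a b f - I a b g.
Proof. by move=> bf bg; rewrite RintegralB//; exact: bmeas_integrable. Qed.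

Lemma itgZ f a b k : bmeas f -> I a b (fun x => k * f x) = k * I a b f.
Proof. by move=> bf; rewrite RintegralZl//; exact: bmeas_integrable. Qed.

Lemma itg_cst a b k : a <= b -> I a b (fun=> k) = k * (b - a).
Proof.
move=> ab; rewrite Rintegral_cst//= lebesgue_measure_itv/= lte_fin.
by case: ltP => [_|ba] //=; have -> : b - a = 0 by lra.
Qed.

Lemma itg_le f g a b : bmeas f -> bmeas g -> (forall x, a <= x <= b -> f x <= g x) ->
  I a b f <= I a b g.
Proof.
by move=> bf bg fg; apply: le_Rintegral => //; try exact: bmeas_integrable.
Qed.

Lemma itg_cat f a b c : bmeas f -> a <= b -> b <= c ->
  I a c f = I a b f + I b c f.
Proof.
move=> bf ab bc.
have := @Rintegral_itvB R f (BLeft a) (BRight c) b (bmeas_integrable _ _ bf).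
rewrite !bnd_simp => /(_ ab bc); rewrite Rintegral_itv_obnd_cbnd => [<-|].
  by rewrite subrKC.
apply: (@integrableS _ _ _ mu `[b, c]) => //; last exact: bmeas_integrable.
exact: subset_itv_oc_cc.
Qed.

Lemma bmeas_continuous h f (M : R) : continuous h -> continuous f ->
  (forall x, `|f x| <= M) -> bmeas (fun x => h (f x)).
Proof.
move=> ch cf fM; split.
  apply: continuous_measurable_fun => x.
  by apply: continuous_comp; [exact: cf|exact: ch].
have M0 : - M <= M by have := fM 0; have := normr_ge0 (f 0); lra.
have cn : {within `[- M, M], continuous (fun x => `|h x|)}.
  apply: continuous_subspaceT => x.
  by apply: (@continuous_comp _ _ _ h (fun y : R => `|y|)); [exact: ch|exact: norm_continuous].
have [m _ mP] := EVT_max M0 cn.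
by exists (`|h m|) => x; apply: mP; rewrite in_itv/= -ler_norml.
Qed.

Lemma lipschitz_continuous h (L : R) : (forall x y, `|h x - h y| <= L * `|x - y|) -> continuous h.
Proof.
move=> hL x; have L0 : 0 < `|L| + 1 by have := normr_ge0 L; lra.
apply/cvgrPdist_le => e e0.
apply/nbhs_ballP; exists (e / (`|L| + 1)); first exact: divr_gt0.
move=> y; rewrite /ball/= => xy; apply: (le_trans (hL _ _)).
apply: (@le_trans _ _ ((`|L| + 1) * `|x - y|)).
  by rewrite ler_wpM2r//; have := ler_norm L; lra.
by rewrite mulrC -ler_pdivlMr//; exact: ltW.
Qed.

Lemma is_derive_seq_quot (g : R -> R) x D : is_derive x (1 : R) g D ->
  n.+1%:R * (g (x + n.+1%:R^-1) - g x) @[n --> \oo] --> D.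
Proof.
have n0 n : (0 : R) < n.+1%:R by rewrite ltr0n.
have inv0 : (n.+1%:R^-1 : R) @[n --> \oo] --> 0 by exact: cvg_harmonic.
move=> /is_derive_epsP gD; apply/cvgrPdist_le => e e0.
have [eta eta0 etaP] := gD e e0.
move/cvgrPdist_lt: inv0 => /(_ eta eta0).
apply: filterS => n; rewrite sub0r normrN => /etaP le1.
have : `|n.+1%:R * (g (x + n.+1%:R^-1) - g x - D * n.+1%:R^-1)| <= n.+1%:R * (e * `|n.+1%:R^-1|).
  by rewrite normrM (ger0_norm (ltW (n0 n))) ler_pM2l.
rewrite [X in _ <= _ * (_ * X)]ger0_norm ?invr_ge0; last exact: ltW.
rewrite distrC mulrBr mulrCA divff ?mulr1; last by rewrite gt_eqF.
by rewrite mulrCA divff ?mulr1// gt_eqF.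
Qed.

(** The integral of a difference quotient of [h] is a difference of two difference quotients of its
    primitive, which tends to [h b - h a]; the quotients themselves tend to [d] almost everywhere
    and are dominated by [L]. They look up to 1 to the right, hence the Lipschitz bound up to
    [b + 1]. *)
Lemma lipschitz_FTC h d (L : R) a b : a <= b ->
  continuous h ->
  (forall x y, a <= x <= b + 1 -> a <= y <= b + 1 -> `|h x - h y| <= L * `|x - y|) ->
  measurable_fun setT d ->
  (\forall x \ae mu, a <= x <= b -> is_derive x (1 : R) h (d x)) ->
  (\int[mu]_(x in `[a, b]) (d x)%:E = (h b - h a)%:E)%E.
Proof.
rewrite le_eqVlt => /predU1P[->|ab] ch hL md hd.
  by rewrite set_itv1 integral_set1 subrr.
have HP x := @is_derive_primitive h (a - 1) x ch.
(* Starting at [a - 1] makes the primitive derivable at [a] as well. *)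
set H := fun y => I (a - 1) y h in HP.
pose q n x := n.+1%:R * (h (x + n.+1%:R^-1) - h x).
have cq n : continuous (q n).
  move=> x; apply: cvgM; first exact: cvg_cst.
  apply: cvgB; last exact: ch.
  by apply: continuous_comp; [apply: cvgD; [exact: cvg_id|exact: cvg_cst]|exact: ch].
have n0 n : (0 : R) < n.+1%:R by rewrite ltr0n.
have quot := is_derive_seq_quot.
have [] := @dominated_convergence _ _ R mu `[a, b] _ (fun n x => (q n x)%:E) (fun x => (d x)%:E) (fun=> L%:E).
- exact: measurable_itv.
- move=> n; apply/measurable_EFinP; apply: (measurable_funS _ _ (continuous_measurable_fun (cq n))) => //.
- by apply/measurable_EFinP; exact: measurable_funS md.
- apply: ae_imp hd => x dx; rewrite /= in_itv/= => /dx {}dx; apply: cvg_EFin; first exact: nearW.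
  exact: (quot _ _ _ dx).
- apply: (@bmeas_integrable (fun=> L)); exact: bmeas_cst.
- apply: ae_all => x n; rewrite /= in_itv/= => xab.
  rewrite lee_fin /q normrM (ger0_norm (ltW (n0 n))).
  have i0 : 0 < n.+1%:R^-1 :> R by rewrite invr_gt0.
  have i1 : n.+1%:R^-1 <= 1 :> R by rewrite invf_le1 ?ler1n.
  have h1 : a <= x + n.+1%:R^-1 <= b + 1.
    by move: (n.+1%:R^-1 : R) i0 i1 => t; move: (x : R) xab => y; lra.
  have h2 : a <= x <= b + 1 by move: (x : R) xab => y; lra.
  have := hL (x + n.+1%:R^-1) x h1 h2; rewrite addrAC subrr add0r.
  rewrite [X in _ <= _ * X]ger0_norm ?invr_ge0; last exact: ltW.
  by rewrite -ler_pdivlMl// mulrC.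
move=> _ _ cv; apply: (cvg_unique _ cv) => //.
have qE n : (\int[mu]_(x in `[a, b]) (q n x)%:E)%E =
    (n.+1%:R * (H (b + n.+1%:R^-1) - H b) - n.+1%:R * (H (a + n.+1%:R^-1) - H a))%:E.
  pose G x := n.+1%:R * (H (x + n.+1%:R^-1) - H x).
  have GP x : a - 1 < x -> is_derive x (1 : R) G (q n x).
    move=> ax; have h1 := HP _ ax.
    have h2 : is_derive x (1 : R) (fun x => H (x + n.+1%:R^-1)) (h (x + n.+1%:R^-1)).
      apply/is_derive_epsP => e e0.
      have ax' : a - 1 < x + n.+1%:R^-1.
        by apply: (lt_trans ax); rewrite ltrDl invr_gt0.
      have /is_derive_epsP /(_ _ e0) [eta eta0 etaP] := HP _ ax'.
      exists eta => // k /etaP.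
      by rewrite [x + n.+1%:R^-1 + k]addrAC.
    exact: (isdZ _ (isdB h2 h1)).
  have -> : (\int[mu]_(x in `[a, b]) (q n x)%:E = (G b)%:E - (G a)%:E)%E.
    apply: continuous_FTC2 => //.
    - by apply: continuous_subspaceT => x; exact: cq.
    - have dG x : a - 1 < x -> derivable G x 1 by move=> /GP[].
      have cG x : a - 1 < x -> {for x, continuous G} by move=> /GP/isd_continuous.
      split.
      + by move=> x /[!in_itv]/= /andP[ax _]; apply: dG; lra.
      + by apply: cvg_at_right_filter; apply: cG; lra.
      + by apply: cvg_at_left_filter; apply: cG; lra.
    - move=> x /[!in_itv]/= /andP[ax _]; rewrite derive1E.
      by have [_ ->] : is_derive x (1 : R) G (q n x) by apply: GP; lra.
  by rewrite -EFinB.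
rewrite /=; under eq_fun do rewrite qE.
apply: cvg_EFin; first exact: nearW.
by apply: cvgB; apply: (quot H); apply: HP; lra.
Qed.

End Integrals.

(** * Calibration *)

Section Entropy.
Context {R : realType}.
Implicit Types (u v p t theta phi : R).

(** The Kullback-Leibler divergence of two Bernoulli laws, written [H (u | v)] in the overview. *)
Definition ent u v : R := s u - u * ln v - (1 - u) * ln (1 - v).

Lemma ln_le_sub1 t : 0 < t -> ln t <= t - 1.
Proof. by move=> t0; have := @le_ln1Dx R (t - 1); rewrite subrKC; apply; lra. Qed.

(** This is [ln t <= t - 1] at [t = sqrt v / sqrt u]. Added to its analogue for [1 - u] and [1 - v],
    it bounds [ent] below by a squared Hellinger distance. *)
Lemma entropy_half u v : 0 <= u -> 0 < v ->
  u * ln u - u * ln v >= 2 * (u - Num.sqrt u * Num.sqrt v).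
Proof.
rewrite le_eqVlt => /predU1P[<-|u0] v0; first by rewrite sqrtr0 !mul0r subrr mulr0.
have su : 0 < Num.sqrt u by rewrite sqrtr_gt0.
have sv : 0 < Num.sqrt v by rewrite sqrtr_gt0.
have h := @ln_le_sub1 (Num.sqrt v / Num.sqrt u) (divr_gt0 sv su).
rewrite ln_div ?posrE// in h.
have lnu : ln u = 2 * ln (Num.sqrt u).
  by rewrite -[in LHS](sqr_sqrtr (ltW u0)) expr2 lnM ?posrE//; ring.
have lnv : ln v = 2 * ln (Num.sqrt v).
  by rewrite -[in LHS](sqr_sqrtr (ltW v0)) expr2 lnM ?posrE//; ring.
have : u * (ln (Num.sqrt v) - ln (Num.sqrt u)) <= u * (Num.sqrt v / Num.sqrt u - 1).
  by rewrite ler_pM2l.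
have -> : u * (Num.sqrt v / Num.sqrt u - 1) = Num.sqrt u * Num.sqrt v - u.
  rewrite -{1 4}(sqr_sqrtr (ltW u0)); move: su; set x := Num.sqrt u => su; field; lra.
rewrite lnu lnv; lra.
Qed.

(** A Pinsker-type inequality. With [a] and [b] the square roots of [u] and [v],
    [u - v = (a + b) (a - b)] and [a + b <= 2]; the same holds for the complements. *)
Lemma ent_ge u v : 0 <= u <= 1 -> 0 < v < 1 -> (u - v) ^+ 2 / 2 <= ent u v.
Proof.
move=> /andP[u0 u1] /andP[v0 v1].
have h1 := entropy_half u0 v0.
have h2 := @entropy_half (1 - u) (1 - v) ltac:(lra) ltac:(lra).
rewrite /ent /s.
have := sqr_sqrtr u0; have := sqr_sqrtr (ltW v0).
have := @sqr_sqrtr _ (1 - u) ltac:(lra); have := @sqr_sqrtr _ (1 - v) ltac:(lra).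
have := sqrtr_ge0 u; have := sqrtr_ge0 v; have := sqrtr_ge0 (1 - u); have := sqrtr_ge0 (1 - v).
move: h1 h2.
set a := Num.sqrt u; set b := Num.sqrt v; set a' := Num.sqrt (1 - u); set b' := Num.sqrt (1 - v).
move=> h1 h2 pb' pa' pb pa eb' ea' eb ea.
have le1 : (u - v) ^+ 2 <= 4 * (a - b) ^+ 2.
  have -> : (u - v) ^+ 2 = (a + b) ^+ 2 * (a - b) ^+ 2 by rewrite -ea -eb; ring.
  by apply: ler_wpM2r; [exact: sqr_ge0|nra].
have le2 : (u - v) ^+ 2 <= 4 * (a' - b') ^+ 2.
  have -> : (u - v) ^+ 2 = (a' + b') ^+ 2 * (a' - b') ^+ 2.
    have -> : u - v = b' ^+ 2 - a' ^+ 2 by rewrite eb' ea'; ring.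
    ring.
  by apply: ler_wpM2r; [exact: sqr_ge0|nra].
have e1 : (a - b) ^+ 2 = u + v - 2 * (a * b) by rewrite -ea -eb; ring.
have e2 : (a' - b') ^+ 2 = (1 - u) + (1 - v) - 2 * (a' * b') by rewrite -ea' -eb'; ring.
lra.
Qed.

Lemma ent_ge0 u v : 0 <= u <= 1 -> 0 < v < 1 -> 0 <= ent u v.
Proof. by move=> h1 h2; apply: le_trans (ent_ge h1 h2); rewrite divr_ge0// sqr_ge0. Qed.

Lemma ent_diag u : ent u u = 0.
Proof. by rewrite /ent /s; ring. Qed.

Lemma xlnx_ge u : 0 <= u -> u - 1 <= u * ln u.
Proof.
rewrite le_eqVlt => /predU1P[<-|u0]; first by rewrite mul0r; lra.
have := @ln_le_sub1 u^-1; rewrite invr_gt0 lnV ?posrE// => /(_ u0).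
rewrite -(ler_pM2l u0) mulrBr divff ?gt_eqF//; lra.
Qed.

Lemma xlnx_le0 u : 0 <= u <= 1 -> u * ln u <= 0.
Proof. by move=> /andP[u0 u1]; rewrite mulr_ge0_le0// ln_le0. Qed.

Lemma s_bound u : 0 <= u <= 1 -> `|s u| <= 1.
Proof.
move=> /andP[u0 u1]; have := xlnx_ge u0; have := @xlnx_ge (1 - u) ltac:(lra).
have := @xlnx_le0 u ltac:(lra); have := @xlnx_le0 (1 - u) ltac:(lra).
rewrite /s ler_norml; lra.
Qed.

Lemma s0 : s (0 : R) = 0.
Proof. by rewrite /s mul0r subr0 ln1 mulr0 addr0. Qed.

(** This is the square of [cosh (phi / 2)]. *)
Definition kap phi : R := (2 + expR phi + expR (- phi)) / 4.
Definition sg phi : R := expR phi / (1 + expR phi).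
(** With [theta = 1 - b ^+ 2] this is the velocity [P_b] of the overview, and [fvel] is [f_b]. *)
Definition pvel theta phi : R := 1 - theta * kap phi.
Definition fvel theta phi : R := ln (pvel theta phi / (theta * kap phi)).

Lemma sg01 phi : 0 < sg phi < 1.
Proof.
have e0 := expR_gt0 phi; rewrite /sg divr_gt0 ?addr_gt0//=.
by rewrite ltr_pdivrMr ?addr_gt0// mul1r ltrDr.
Qed.

Lemma kap_sg phi : kap phi = (4 * sg phi * (1 - sg phi))^-1.
Proof.
have e0 := expR_gt0 phi; rewrite /kap /sg expRN; field.
by apply/and3P; split; lra.
Qed.

Lemma kap_ge1 phi : 1 <= kap phi.
Proof.
have e0 := expR_gt0 phi; rewrite /kap expRN.
have -> : (2 + expR phi + (expR phi)^-1) / 4 = 1 + (expR phi - 1) ^+ 2 / (4 * expR phi) by field; lra.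
by rewrite lerDl divr_ge0// ?sqr_ge0// mulr_ge0// ltW.
Qed.

Lemma kapN phi : kap (- phi) = kap phi.
Proof. by rewrite /kap opprK; ring. Qed.

Lemma kap_le p phi : 0 <= p -> p <= phi -> kap p <= kap phi.
Proof.
move=> p0 pphi; rewrite /kap !expRN.
have : expR p <= expR phi by rewrite ler_expR.
have : 1 <= expR p by rewrite -expR0 ler_expR.
move: (expR p) (expR phi) => x y x1 xy.
have -> : x^-1 = y^-1 + (y - x) / (x * y) by field; apply/andP; split; lra.
have : (y - x) / (x * y) <= y - x.
  by rewrite ler_pdivrMr ?ler_peMr//; nra.
lra.
Qed.

Lemma kap_le_norm p phi : `|p| <= `|phi| -> kap p <= kap phi.
Proof.
have kn x : kap x = kap `|x|.
  by case: (lerP 0 x) => x0; [rewrite ger0_norm|rewrite ltr0_norm// kapN].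
by move=> h; rewrite kn (kn phi); apply: kap_le.
Qed.

Lemma ln_kap phi : ln (kap phi) = 2 * ln (1 + expR phi) - phi - ln 4.
Proof.
have e0 := expR_gt0 phi.
have -> : kap phi = (1 + expR phi) * (1 + expR phi) / (expR phi * 4).
  by rewrite /kap expRN; field; lra.
rewrite ln_div ?posrE ?mulr_gt0 ?addr_gt0// !lnM ?posrE ?addr_gt0// expRK; ring.
Qed.

Lemma ent_sg u phi : ent u (sg phi) = s u - u * phi + ln (1 + expR phi).
Proof.
have e0 := expR_gt0 phi; rewrite /ent.
have -> : 1 - sg phi = (1 + expR phi)^-1 by rewrite /sg; field; lra.
rewrite /sg ln_div ?posrE ?addr_gt0// lnV ?posrE ?addr_gt0// expRK; ring.
Qed.

Lemma is_derive_kap phi : is_derive phi (1 : R) kap ((expR phi - expR (- phi)) / 4).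
Proof.
have h : is_derive phi (1 : R) (fun x => expR (- x)) (expR (- phi) * - 1).
  exact: (isd_comp (isd_exp _) (isdN (isd_id phi))).
have := isdZ 4^-1 (isdD (isdD (isd_cst 2 phi) (isd_exp phi)) h).
have -> : (fun y => 4^-1 * (2 + expR y + expR (- y))) = kap :> (R -> R).
  by apply/funext => y; rewrite mulrC.
move=> /isd_cast; apply; ring.
Qed.

Lemma is_derive_sg phi : is_derive phi (1 : R) sg (sg phi * (1 - sg phi)).
Proof.
have e0 := expR_gt0 phi.
have n0 : 1 + expR phi != 0 by lra.
have := isdM (isd_exp phi) (isdV (isdD (isd_cst 1 phi) (isd_exp phi)) n0).
by move=> /isd_cast; apply; rewrite /sg; field; lra.
Qed.

Lemma is_derive_fvel theta phi : 0 < theta -> 0 < pvel theta phi ->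
  exists D, is_derive phi (1 : R) (fvel theta) D.
Proof.
move=> t0 p0; have k0 : 0 < theta * kap phi by have := kap_ge1 phi; nra.
have n0 : theta * kap phi != 0 by rewrite gt_eqF.
have h1 := isdZ theta (is_derive_kap phi).
have h2 := isdM (isdB (isd_cst 1 phi) h1) (isdV h1 n0).
have h3 : 0 < pvel theta phi / (theta * kap phi) by exact: divr_gt0.
by have h4 := isd_ln_comp h2 h3; eexists; exact: h4.
Qed.

End Entropy.

Section Calibration.
Context {R : realType} (alpha : R) (alpha01 : 0 < alpha < 1).
Local Notation mu := (@lebesgue_measure R).
Local Notation c := (phip alpha).
Implicit Types (u p t theta phi b : R).

Lemma alpha_sqr_lt1 : 0 < 1 - alpha ^+ 2.
Proof. by have /andP[a0 a1] := alpha01; rewrite subr_gt0 expr_lt1 ?ltW. Qed.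
Local Ltac pull := have /andP[a0 a1] := alpha01; have al2 := alpha_sqr_lt1.

Lemma phipE : expR c = (1 + alpha) / (1 - alpha).
Proof.
pull.
rewrite /phip /ds /up lnK ?posrE; last first.
  by rewrite divr_gt0//; lra.
by field; lra.
Qed.

Lemma phimE : phim alpha = - c.
Proof.
pull.
apply: expR_inj; rewrite expRN phipE /phim /ds /um lnK ?posrE; last first.
  by rewrite divr_gt0//; lra.
by field; lra.
Qed.

Lemma phip_gt0 : 0 < c.
Proof. pull; by rewrite -expR_gt1 phipE ltr_pdivlMr; lra. Qed.

Lemma kap_phip : kap c = (1 - alpha ^+ 2)^-1.
Proof.
pull.
rewrite /kap expRN phipE; field; do ?[apply/andP; split]; lra.
Qed.

Lemma sg_phip : sg c = up alpha.
Proof. pull; by rewrite /sg phipE /up; field; lra. Qed.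

Lemma sg_phim : sg (- c) = um alpha.
Proof. pull; by rewrite /sg expRN phipE /um; field; lra. Qed.

(** On [[- c, c]] the function [kap] is largest at the end points, where it equals
    [(1 - alpha ^+ 2)^-1]; the strict upper bound on [theta] keeps the velocity positive up to
    there. *)
Lemma pvel01 theta phi : 0 < theta < 1 - alpha ^+ 2 -> `|phi| <= c -> 0 < pvel theta phi < 1.
Proof.
pull.
move=> /andP[t0 t1] hc; have k1 := kap_ge1 phi.
have kc : kap phi <= (1 - alpha ^+ 2)^-1.
  rewrite -kap_phip; apply: kap_le_norm; rewrite [leRHS]ger0_norm//.
  exact/ltW/phip_gt0.
rewrite /pvel; apply/andP; split; last by nra.
have : theta * kap phi < 1; last by lra.
apply: (@le_lt_trans _ _ (theta * (1 - alpha ^+ 2)^-1)); first by rewrite ler_pM2l.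
by rewrite ltr_pdivrMr// mul1r.
Qed.

Definition energy theta : R := ln ((1 - alpha ^+ 2) / theta).

(** Once the entropy of [u] is split off, [phi - 2 * ln (1 + expR phi)] remains, which is
    [- ln (kap phi)] up to a constant. The entropy of [p] brings [ln (1 - pvel theta phi) = ln theta
    + ln (kap phi)], which cancels it. *)
Lemma g_calibrated theta u phi p : 0 < theta < 1 - alpha ^+ 2 -> `|phi| <= c ->
  g u phi p - g (up alpha) c 0 =
  ent u (sg phi) + p * fvel theta phi - energy theta + ent p (pvel theta phi).
Proof.
pull.
move=> ht hc; have /andP[t0 t1] := ht.
have /andP[P0 P1] := pvel01 ht hc.
have k1 := kap_ge1 phi.
have tk : 0 < theta * kap phi by nra.
have g0 : g (up alpha) c 0 = c - 2 * ln (1 + expR c).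
  have := ent_diag (up alpha); rewrite -[in X in ent _ X]sg_phip ent_sg /g s0 => h; lra.
have lk := ln_kap c; rewrite kap_phip lnV ?posrE// in lk.
have lk' := ln_kap phi.
rewrite g0 ent_sg /energy ln_div ?posrE// /fvel ln_div ?posrE// /g.
rewrite [in RHS]/ent (_ : 1 - pvel theta phi = theta * kap phi); last by rewrite /pvel; ring.
rewrite lnM ?posrE; [|by []|lra].
nra.
Qed.

(** Outside [[- c, c]] the velocity may turn nonpositive; the truncation makes [fvel] continuous on
    the whole line. *)
Definition clamp x : R := if x < - c then - c else if c < x then c else x.

Lemma clamp_bound x : `|clamp x| <= c.
Proof.
pull.
have c0 := phip_gt0; rewrite ler_norml /clamp; case: ltP => h1; [|case: ltP => h2]; lra.
Qed.

Lemma clamp_id x : `|x| <= c -> clamp x = x.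
Proof.
pull.
by rewrite ler_norml => /andP[h1 h2]; rewrite /clamp !ltNge h1 h2.
Qed.

Lemma clamp_lip x y : `|clamp x - clamp y| <= 1 * `|x - y|.
Proof.
pull.
have c0 := phip_gt0.
rewrite mul1r; wlog xy : x y / x <= y => [h|].
  case: (leP x y) => [/h//|/ltW/h].
  by move=> h1; rewrite distrC (distrC x).
rewrite [leRHS]ler0_norm; last by lra.
rewrite /clamp ler_norml.
do 2 (case: ltP => ?; [|case: ltP => ?]); lra.
Qed.

Definition cvel theta x : R := fvel theta (clamp x).

Lemma cvel_continuous theta : 0 < theta < 1 - alpha ^+ 2 -> continuous (cvel theta).
Proof.
pull.
move=> ht x; apply: (@continuous_comp _ _ _ clamp (fvel theta)).
  exact: (lipschitz_continuous clamp_lip).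
have /andP[t0 _] := ht; have /andP[P0 _] := pvel01 ht (clamp_bound x).
by have [D /isd_continuous] := is_derive_fvel t0 P0.
Qed.

(** The lower limit lies strictly below [- c], so that the primitive is derivable on all of
    [[- c, c]]. *)
Definition action theta x : R := (\int[mu]_(t in `[- c - 1, x]) cvel theta t)%R.

Lemma is_derive_action theta x : 0 < theta < 1 - alpha ^+ 2 -> - c - 1 < x ->
  is_derive x (1 : R) (action theta) (cvel theta x).
Proof. pull; by move=> ht; apply: is_derive_primitive; exact: cvel_continuous. Qed.

Definition halfact theta : R := action theta c - action theta 0.

(** [fvel] is even, so [action x + action (- x)] is constant on [[0, c]]. *)
Lemma action_half theta : 0 < theta < 1 - alpha ^+ 2 ->
  action theta 0 - action theta (- c) = halfact theta.
Proof.
pull.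
move=> ht; have c0 := phip_gt0.
pose h x := action theta x + action theta (- x).
have hd x : - c <= x <= c -> is_derive x (1 : R) h 0.
  move=> xc.
  have d1 := @is_derive_action theta x ht ltac:(lra).
  have d2 := @is_derive_action theta (- x) ht ltac:(lra).
  have := isdD d1 (isd_comp d2 (isdN (isd_id x))).
  move=> /isd_cast; apply.
  rewrite /cvel !clamp_id ?normrN ?ler_norml ?opprK; try lra.
  by rewrite /fvel /pvel kapN; ring.
have le1 : h 0 <= h c by apply: (@isd_ge0_le R h (fun=> 0) 0 c (ltW c0)) => // x xc; apply: hd; lra.
have le2 : - h 0 <= - h c.
  by apply: (@isd_ge0_le R (fun x => - h x) (fun=> - 0)) => [|x xc|x _]; [lra|apply/isdN/hd; lra|lra].
move: le1 le2; rewrite /h /halfact oppr0; lra.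
Qed.

(** In the variable [y = 2 * sg phi - 1] the equation [phi' = P_b phi] reads [y' = (b^2 - y^2) / 2];
    this is its time function, a primitive of [1 / P_b]. *)
Definition ytime b phi : R := b^-1 * (ln (b + (2 * sg phi - 1)) - ln (b - (2 * sg phi - 1))).

Lemma kap_y phi : kap phi = (1 - (2 * sg phi - 1) ^+ 2)^-1.
Proof. pull; by rewrite kap_sg; congr (_^-1); ring. Qed.

Lemma y_bound phi : `|phi| <= c -> `|2 * sg phi - 1| <= alpha.
Proof.
pull.
move=> hc; have e0 := expR_gt0 phi.
have -> : 2 * sg phi - 1 = (expR phi - 1) / (1 + expR phi) by rewrite /sg; field; lra.
have /andP[h1 h2] : expR (- c) <= expR phi <= expR c.
  by rewrite !ler_expR -ler_norml.
rewrite expRN phipE invf_div in h1; rewrite phipE in h2.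
rewrite ler_pdivlMr in h2; last by lra.
rewrite ler_pdivrMr in h1; last by lra.
rewrite ler_norml ler_pdivlMr ?ler_pdivrMr; lra.
Qed.

Lemma is_derive_ytime b phi : alpha < b < 1 -> `|phi| <= c ->
  is_derive phi (1 : R) (ytime b) (pvel (1 - b ^+ 2) phi)^-1.
Proof.
pull.
move=> /andP[ab b1] hc.
have := y_bound hc; rewrite ler_norml => /andP[y1 y2].
have /andP[s0 s1] := sg01 phi.
have d1 := isdB (isdZ 2 (is_derive_sg phi)) (isd_cst 1 phi).
have h1 : 0 < b + (2 * sg phi - 1) by lra.
have h2 : 0 < b - (2 * sg phi - 1) by lra.
have d2 := isd_ln_comp (isdD (isd_cst b phi) d1) h1.
have d3 := isd_ln_comp (isdB (isd_cst b phi) d1) h2.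
move: (isdZ b^-1 (isdB d2 d3)) => /isd_cast; apply.
rewrite /pvel kap_y.
have e1 : 1 - (2 * sg phi - 1) ^+ 2 = 4 * (sg phi * (1 - sg phi)) by ring.
have p0 : 0 < sg phi * (1 - sg phi) by rewrite mulr_gt0//; lra.
move: (h1) (h2) (p0) e1 => H1 H2 H3 e1.
have q0 : 0 < b ^+ 2 - (2 * sg phi - 1) ^+ 2.
  have -> : b ^+ 2 - (2 * sg phi - 1) ^+ 2 = (b + (2 * sg phi - 1)) * (b - (2 * sg phi - 1)) by ring.
  exact: mulr_gt0.
have -> : (1 - (1 - b ^+ 2) * (1 - (2 * sg phi - 1) ^+ 2)^-1)^-1 =
  4 * (sg phi * (1 - sg phi)) / (b ^+ 2 - (2 * sg phi - 1) ^+ 2).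
  rewrite -e1.
  have w0 : 1 - (2 * sg phi - 1) ^+ 2 != 0 by rewrite e1; lra.
  rewrite -[RHS]invf_div; congr (_^-1); move: w0 q0.
  by set w := (2 * sg phi - 1) ^+ 2 => w0 q0; field.
field; do ?[apply/andP; split]; try lra.
Qed.

Lemma ytime_phip b : alpha < b < 1 ->
  ytime b c - ytime b 0 = b^-1 * ln ((b + alpha) / (b - alpha)).
Proof.
pull.
move=> /andP[ab b1]; rewrite /ytime sg_phip /sg expR0 /up.
have -> : 2 * ((1 + alpha) / 2) - 1 = alpha by field.
have -> : 2 * (1 / (1 + 1)) - 1 = 0 :> R by field.
rewrite ln_div ?posrE ?subr_gt0//; last by lra.
by rewrite addr0 subr0; ring.
Qed.

(** The two bounds are the nonnegativity of the relative entropies of the two velocities, taken in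
    both orders. They express that [fvel] has derivative [- 1 / pvel] with respect to [ln theta]. *)
Lemma fvel_cmp theta theta' phi : 0 < theta -> theta < theta' -> theta' < 1 - alpha ^+ 2 -> `|phi| <= c ->
  ln (theta' / theta) * (pvel theta phi)^-1 <= fvel theta phi - fvel theta' phi
  <= ln (theta' / theta) * (pvel theta' phi)^-1.
Proof.
pull.
move=> t0 tt t1 hc.
have ht : 0 < theta < 1 - alpha ^+ 2 by lra.
have ht' : 0 < theta' < 1 - alpha ^+ 2 by lra.
have h := pvel01 ht hc; have h' := pvel01 ht' hc.
have k1 := kap_ge1 phi.
have e1 := @ent_ge0 _ (pvel theta phi) (pvel theta' phi) ltac:(lra) h'.
have e2 := @ent_ge0 _ (pvel theta' phi) (pvel theta phi) ltac:(lra) h.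
rewrite /ent /s in e1 e2.
have E : 1 - pvel theta phi = theta * kap phi by rewrite /pvel; ring.
have E' : 1 - pvel theta' phi = theta' * kap phi by rewrite /pvel; ring.
have l1 : ln (theta * kap phi) = ln theta + ln (kap phi) by rewrite lnM ?posrE//; lra.
have l2 : ln (theta' * kap phi) = ln theta' + ln (kap phi) by rewrite lnM ?posrE//; lra.
case/andP: h => h h1; case/andP: h' => h' h1'.
have fE : fvel theta phi - fvel theta' phi = ln (pvel theta phi) - ln (pvel theta' phi) + ln theta' - ln theta.
  rewrite /fvel !ln_div ?posrE//; [rewrite l1 l2; lra|nra|nra].
rewrite fE ln_div ?posrE; [|lra|lra].
rewrite ler_pdivrMr// ler_pdivlMr//.
rewrite E E' l1 l2 in e1; rewrite E E' l1 l2 in e2.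
move: e1 e2; rewrite -E -E'.
move: (ln _) (ln _) (ln _) (ln _) (ln _) => A B C D F e1 e2.
apply/andP; split; nra.
Qed.

End Calibration.

Section Squeeze.
Context {R : realType}.
Implicit Types (N e tau : R -> R) (x : R).

(* A Stieltjes-type differentiation rule: [dN = tau de] when [tau] is
   nonincreasing. *)
Lemma is_derive_squeeze N e tau x (e' d : R) : 0 < d ->
  (forall y z : R, `|y - x| < d -> `|z - x| < d -> y < z ->
     (e z - e y) * tau z <= N z - N y <= (e z - e y) * tau y) ->
  is_derive x (1 : R) e e' -> {for x, continuous tau} ->
  is_derive x (1 : R) N (e' * tau x).
Proof.
move=> d0 H /is_derive_epsP eP ctau; apply/is_derive_epsP => E E0.
have p1 : 0 < `|e'| + 1 by have := normr_ge0 e'; lra.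
have p2 : 0 < `|tau x| + 1 by have := normr_ge0 (tau x); lra.
pose eta := E / 2 / (`|e'| + 1); pose eta' := Num.min 1 (E / 2 / (`|tau x| + 1)).
have eta0 : 0 < eta by rewrite /eta divr_gt0//; lra.
have eta0' : 0 < eta' by rewrite /eta' lt_min ltr01 divr_gt0//; lra.
have [d1 d10 d1P] := eP eta' eta0'.
have /nbhs_ballP[d2 /= d20 d2P] : nbhs x [set y | `|tau x - tau y| <= eta].
  by move/cvgrPdist_le : ctau; apply.
exists (Num.min d (Num.min d1 d2)); first by rewrite !lt_min d0 d10.
move=> h; rewrite !lt_min => /and3P[hd h1 h2].
have tauh : `|tau (x + h) - tau x| <= eta.
  by rewrite distrC; apply: d2P; rewrite /ball/= opprD addNKr normrN.
have := d1P _ h1; set r := e (x + h) - e x - e' * h => rP.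
have main : `|N (x + h) - N x - (e (x + h) - e x) * tau x| <= `|e (x + h) - e x| * eta.
  have [->|hn0] := eqVneq h 0; first by rewrite addr0 !subrr mul0r subrr normr0 mul0r.
  apply: (@le_trans _ _ (`|(e (x + h) - e x) * (tau (x + h) - tau x)|)); last first.
    by rewrite normrM ler_wpM2l.
  have xx : `|x - x| < d by rewrite subrr normr0.
  have xh : `|x + h - x| < d by rewrite addrAC subrr add0r.
  have [hp|hn] := ltP 0 h.
    have /andP[q1 q2] := H x (x + h) xx xh ltac:(lra).
    rewrite ler0_norm; last by lra.
    by rewrite -normrN; apply: le_trans (ler_norm _); lra.
  have /andP[q1 q2] := H (x + h) x xh xx ltac:(lra).
  rewrite ler0_norm; last by lra.
  by rewrite -normrN; apply: le_trans (ler_norm _); lra.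
have er : `|e (x + h) - e x| <= (`|e'| + 1) * `|h|.
  have -> : e (x + h) - e x = e' * h + r by rewrite /r; ring.
  apply: (le_trans (ler_normD _ _)); rewrite normrM mulrDl lerD2l mul1r.
  apply: (le_trans rP); apply: ler_piMl => //; by rewrite /eta' ge_min lexx.
have -> : N (x + h) - N x - e' * tau x * h =
  (N (x + h) - N x - (e (x + h) - e x) * tau x) + r * tau x by rewrite /r; ring.
apply: (le_trans (ler_normD _ _)).
have b1 : `|e (x + h) - e x| * eta <= E / 2 * `|h|.
  apply: (@le_trans _ _ ((`|e'| + 1) * `|h| * eta)); first by apply: ler_wpM2r => //; exact: ltW.
  by rewrite /eta mulrAC [(_ + 1) * _]mulrC divfK ?gt_eqF.
have b2 : `|r * tau x| <= E / 2 * `|h|.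
  rewrite normrM; apply: (@le_trans _ _ (E / 2 / (`|tau x| + 1) * `|h| * (`|tau x| + 1))).
    apply: ler_pM => //; last by lra.
    apply: (le_trans rP); apply: ler_wpM2r => //; by rewrite /eta' ge_min lexx orbT.
  by rewrite mulrAC divfK ?gt_eqF.
lra.
Qed.

End Squeeze.

(** * The half action [m_b] and its behaviour as [b] tends to [alpha] *)

Section HalfAction.
Context {R : realType} (alpha : R) (alpha01 : 0 < alpha < 1).
Local Notation c := (phip alpha).
Implicit Types (b x : R).
Local Ltac pull := have /andP[a0 a1] := alpha01; have al2 := alpha_sqr_lt1 alpha01.

Definition halfmin b : R := halfact alpha (1 - b ^+ 2).
Definition period b : R := b^-1 * ln ((b + alpha) / (b - alpha)).

Lemma theta01 b : alpha < b < 1 -> 0 < 1 - b ^+ 2 < 1 - alpha ^+ 2.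
Proof. by move=> /andP[ab b1]; pull; apply/andP; split; nra. Qed.

(** The comparison [fvel_cmp] integrated over [[0, c]], with [ytime] as primitive of [1 / pvel].
    Together with [is_derive_squeeze] it spares a differentiation under the integral sign. *)
Lemma halfmin_cmp b b' : alpha < b' -> b' < b -> b < 1 ->
  (- ln (1 - b ^+ 2) - - ln (1 - b' ^+ 2)) * period b <= halfmin b - halfmin b'
  <= (- ln (1 - b ^+ 2) - - ln (1 - b' ^+ 2)) * period b'.
Proof.
set L := - _ - - _ => ab bb b1; pull.
have hb : alpha < b < 1 by lra.
have hb' : alpha < b' < 1 by lra.
have t := theta01 hb; have t' := theta01 hb'.
have tt : 1 - b ^+ 2 < 1 - b' ^+ 2 by nra.
have c0 := phip_gt0 alpha01.
have LE : L = ln ((1 - b' ^+ 2) / (1 - b ^+ 2)).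
  by rewrite /L ln_div ?posrE; [ring|lra|lra].
rewrite /period -!(ytime_phip alpha01)// /halfmin /halfact.
have nx x : 0 <= x <= c -> `|x| <= c by move=> h; rewrite ger0_norm; lra.
have cmp x : 0 < x < c -> L * (pvel (1 - b ^+ 2) x)^-1 <=
    cvel alpha (1 - b ^+ 2) x - cvel alpha (1 - b' ^+ 2) x <= L * (pvel (1 - b' ^+ 2) x)^-1.
  move=> xc; have xc' : `|x| <= c by apply: nx; lra.
  rewrite /cvel clamp_id// LE; apply: (@fvel_cmp _ alpha) => //; lra.
have dA x : 0 <= x <= c -> is_derive x (1 : R) (action alpha (1 - b ^+ 2)) (cvel alpha (1 - b ^+ 2) x).
  by move=> xc; apply: is_derive_action => //; lra.
have dA' x : 0 <= x <= c -> is_derive x (1 : R) (action alpha (1 - b' ^+ 2)) (cvel alpha (1 - b' ^+ 2) x).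
  by move=> xc; apply: is_derive_action => //; lra.
have dy x : 0 <= x <= c -> is_derive x (1 : R) (ytime b) (pvel (1 - b ^+ 2) x)^-1.
  by move=> /nx xc; apply: (@is_derive_ytime _ alpha).
have dy' x : 0 <= x <= c -> is_derive x (1 : R) (ytime b') (pvel (1 - b' ^+ 2) x)^-1.
  by move=> /nx xc; apply: (@is_derive_ytime _ alpha).
have := @isd_ge0_le R (fun x => action alpha (1 - b ^+ 2) x - action alpha (1 - b' ^+ 2) x - L * ytime b x)
  (fun x => cvel alpha (1 - b ^+ 2) x - cvel alpha (1 - b' ^+ 2) x - L * (pvel (1 - b ^+ 2) x)^-1) 0 c (ltW c0).
move=> /(_ (fun x h => isdB (isdB (dA x h) (dA' x h)) (isdZ L (dy x h)))) h1.
have := @isd_ge0_le R (fun x => L * ytime b' x - (action alpha (1 - b ^+ 2) x - action alpha (1 - b' ^+ 2) x))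
  (fun x => L * (pvel (1 - b' ^+ 2) x)^-1 - (cvel alpha (1 - b ^+ 2) x - cvel alpha (1 - b' ^+ 2) x)) 0 c (ltW c0).
move=> /(_ (fun x h => isdB (isdZ L (dy' x h)) (isdB (dA x h) (dA' x h)))) h2.
have {}h1 := h1 (fun x h => ltac:(have /andP[q1 q2] := cmp x h; lra)).
have {}h2 := h2 (fun x h => ltac:(have /andP[q1 q2] := cmp x h; lra)).
by apply/andP; split; lra.
Qed.

Lemma is_derive_halfmin b : alpha < b < 1 ->
  is_derive b (1 : R) halfmin (2 / (1 - b ^+ 2) * ln ((b + alpha) / (b - alpha))).
Proof.
move=> /andP[ab b1]; pull.
have p : 0 < 1 - b ^+ 2 by nra.
pose d := Num.min (b - alpha) (1 - b).
have d0 : 0 < d by rewrite /d lt_min; lra.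
have dI y : `|y - b| < d -> alpha < y < 1.
  by rewrite /d lt_min !ltr_norml; lra.
have he : is_derive b (1 : R) (fun x => - ln (1 - x * x)) (2 * b / (1 - b ^+ 2)).
  have p' : 0 < 1 - b * b by rewrite -expr2.
  have := isdN (isd_ln_comp (isdB (isd_cst 1 b) (isdM (isd_id b) (isd_id b))) p').
  move=> /isd_cast; apply; rewrite expr2; field; lra.
have ct : {for b, continuous period}.
  have h1 : b != 0 by lra.
  have h2 : b - alpha != 0 by lra.
  have h3 : 0 < (b + alpha) / (b - alpha) by rewrite divr_gt0; lra.
  have := isdM (isdV (isd_id b) h1) (isd_ln_comp (isdM (isdD (isd_id b) (isd_cst alpha b))
    (isdV (isdB (isd_id b) (isd_cst alpha b)) h2)) h3).
  exact: isd_continuous.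
have := @is_derive_squeeze R halfmin _ period b _ d d0 _ he ct.
have cmp (y z : R) : `|y - b| < d -> `|z - b| < d -> y < z ->
    (- ln (1 - z * z) - - ln (1 - y * y)) * period z <= halfmin z - halfmin y <=
    (- ln (1 - z * z) - - ln (1 - y * y)) * period y.
  move=> /dI hy /dI hz yz; rewrite -!expr2; apply: halfmin_cmp => //; lra.
by move=> /(_ cmp)/isd_cast; apply; rewrite /period; field; lra.
Qed.

(** The primitive of [k * (A - ln (b - alpha))] that tends to 0 at [alpha]: it integrates the
    logarithmic singularity of the derivative of [halfmin], the regular factors being frozen in [k]
    and [A]. *)
Definition barrier (k A : R) b : R := k * ((b - alpha) * (A - ln (b - alpha)) + (b - alpha)).

Lemma is_derive_barrier k A b : alpha < b ->
  is_derive b (1 : R) (barrier k A) (k * (A - ln (b - alpha))).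
Proof.
move=> ab; have h0 : 0 < b - alpha by lra.
have dd := isdB (isd_id b) (isd_cst alpha b).
have := isdZ k (isdD (isdM dd (isdB (isd_cst A b) (isd_ln_comp dd h0))) dd).
by move=> /isd_cast; apply; field; lra.
Qed.

(** The factors [2 / (1 - x ^+ 2)] and [ln (x + alpha)] increase with [x]. Frozen at [alpha] they
    bound the derivative of [halfmin] from below; [barrier_up] takes them at the right end [b], with
    [b + alpha] enlarged to [2 * b]. *)
Definition barrier_low := barrier (2 / (1 - alpha ^+ 2)) (ln (2 * alpha)).
Definition barrier_up b := barrier (2 / (1 - b ^+ 2)) (ln (2 * b)).

Lemma halfmin_low_mono b b' : alpha < b' -> b' <= b -> b < 1 ->
  halfmin b' - barrier_low b' <= halfmin b - barrier_low b.
Proof.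
move=> ab bb b1; pull.
have dN x : b' <= x <= b -> is_derive x (1 : R) halfmin (2 / (1 - x ^+ 2) * ln ((x + alpha) / (x - alpha))).
  by move=> h; apply: is_derive_halfmin; lra.
have dB x : b' <= x <= b -> is_derive x (1 : R) barrier_low (2 / (1 - alpha ^+ 2) * (ln (2 * alpha) - ln (x - alpha))).
  by move=> h; apply: is_derive_barrier; lra.
apply: (isd_ge0_le bb (fun x h => isdB (dN x h) (dB x h))) => x xb.
rewrite subr_ge0 ln_div ?posrE; [|lra|lra].
have l1 : ln (2 * alpha) <= ln (x + alpha) by rewrite ler_ln ?posrE; lra.
have l2 : ln (x - alpha) <= ln (x + alpha) by rewrite ler_ln ?posrE; lra.
apply: (@le_trans _ _ (2 / (1 - alpha ^+ 2) * (ln (x + alpha) - ln (x - alpha)))).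
  by apply: ler_wpM2l; [rewrite divr_ge0//; lra|lra].
apply: ler_wpM2r; first by lra.
by apply: ler_wpM2l => //; rewrite lef_pV2 ?posrE//; nra.
Qed.

Lemma halfmin_up_mono b b' : alpha < b' -> b' <= b -> b < 1 ->
  halfmin b - barrier_up b b <= halfmin b' - barrier_up b b'.
Proof.
move=> ab bb b1; pull.
have dN x : b' <= x <= b -> is_derive x (1 : R) halfmin (2 / (1 - x ^+ 2) * ln ((x + alpha) / (x - alpha))).
  by move=> h; apply: is_derive_halfmin; lra.
have dB x : b' <= x <= b -> is_derive x (1 : R) (barrier_up b) (2 / (1 - b ^+ 2) * (ln (2 * b) - ln (x - alpha))).
  by move=> h; apply: is_derive_barrier; lra.
suff : barrier_up b b' - halfmin b' <= barrier_up b b - halfmin b by lra.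
apply: (isd_ge0_le bb (fun x h => isdB (dB x h) (dN x h))) => x xb.
rewrite subr_ge0 ln_div ?posrE; [|lra|lra].
have l1 : ln (x + alpha) <= ln (2 * b) by rewrite ler_ln ?posrE; lra.
have l2 : ln (x - alpha) <= ln (x + alpha) by rewrite ler_ln ?posrE; lra.
have p0 : 0 < 1 - b ^+ 2 by nra.
apply: (@le_trans _ _ (2 / (1 - b ^+ 2) * (ln (x + alpha) - ln (x - alpha)))); last first.
  by apply: ler_wpM2l; [rewrite divr_ge0//; lra|lra].
apply: ler_wpM2r; first by lra.
by apply: ler_wpM2l => //; rewrite lef_pV2 ?posrE//; nra.
Qed.

Lemma barrier_up_ge0 b b' : alpha < b' -> b' <= b -> b < 1 -> 0 <= barrier_up b b'.
Proof.
move=> ab bb b1; pull; rewrite /barrier_up /barrier.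
have p0 : 0 < 1 - b ^+ 2 by nra.
have l1 : ln (b' - alpha) <= ln (2 * b) by rewrite ler_ln ?posrE; lra.
apply: mulr_ge0; first by rewrite divr_ge0// ltW.
by apply: addr_ge0; [apply: mulr_ge0; lra|lra].
Qed.

Lemma halfmin_le b b' : alpha < b' -> b' <= b -> b < 1 -> halfmin b' <= halfmin b.
Proof.
move=> ab bb b1; pull.
have dN x : b' <= x <= b -> is_derive x (1 : R) halfmin (2 / (1 - x ^+ 2) * ln ((x + alpha) / (x - alpha))).
  by move=> h; apply: is_derive_halfmin; lra.
apply: (isd_ge0_le bb dN) => x xb.
apply: mulr_ge0; first by rewrite divr_ge0//; nra.
by rewrite ln_ge0// ler_pdivlMr; lra.
Qed.

(** By [minGE] below, half the minimum of [G]. As [halfmin] is nondecreasing, this is its limit at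
    [alpha]. *)
Definition mhalf : R := inf (halfmin @` [set b | alpha < b < 1]).

(** Shows that the infimum [mhalf] is over a set bounded below, and yields the upper estimate
    [halfmin_up]. *)
Lemma halfmin_sub b b' : alpha < b < 1 -> alpha < b' < 1 ->
  halfmin b - barrier_up b b <= halfmin b'.
Proof.
move=> /andP[ab b1] /andP[ab' b1']; have [bb|bb] := leP b' b.
  have := halfmin_up_mono ab' bb b1; have := barrier_up_ge0 ab' bb b1; lra.
have := halfmin_le ab (ltW bb) b1'; have := barrier_up_ge0 ab (lexx b) b1; lra.
Qed.

Lemma mhalf_le b : alpha < b < 1 -> mhalf <= halfmin b.
Proof.
move=> hb; apply: ge_inf; last by exists b.
by exists (halfmin b - barrier_up b b) => _ [b' hb' <-]; exact: halfmin_sub.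
Qed.

Lemma halfmin_up b : alpha < b < 1 -> halfmin b - mhalf <= barrier_up b b.
Proof.
move=> hb; rewrite lerBlDr -lerBlDl.
apply: lb_le_inf; first by exists (halfmin b), b.
by move=> _ [b' hb' <-]; exact: halfmin_sub.
Qed.

Lemma mhalf_adherent e : 0 < e -> exists2 b, alpha < b < 1 & halfmin b < mhalf + e.
Proof.
move=> e0; pull.
have hi : has_inf (halfmin @` [set b | alpha < b < 1]).
  have hb : alpha < (1 + alpha) / 2 < 1 by lra.
  split; first by exists (halfmin ((1 + alpha) / 2)), ((1 + alpha) / 2).
  by exists mhalf => _ [b' hb' <-]; exact: mhalf_le.
by have [_ [b hb <-] lt] := inf_adherent e0 hi; exists b.
Qed.

Lemma barrier_low_small e : 0 < e -> exists2 d : R, 0 < d &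
  forall b, alpha < b -> b < alpha + d -> barrier_low b <= e.
Proof.
move=> e0; pull.
pose k := 2 / (1 - alpha ^+ 2).
have k0 : 0 < k by rewrite divr_gt0.
pose r := Num.min 1 (e / (k * 4)).
have r0 : 0 < r by rewrite lt_min ltr01 divr_gt0//; lra.
exists (r ^+ 2); first by rewrite exprn_gt0.
move=> b ab bd; rewrite /barrier_low /barrier -/k.
set d := b - alpha.
have d0 : 0 < d by rewrite /d; lra.
have dr : Num.sqrt d <= r by rewrite -(ger0_norm (ltW r0)) -sqrtr_sqr ler_wsqrtr// /d; lra.
have sd0 : 0 < Num.sqrt d by rewrite sqrtr_gt0.
(* It bounds [d * (ln (2 * alpha) - ln d)] by [2 * sqrt d * sqrt (2 * alpha)], so the barrier is at
   most of order [sqrt d]. *)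
have h := @entropy_half _ d (2 * alpha) (ltW d0) ltac:(lra).
have s2 : Num.sqrt (2 * alpha) <= 3 / 2.
  apply: (@le_trans _ _ (Num.sqrt ((3 / 2) ^+ 2))); last by rewrite sqrtr_sqr ger0_norm; lra.
  by rewrite ler_wsqrtr//; lra.
have s20 := sqrtr_ge0 (2 * alpha).
have : d * (ln (2 * alpha) - ln d) + d <= 3 * Num.sqrt d by nra.
move=> h2; apply: (@le_trans _ _ (k * (4 * r))).
  by rewrite ler_pM2l//; lra.
have : r <= e / (k * 4) by rewrite /r ge_min lexx orbT.
by rewrite ler_pdivlMr; lra.
Qed.

(** [halfmin - barrier_low] is nondecreasing, and near [alpha] it is at least [mhalf - e], since
    [barrier_low] is small there. *)
Lemma halfmin_low b : alpha < b < 1 -> barrier_low b <= halfmin b - mhalf.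
Proof.
move=> hb; pull; apply/ler_addgt0Pl => e e0.
have [d d0 dP] := barrier_low_small e0.
have /andP[ab b1] := hb.
pose b' := Num.min b (alpha + d / 2).
have h1 : alpha < b' by rewrite lt_min; lra.
have h2 : b' <= b by rewrite ge_min lexx.
have h3 : b' < alpha + d by rewrite gt_min; apply/orP; right; lra.
have := halfmin_low_mono h1 h2 b1; have := dP _ h1 h3.
have := @mhalf_le b' ltac:(lra); lra.
Qed.

End HalfAction.

(** * Profiles and the calibrated lower bound *)

Section Profiles.
Context {R : realType} (alpha : R) (alpha01 : 0 < alpha < 1).
Local Notation mu := (@lebesgue_measure R).
Local Notation c := (phip alpha).
Local Notation "'I' a b f" := (\int[mu]_(x in `[a, b]) (f x))%R (at level 10, a, b, f at level 9).
Implicit Types (u phi d : R -> R) (x y : R).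
Local Ltac pull := have /andP[a0 a1] := alpha01; have al2 := alpha_sqr_lt1 alpha01.

(** Versions of [u] and of the derivative for which the bounds hold everywhere, so that pointwise
    inequalities integrate without exceptional sets; only [prof_der] is almost everywhere. *)
Record profile u phi d : Prop := Profile {
  prof_mu : measurable_fun setT u;
  prof_u01 : forall x, 0 <= u x <= 1;
  prof_md : measurable_fun setT d;
  prof_d01 : forall x, 0 <= d x <= 1;
  prof_lip : forall x y, `|phi x - phi y| <= 1 * `|x - y|;
  prof_mono : {homo phi : x y / x <= y};
  prof_bound : forall x, `|phi x| <= c;
  prof_der : \forall x \ae mu, is_derive x (1 : R) phi (d x) }.

Definition lag u phi d x : R := g (u x) (phi x) (d x) - g (up alpha) c 0.

(** Applied to [x - phi x], the monotonicity criterion turns [phi' <= 1] into a Lipschitz bound. *)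
Lemma lac_id_sub phi : locally_absolutely_continuous phi ->
  locally_absolutely_continuous (fun x => x - phi x).
Proof.
move=> hphi a b ab e e0.
have [d d0 dP] := hphi a b ab (e / 2) ltac:(lra).
exists (Num.min d (e / 2)); first by rewrite lt_min d0; lra.
move=> n c1 c1ab tr; rewrite lt_min => /andP[h1 h2].
have le2 := dP n c1 c1ab tr h1.
apply: (@le_lt_trans _ _ (\sum_(i < n) (((c1 i).2 - (c1 i).1) + `|phi (c1 i).2 - phi (c1 i).1|))).
  apply: ler_sum => i _; have [_ [le12 _]] := c1ab i.
  have -> : (c1 i).2 - phi (c1 i).2 - ((c1 i).1 - phi (c1 i).1) =
    ((c1 i).2 - (c1 i).1) - (phi (c1 i).2 - phi (c1 i).1) by ring.
  by apply: (le_trans (ler_normB _ _)); rewrite ger0_norm//; lra.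
by rewrite big_split/=; lra.
Qed.

Lemma in_C_mono phi : in_C alpha phi -> {homo phi : x y / x <= y}.
Proof.
by move=> [ac der _ _]; apply: ac_nondecreasing => //; apply: ae_imp der => x [? /andP[]].
Qed.

Lemma in_C_lip phi : in_C alpha phi -> forall x y, `|phi x - phi y| <= 1 * `|x - y|.
Proof.
move=> hC; have mono := in_C_mono hC; have [ac der _ _] := hC.
have mono' : {homo (fun x => x - phi x) : x y / x <= y}.
  apply: ac_nondecreasing; first exact: lac_id_sub.
  apply: ae_imp der => x [dx /andP[_ le1]].
  have := isdB (isd_id x) (derivable_is_derive1 dx).
  by move=> h; have [h1 h2] := h; split => //; rewrite derive1E h2 subr_ge0.
move=> x y; rewrite mul1r; have [xy|/ltW yx] := leP x y.
  have := mono _ _ xy; have /= := mono' _ _ xy => h1 h2.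
  by rewrite !ler0_norm; lra.
have := mono _ _ yx; have /= := mono' _ _ yx => h1 h2.
by rewrite !ger0_norm; lra.
Qed.

Lemma in_C_bound phi : in_C alpha phi -> forall x, `|phi x| <= c.
Proof.
move=> hC; have mono := in_C_mono hC; have [_ _ lm lp] := hC.
move=> x; rewrite ler_norml -(phimE alpha01); apply/andP; split.
  apply/ler_addgt0Pl => e e0.
  have /(cvgr_ge _ lm) [M [_ MP]] : phim alpha - e < phim alpha by lra.
  pose y := Num.min x (M - 1).
  have h1 : y <= x by rewrite ge_min lexx.
  have : y < M by rewrite gt_min; apply/orP; right; lra.
  move=> /MP h2; have := mono _ _ h1; lra.
apply/ler_addgt0Pl => e e0.
have /(cvgr_le _ lp) [M [_ MP]] : c < c + e by lra.
pose y := Num.max x (M + 1).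
have h1 : x <= y by rewrite le_max lexx.
have : M < y by rewrite lt_max; apply/orP; right; lra.
move=> /MP h2; have := mono _ _ h1; lra.
Qed.

(** Both functions are set to 0 on the exceptional null set; the derivative is then measurable as an
    everywhere limit of difference quotients. *)
Lemma X_profile (x : X alpha) : exists u d, profile u (Xphi x) d /\
  exists2 N : set R, measurable N /\ mu N = 0%E &
    forall y, ~ N y -> u y = Xu x y /\ d y = derive1 (Xphi x) y.
Proof.
have hC : in_C alpha (Xphi x) by exact: (set_valP x.2).
have [ac [N1 [mN1 N10 N1P]] _ _] := hC.
have [N2 [mN2 N20 N2P]] : \forall y \ae mu, 0 <= Xu x y <= 1 by exact: (set_valP x.1).
set phi := Xphi x.
pose N := N1 `|` N2.
have mN : measurable N by exact: measurableU.
have N0 : mu N = 0%E.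
  apply/eqP; rewrite eq_le measure_ge0 andbT.
  by apply: (le_trans (measureU2 _ mN1 mN2)); rewrite /= [X in (X + _)%E]N10 [X in (_ + X)%E]N20 adde0.
have der y : ~ N y -> derivable phi y 1 /\ 0 <= derive1 phi y <= 1.
  by move=> Ny; apply: contrapT => /N1P ?; apply: Ny; left.
have u01 y : ~ N y -> 0 <= Xu x y <= 1.
  by move=> Ny; apply: contrapT => /N2P ?; apply: Ny; right.
have mNC : measurable (~` N) by exact: measurableC.
have mI : measurable_fun setT (\1_(~` N) : R -> R) by exact: measurable_indic.
pose u y : R := Xu x y * \1_(~` N) y.
pose d y : R := derive1 phi y * \1_(~` N) y.
have in1 y : ~ N y -> \1_(~` N) y = 1 :> R by move=> Ny; rewrite indicE mem_set.
have in0 y : N y -> \1_(~` N) y = 0 :> R.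
  by move=> Ny; rewrite indicE memNset// => /(_ Ny).
have lip := in_C_lip hC.
have cphi := lipschitz_continuous lip.
exists u, d; split; last first.
  by exists N => // y Ny; rewrite /u /d in1// !mulr1.
split => //.
- apply: measurable_funM => //; exact: (measurable_funPT (repr (val x.1))).
- move=> y; rewrite /u; have [Ny|Ny] := pselect (N y).
    by rewrite in0// mulr0 lexx ler01.
  by rewrite in1// mulr1; exact: u01.
- apply: (@measurable_fun_cvg _ _ _ _
    (fun n y => n.+1%:R * (phi (y + n.+1%:R^-1) - phi y) * \1_(~` N) y)).
    move=> n; apply: measurable_funM => //; apply: continuous_measurable_fun => y.
    apply: cvgM; first exact: cvg_cst.
    apply: cvgB; last exact: cphi.
    apply: (@continuous_comp _ _ _ (fun y => y + n.+1%:R^-1) phi); last exact: cphi.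
    by apply: cvgD; [exact: cvg_id|exact: cvg_cst].
  move=> y _; rewrite /d; have [Ny|Ny] := pselect (N y).
    by rewrite in0// mulr0; under eq_fun do rewrite mulr0; exact: cvg_cst.
  apply: cvgM; last exact: cvg_cst.
  by apply: is_derive_seq_quot; apply: derivable_is_derive1; have [] := der _ Ny.
- move=> y; rewrite /d; have [Ny|Ny] := pselect (N y).
    by rewrite in0// mulr0 lexx ler01.
  by rewrite in1// mulr1; have [] := der _ Ny.
- exact: in_C_mono.
- exact: in_C_bound.
- exists N; split => // y /= nd; apply: contrapT => Ny; apply: nd.
  by rewrite /d in1// mulr1; apply: derivable_is_derive1; have [] := der _ Ny.
Qed.

Lemma G_ell_profile (x : X alpha) u d l :
  (exists2 N : set R, measurable N /\ mu N = 0%E &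
    forall y, ~ N y -> u y = Xu x y /\ d y = derive1 (Xphi x) y) ->
  domB l x ->
  G_ell l x = (\int[mu]_(y in `[(- l)%R, l]) (lag u (Xphi x) d y)%:E)%E.
Proof.
move=> [N [mN N0] NP] dB; rewrite /G_ell asboolT//.
apply: (@integral_null_eq _ _ R mu _ N _ _ mN N0) => y _ Ny.
by have [eu ed] := NP y Ny; rewrite /lag eu ed.
Qed.

Lemma bmeas_s u : measurable_fun setT u -> (forall x, 0 <= u x <= 1) -> bmeas (fun x => s (u x)).
Proof.
move=> hu u01; split; last by exists 1 => x; exact: s_bound.
have hu' : measurable_fun setT (fun x => 1 - u x) by exact: measurable_funB.
by apply: measurable_funD; apply: measurable_funM => //; apply: (measurableT_comp (@measurable_ln R)).
Qed.

Section WithProfile.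
Variables (u phi d : R -> R).
Hypothesis pr : profile u phi d.

Let cphi : continuous phi := lipschitz_continuous (prof_lip pr).

Lemma bmeas_cphi h : continuous h -> bmeas (fun x => h (phi x)).
Proof. by move=> ch; apply: (bmeas_continuous ch cphi (prof_bound pr)). Qed.

Lemma bmeas01 (f : R -> R) : measurable_fun setT f -> (forall x, 0 <= f x <= 1) -> bmeas f.
Proof.
move=> mf f01; split => //; exists 1 => x; have := f01 x.
by move=> /andP[? ?]; rewrite ger0_norm.
Qed.

Lemma bmeas_u : bmeas u.
Proof. exact: bmeas01 (prof_mu pr) (prof_u01 pr). Qed.

Lemma bmeas_d : bmeas d.
Proof. exact: bmeas01 (prof_md pr) (prof_d01 pr). Qed.

Lemma bmeas_entu : bmeas (fun x => ent (u x) (sg (phi x))).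
Proof.
have -> : (fun x => ent (u x) (sg (phi x))) = (fun x => s (u x) - u x * phi x + ln (1 + expR (phi x))).
  by apply/funext => x; rewrite ent_sg.
apply: bmeasD; first apply: bmeasB.
- exact: bmeas_s (prof_mu pr) (prof_u01 pr).
- apply: bmeasM; first exact: bmeas_u.
  by apply: (@bmeas_cphi id) => x; exact: cvg_id.
- apply: (@bmeas_cphi (fun x => ln (1 + expR x))) => x.
  have h : 0 < 1 + expR x by have := expR_gt0 x; lra.
  exact: isd_continuous (isd_ln_comp (isdD (isd_cst 1 x) (isd_exp x)) h).
Qed.

Lemma pvel_clamp_continuous theta : continuous (fun x => pvel theta (clamp alpha x)).
Proof.
move=> x; apply: (@continuous_comp _ _ _ (clamp alpha) (pvel theta)).
  exact: (lipschitz_continuous (clamp_lip alpha01)).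
exact: isd_continuous (isdB (isd_cst 1 _) (isdZ theta (is_derive_kap _))).
Qed.

Lemma bmeas_entd theta : 0 < theta < 1 - alpha ^+ 2 ->
  bmeas (fun x => ent (d x) (pvel theta (phi x))).
Proof.
move=> ht; rewrite /ent.
(* The truncation is inserted because the logarithms of [pvel] and [1 - pvel] have to be continuous
   on the whole line. *)
have cid x : clamp alpha (phi x) = phi x by apply: (clamp_id alpha01); exact: (prof_bound pr x).
have h01 x : 0 < pvel theta (clamp alpha x) < 1 by apply: (pvel01 alpha01 ht); exact: (clamp_bound alpha01).
apply: bmeasB; first apply: bmeasB.
- exact: bmeas_s (prof_md pr) (prof_d01 pr).
- apply: bmeasM; first exact: bmeas_d.
  have -> : (fun x => ln (pvel theta (phi x))) = (fun x => ln (pvel theta (clamp alpha (phi x)))).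
    by apply/funext => x; rewrite cid.
  apply: (@bmeas_cphi (fun x => ln (pvel theta (clamp alpha x)))) => x.
  have /andP[h0 _] := h01 x.
  by apply: (@continuous_comp _ _ _ (fun x => pvel theta (clamp alpha x)) (@ln R));
    [exact: pvel_clamp_continuous|exact: continuous_ln].
- apply: bmeasM; first by apply: bmeasB; [exact: bmeas_cst|exact: bmeas_d].
  have -> : (fun x => ln (1 - pvel theta (phi x))) = (fun x => ln (1 - pvel theta (clamp alpha (phi x)))).
    by apply/funext => x; rewrite cid.
  apply: (@bmeas_cphi (fun x => ln (1 - pvel theta (clamp alpha x)))) => x.
  have h0 : 0 < 1 - pvel theta (clamp alpha x) by have := h01 x; lra.
  apply: (@continuous_comp _ _ _ (fun x => 1 - pvel theta (clamp alpha x)) (@ln R));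
    last exact: continuous_ln.
  by apply: cvgB; [exact: cvg_cst|exact: pvel_clamp_continuous].
Qed.

Lemma bmeas_cvel theta : 0 < theta < 1 - alpha ^+ 2 -> bmeas (fun x => cvel alpha theta (phi x)).
Proof. by move=> ht; apply: bmeas_cphi; exact: cvel_continuous. Qed.

Lemma lagE theta : 0 < theta < 1 - alpha ^+ 2 ->
  lag u phi d = (fun x => ent (u x) (sg (phi x)) + ent (d x) (pvel theta (phi x)) +
    (cvel alpha theta (phi x) * d x - energy alpha theta)).
Proof.
move=> ht; apply/funext => x; rewrite /lag (g_calibrated alpha01 _ _ ht (prof_bound pr x)).
by rewrite /cvel clamp_id ?(prof_bound pr x)//; ring.
Qed.

(** Prepares [lipschitz_FTC] for the composite [action \o phi]; [cvel] is bounded on [[- c, c]] and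
    [phi] is 1-Lipschitz. *)
Lemma action_lip theta : 0 < theta < 1 - alpha ^+ 2 -> exists L : R,
  forall x y, `|action alpha theta (phi x) - action alpha theta (phi y)| <= L * `|x - y|.
Proof.
move=> ht; have c0 := phip_gt0 alpha01.
have cn : {within `[- c, c], continuous (fun x => `|cvel alpha theta x|)}.
  apply: continuous_subspaceT => x.
  apply: (@continuous_comp _ _ _ (cvel alpha theta) (fun y : R => `|y|)); last exact: norm_continuous.
  exact: cvel_continuous.
have [|m _ mP] := EVT_max _ cn; first by lra.
set M := `|cvel alpha theta m| in mP.
have M0 : 0 <= M by exact: normr_ge0.
have key y z : - c <= y -> y <= z -> z <= c ->
    `|action alpha theta z - action alpha theta y| <= M * (z - y).
  move=> cy yz zc.
  have dA x : y <= x <= z -> is_derive x (1 : R) (action alpha theta) (cvel alpha theta x).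
    by move=> h; apply: is_derive_action => //; lra.
  have bd x : y < x < z -> `|cvel alpha theta x| <= M.
    by move=> h; apply: mP; rewrite in_itv/=; lra.
  have h1 := isd_ge0_le yz (fun x h => isdB (isdZ M (isd_id x)) (dA x h)).
  have h2 := isd_ge0_le yz (fun x h => isdD (isdZ M (isd_id x)) (dA x h)).
  have {}h1 := h1 (fun x h => ltac:(have := bd x h; rewrite ler_norml => /andP[q1 q2]; lra)).
  have {}h2 := h2 (fun x h => ltac:(have := bd x h; rewrite ler_norml => /andP[q1 q2]; lra)).
  by rewrite ler_norml; apply/andP; split; lra.
exists M => x y; wlog xy : x y / x <= y => [h|].
  case: (leP x y) => [/h//|/ltW/h].
  by move=> h1; rewrite distrC (distrC x).
rewrite distrC (distrC x).
have mo := prof_mono pr xy.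
have b1 := prof_bound pr x; have b2 := prof_bound pr y.
rewrite !ler_norml in b1 b2.
have := key (phi x) (phi y) ltac:(lra) mo ltac:(lra).
move=> h; apply: (le_trans h); apply: ler_wpM2l => //.
have := prof_lip pr y x; rewrite mul1r; apply: le_trans; exact: ler_norm.
Qed.

Lemma itg_cvel theta a b : 0 < theta < 1 - alpha ^+ 2 -> a <= b ->
  I a b (fun x => cvel alpha theta (phi x) * d x) =
  action alpha theta (phi b) - action alpha theta (phi a).
Proof.
move=> ht ab; have [L hL] := action_lip ht.
have bm : bmeas (fun x => cvel alpha theta (phi x) * d x).
  by apply: bmeasM; [exact: bmeas_cvel|exact: bmeas_d].
apply: EFin_inj; rewrite -itg_EFin//.
apply: (lipschitz_FTC ab (lipschitz_continuous hL) (fun x y _ _ => hL x y) bm.1).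
apply: ae_imp (prof_der pr) => x dx _.
have b1 := prof_bound pr x; rewrite ler_norml in b1.
have c0 := phip_gt0 alpha01.
by apply: (isd_comp _ dx); apply: is_derive_action => //; lra.
Qed.

Lemma bmeas_lag : bmeas (lag u phi d).
Proof.
pull; have ht : 0 < (1 - alpha ^+ 2) / 2 < 1 - alpha ^+ 2 by lra.
rewrite (lagE ht); apply: bmeasD.
  by apply: bmeasD; [exact: bmeas_entu|exact: bmeas_entd].
apply: bmeasB; last exact: bmeas_cst.
by apply: bmeasM; [exact: bmeas_cvel|exact: bmeas_d].
Qed.

Lemma itg_lag theta a b : 0 < theta < 1 - alpha ^+ 2 -> a <= b ->
  I a b (lag u phi d) =
  I a b (fun x => ent (u x) (sg (phi x)) + ent (d x) (pvel theta (phi x))) +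
  (action alpha theta (phi b) - action alpha theta (phi a) - energy alpha theta * (b - a)).
Proof.
move=> ht ab; rewrite (lagE ht).
have bm : bmeas (fun x => cvel alpha theta (phi x) * d x).
  by apply: bmeasM; [exact: bmeas_cvel|exact: bmeas_d].
rewrite itgD; last 2 first.
- by apply: bmeasD; [exact: bmeas_entu|exact: bmeas_entd].
- by apply: bmeasB => //; exact: bmeas_cst.
by rewrite itgB ?itg_cvel ?itg_cst//; exact: bmeas_cst.
Qed.

(** Both entropies are dropped; what is left depends on [phi] through its end values only. *)
Lemma itg_lag_ge theta a b : 0 < theta < 1 - alpha ^+ 2 -> a <= b ->
  action alpha theta (phi b) - action alpha theta (phi a) - energy alpha theta * (b - a)
  <= I a b (lag u phi d).
Proof.
move=> ht ab; rewrite (itg_lag ht ab) lerDr.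
apply: Rintegral_ge0 => x _; apply: addr_ge0; apply: ent_ge0.
- exact: (prof_u01 pr).
- exact: sg01.
- exact: (prof_d01 pr).
- apply: (pvel01 alpha01 ht); exact: (prof_bound pr).
Qed.

End WithProfile.
End Profiles.

(** * Extremals *)

Section Wave.
Context {R : realType}.
Implicit Types (b x y : R).

(** The solution of [y' = (b^2 - y^2) / 2] vanishing at 0, where [y = 2 * sg phi - 1]; [wave b] is
    the corresponding solution of [phi' = P_b phi]. *)
Definition wave_y b x : R := b * tanh (b * x / 2).
Definition wave b x : R := ds (1 / 2 + wave_y b x / 2).

Lemma is_derive_tanh x : is_derive x (1 : R) tanh (1 - tanh x ^+ 2).
Proof.
have e0 := expR_gt0 x; have e1 := expR_gt0 (- x).
have dN : is_derive x (1 : R) (fun y => expR (- y)) (expR (- x) * - 1).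
  exact: (isd_comp (isd_exp _) (isdN (isd_id x))).
have n0 : expR x + expR (- x) != 0 by lra.
have := isdM (isdB (isd_exp x) dN) (isdV (isdD (isd_exp x) dN) n0).
by move=> /isd_cast; apply; rewrite /tanh; field.
Qed.

Lemma tanh_exp x : tanh x = (expR (x + x) - 1) / (expR (x + x) + 1).
Proof.
have e0 := expR_gt0 x; rewrite /tanh expRN expRD; field.
have : 0 < expR x * expR x by exact: mulr_gt0.
by move: (expR x * expR x) => t t0; do ?[apply/andP; split]; lra.
Qed.

Lemma tanh_bound x : `|tanh x| < 1.
Proof.
have e0 := expR_gt0 (x + x); rewrite tanh_exp ltr_norml ltr_pdivlMr ?ltr_pdivrMr; lra.
Qed.

Lemma wave_y_bound b x : 0 < b -> `|wave_y b x| < b.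
Proof.
by move=> b0; rewrite /wave_y normrM gtr0_norm// gtr_pMr// tanh_bound.
Qed.

Lemma is_derive_wave_y b x : is_derive x (1 : R) (wave_y b) ((b ^+ 2 - wave_y b x ^+ 2) / 2).
Proof.
have d1 : is_derive x (1 : R) (fun x => b * x / 2) (b / 2).
  have := isdM (isdZ b (isd_id x)) (isd_cst (2^-1) x).
  by move=> /isd_cast; apply; ring.
have := isdZ b (isd_comp (is_derive_tanh _) d1).
by move=> /isd_cast; apply; rewrite /wave_y; field.
Qed.

Lemma sg_ds (u : R) : 0 < u < 1 -> sg (ds u) = u.
Proof.
move=> /andP[u0 u1]; rewrite /sg /ds lnK ?posrE ?divr_gt0//; last by lra.
by field; lra.
Qed.

Lemma sg_wave b x : 0 < b < 1 -> sg (wave b x) = 1 / 2 + wave_y b x / 2.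
Proof.
move=> /andP[b0 b1]; rewrite sg_ds//.
have := wave_y_bound x b0; rewrite ltr_norml; lra.
Qed.

Lemma is_derive_wave b x : 0 < b < 1 ->
  is_derive x (1 : R) (wave b) (pvel (1 - b ^+ 2) (wave b x)).
Proof.
move=> hb; have /andP[b0 b1] := hb.
have := wave_y_bound x b0; rewrite ltr_norml => /andP[y1 y2].
rewrite /pvel kap_sg sg_wave//.
have dw : is_derive x (1 : R) (fun x => 1 / 2 + wave_y b x / 2) ((b ^+ 2 - wave_y b x ^+ 2) / 4).
  have := isdD (isd_cst (1 / 2) x) (isdM (is_derive_wave_y b x) (isd_cst (2^-1) x)).
  by move=> /isd_cast; apply; field.
set w := 1 / 2 + wave_y b x / 2.
have w0 : 0 < w by rewrite /w; lra.
have w1 : 0 < 1 - w by rewrite /w; lra.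
have wn : 1 - w != 0 by lra.
have h : 0 < w / (1 - w) by exact: divr_gt0.
have := isd_ln_comp (isdM dw (isdV (isdB (isd_cst 1 x) dw) wn)) h.
move=> /isd_cast; apply.
have -> : wave_y b x = 2 * w - 1 by rewrite /w; field.
rewrite -/w; field.
by do ?[apply/andP; split]; lra.
Qed.

Lemma wave0 b : wave b 0 = 0.
Proof.
rewrite /wave /wave_y mulr0 mul0r /tanh oppr0 subrr mul0r mulr0 mul0r addr0 /ds.
by have -> : 1 / 2 / (1 - 1 / 2) = 1 :> R; [field|rewrite ln1].
Qed.

Lemma tanhN x : tanh (- x) = - tanh x.
Proof. by rewrite /tanh opprK -mulNr opprB [X in _ / X = _]addrC. Qed.

Lemma waveN b x : 0 < b < 1 -> wave b (- x) = - wave b x.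
Proof.
move=> /andP[b0 b1]; have := wave_y_bound x b0; rewrite ltr_norml => /andP[y1 y2].
rewrite /wave.
have -> : wave_y b (- x) = - wave_y b x by rewrite /wave_y mulrN mulNr tanhN mulrN.
rewrite /ds -lnV; last by rewrite posrE divr_gt0; lra.
by congr ln; field; apply/andP; split; lra.
Qed.

Lemma pvel_wave b x : 0 < b < 1 -> 0 < pvel (1 - b ^+ 2) (wave b x) < 1.
Proof.
move=> hb; have /andP[b0 b1] := hb; have := wave_y_bound x b0; rewrite ltr_norml => /andP[y1 y2].
rewrite /pvel kap_sg sg_wave//.
have -> : 4 * (1 / 2 + wave_y b x / 2) * (1 - (1 / 2 + wave_y b x / 2)) = 1 - wave_y b x ^+ 2 by field.
have p : 0 < 1 - wave_y b x ^+ 2 by nra.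
have : 0 < (1 - b ^+ 2) / (1 - wave_y b x ^+ 2) < 1.
  by rewrite divr_gt0 ?ltr_pdivrMr//; nra.
lra.
Qed.

Lemma wave_mono_lip b x y : 0 < b < 1 -> x <= y -> 0 <= wave b y - wave b x <= y - x.
Proof.
move=> hb xy.
have dw t : x <= t <= y -> is_derive t (1 : R) (wave b) (pvel (1 - b ^+ 2) (wave b t)).
  by move=> _; exact: is_derive_wave.
have h1 := isd_ge0_le xy dw (fun t _ => ltac:(have := pvel_wave t hb; lra)).
have h2 := isd_ge0_le xy (fun t h => isdB (isd_id t) (dw t h)) (fun t _ => ltac:(have := pvel_wave t hb; lra)).
by move: h1 h2 => /= h1 h2; apply/andP; split; lra.
Qed.

Lemma wave_lt b x y : 0 < b < 1 -> x < y -> wave b x < wave b y.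
Proof.
move=> hb xy; rewrite lt_neqAle; have /andP[h _] := wave_mono_lip hb (ltW xy).
apply/andP; split; last by lra.
apply/eqP => e.
have /andP[b0 b1] := hb.
have : sg (wave b x) = sg (wave b y) by rewrite e.
rewrite !sg_wave// => e2.
have : tanh (b * x / 2) = tanh (b * y / 2).
  apply: (mulfI (_ : b != 0)); first by lra.
  by rewrite -/(wave_y b x) -/(wave_y b y); lra.
rewrite !tanh_exp.
have lte : expR (b * x / 2 + b * x / 2) < expR (b * y / 2 + b * y / 2).
  by rewrite ltr_expR; nra.
move: lte (expR_gt0 (b * x / 2 + b * x / 2)).
move: (expR _) (expR _) => s t st s0 e3.
have : (s - 1) * (t + 1) = (t - 1) * (s + 1).
  apply/eqP; rewrite -eqr_div; [exact/eqP|lra|lra].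
nra.
Qed.

End Wave.

Section Extremals.
Context {R : realType} (alpha : R) (alpha01 : 0 < alpha < 1).
Local Notation mu := (@lebesgue_measure R).
Local Notation c := (phip alpha).
Local Notation "'I' a b f" := (\int[mu]_(x in `[a, b]) (f x))%R (at level 10, a, b, f at level 9).
Implicit Types (b x y z : R).
Local Ltac pull := have /andP[a0 a1] := alpha01; have al2 := alpha_sqr_lt1 alpha01;
  have c0 := phip_gt0 alpha01.

Lemma wave_period b : alpha < b < 1 -> wave b (period alpha b) = c.
Proof.
move=> /andP[ab b1]; pull.
have E : expR (b * period alpha b) = (b + alpha) / (b - alpha).
  rewrite /period mulrA divff ?mul1r ?lnK ?posrE ?divr_gt0//; lra.
rewrite /wave /phip; congr ds; rewrite /up /wave_y tanh_exp -splitr E.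
by field; do ?[apply/andP; split]; lra.
Qed.

Lemma period_gt0 b : alpha < b < 1 -> 0 < period alpha b.
Proof.
move=> /andP[ab b1]; pull; rewrite /period mulr_gt0 ?invr_gt0//; first by lra.
by rewrite ln_gt0// ltr_pdivlMr; lra.
Qed.

Lemma phibar_wave : phibar alpha = wave alpha.
Proof.
apply/funext => x; rewrite /phibar /ubar /wave /wave_y; congr ds; ring.
Qed.

Lemma sg_phibar x : sg (phibar alpha x) = ubar alpha x.
Proof. by rewrite phibar_wave sg_wave// /ubar /wave_y; ring. Qed.

Lemma clamp_mono x y : x <= y -> 0 <= clamp alpha y - clamp alpha x <= y - x.
Proof.
pull; move=> xy; rewrite /clamp.
do 2 (case: ltP => ?; [|case: ltP => ?]); lra.
Qed.

Variables (b1 b2 z : R).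
Hypotheses (hb1 : alpha < b1 < 1) (hb2 : alpha < b2 < 1).

Let T1 := period alpha b1.
Let T2 := period alpha b2.

(** The extremals of parameters [b1] to the right of [z] and [b2] to the left, stopped at the end
    values. One summand is always 0, and since [max x z + min x z = x + z], monotonicity and the
    Lipschitz bound of the sum follow without distinguishing cases. *)
Definition rec_phi x : R :=
  clamp alpha (wave b1 (Num.max x z - z)) + clamp alpha (wave b2 (Num.min x z - z)).

Definition rec_d x : R :=
  if z <= x <= z + T1 then pvel (1 - b1 ^+ 2) (rec_phi x)
  else if z - T2 <= x < z then pvel (1 - b2 ^+ 2) (rec_phi x) else 0.

Let h01 b : alpha < b < 1 -> 0 < b < 1.
Proof. by pull; lra. Qed.

Lemma clamp0 : clamp alpha 0 = 0.
Proof. by pull; rewrite /clamp !ltNge; case: ifPn; [lra|case: ifPn => //; lra]. Qed.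

Lemma rec_phi_right x : z <= x <= z + T1 -> rec_phi x = wave b1 (x - z).
Proof.
move=> /andP[zx xT]; pull; rewrite /rec_phi max_l// min_r// subrr wave0 clamp0 addr0.
have /andP[m1 _] := @wave_mono_lip _ b1 0 (x - z) (h01 hb1) ltac:(lra).
have /andP[m2 _] := @wave_mono_lip _ b1 (x - z) T1 (h01 hb1) ltac:(lra).
rewrite wave0 in m1; rewrite wave_period// in m2.
by rewrite clamp_id// ger0_norm; lra.
Qed.

Lemma rec_phi_left x : z - T2 <= x <= z -> rec_phi x = wave b2 (x - z).
Proof.
move=> /andP[zx xT]; pull; rewrite /rec_phi max_r// min_l// subrr wave0 clamp0 add0r.
have /andP[m1 _] := @wave_mono_lip _ b2 (x - z) 0 (h01 hb2) ltac:(lra).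
have /andP[m2 _] := @wave_mono_lip _ b2 (- T2) (x - z) (h01 hb2) ltac:(lra).
rewrite wave0 in m1; rewrite waveN ?wave_period// in m2; last exact: h01.
by rewrite clamp_id// ler0_norm; lra.
Qed.

Lemma rec_phi_top x : z + T1 <= x -> rec_phi x = c.
Proof.
move=> xT; pull; have t1 : 0 < T1 by exact: period_gt0.
rewrite /rec_phi max_l ?min_r; [|lra|lra]; rewrite subrr wave0 clamp0 addr0.
have /andP[m1 _] := @wave_mono_lip _ b1 T1 (x - z) (h01 hb1) ltac:(lra).
rewrite wave_period// in m1.
rewrite /clamp; case: ltP => [|_]; first by lra.
by case: ltP => //; lra.
Qed.

Lemma rec_phi_bot x : x <= z - T2 -> rec_phi x = - c.
Proof.
move=> xT; pull; have t1 : 0 < T2 by exact: period_gt0.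
rewrite /rec_phi max_r ?min_l; [|lra|lra]; rewrite subrr wave0 clamp0 add0r.
have /andP[m1 _] := @wave_mono_lip _ b2 (x - z) (- T2) (h01 hb2) ltac:(lra).
rewrite waveN ?wave_period// in m1; last exact: h01.
rewrite /clamp; case: ltP => // h1; case: ltP; lra.
Qed.

Lemma rec_phi_z : rec_phi z = 0.
Proof.
by have t1 : 0 < T1 by [exact: period_gt0]; rewrite rec_phi_right ?subrr ?wave0//; lra.
Qed.

Lemma rec_phi_mono_lip x y : x <= y -> 0 <= rec_phi y - rec_phi x <= y - x.
Proof.
move=> xy; rewrite /rec_phi.
have h1 : Num.max x z <= Num.max y z by rewrite ge_max !le_max xy lexx orbT.
have h2 : Num.min x z <= Num.min y z by rewrite le_min !ge_min xy lexx orbT.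
have e : Num.max y z - Num.max x z + (Num.min y z - Num.min x z) = y - x.
  have := addr_max_min x z; have := addr_max_min y z; lra.
have /andP[w1 w1'] := @wave_mono_lip _ b1 (Num.max x z - z) (Num.max y z - z) (h01 hb1) ltac:(lra).
have /andP[w2 w2'] := @wave_mono_lip _ b2 (Num.min x z - z) (Num.min y z - z) (h01 hb2) ltac:(lra).
have /andP[q1 q1'] := @clamp_mono _ _ (etrans (esym (subr_ge0 _ _)) w1).
have /andP[q2 q2'] := @clamp_mono _ _ (etrans (esym (subr_ge0 _ _)) w2).
rewrite opprB addrA subrK in w1'; rewrite opprB addrA subrK in w2'.
rewrite opprD addrACA -e; apply/andP; split; first exact: addr_ge0.
by apply: lerD; [exact: le_trans q1' w1'|exact: le_trans q2' w2'].
Qed.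

Lemma rec_phi_bound x : `|rec_phi x| <= c.
Proof.
pull; have t1 : 0 < T1 by exact: period_gt0.
have t2 : 0 < T2 by exact: period_gt0.
rewrite ler_norml.
pose lo := Num.min x (z - T2); pose hi := Num.max x (z + T1).
have /andP[m1 _] := @rec_phi_mono_lip lo x ltac:(by rewrite ge_min lexx).
have /andP[m2 _] := @rec_phi_mono_lip x hi ltac:(by rewrite le_max lexx).
rewrite (@rec_phi_bot lo) in m1; last by rewrite ge_min lexx orbT.
rewrite (@rec_phi_top hi) in m2; last by rewrite le_max lexx orbT.
by apply/andP; split; lra.
Qed.

Lemma rec_lip x y : `|rec_phi x - rec_phi y| <= 1 * `|x - y|.
Proof.
rewrite mul1r; have [xy|/ltW xy] := leP x y; have := rec_phi_mono_lip xy => /andP[m1 m2].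
  by rewrite distrC [leRHS]distrC !ger0_norm ?subr_ge0// -subr_ge0.
by rewrite !ger0_norm ?subr_ge0// -subr_ge0.
Qed.

Lemma rec_der x : x != z -> x != z + T1 -> x != z - T2 ->
  is_derive x (1 : R) rec_phi (rec_d x).
Proof.
move=> xz xT1 xT2; pull.
have t1 : 0 < T1 by exact: period_gt0.
have t2 : 0 < T2 by exact: period_gt0.
rewrite /rec_d.
have dsh b : 0 < b < 1 -> is_derive x (1 : R) (fun y => wave b (y - z)) (pvel (1 - b ^+ 2) (wave b (x - z))).
  move=> hb; have := @isd_comp _ (wave b) (fun y => y - z) x _ _ (is_derive_wave (x - z) hb) (isdB (isd_id x) (isd_cst z x)).
  by move=> /isd_cast; apply; ring.
have [hx|hx] := ltP x z.
  rewrite /= andbT; have [hx2|hx2] := leP (z - T2) x.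
    have {xT2} hx2 : z - T2 < x by rewrite lt_neqAle hx2 eq_sym xT2.
    rewrite rec_phi_left; last by lra.
    apply: (@isd_near _ (fun y => wave b2 (y - z)) _ _ _ (Num.min (x - (z - T2)) (z - x))); last exact: dsh (h01 hb2).
      by rewrite lt_min; lra.
    move=> y; rewrite lt_min !ltr_norml => hy; rewrite rec_phi_left//; lra.
  apply: (@isd_near _ (fun=> - c) _ _ _ (z - T2 - x)).
    by lra.
  by move=> y; rewrite ltr_norml => hy; rewrite rec_phi_bot//; lra.
have {xz} hx : z < x by rewrite lt_neqAle hx eq_sym xz.
rewrite /= andbF.
have [hx2|hx2] := leP x (z + T1).
  have {xT1} hx2 : x < z + T1 by rewrite lt_neqAle hx2 xT1.
  rewrite rec_phi_right; last by lra.
  apply: (@isd_near _ (fun y => wave b1 (y - z)) _ _ _ (Num.min (x - z) (z + T1 - x))); last exact: dsh (h01 hb1).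
    by rewrite lt_min; lra.
  move=> y; rewrite lt_min !ltr_norml => hy; rewrite rec_phi_right//; lra.
apply: (@isd_near _ (fun=> c) _ _ _ (x - (z + T1))).
  by lra.
by move=> y; rewrite ltr_norml => hy; rewrite rec_phi_top//; lra.
Qed.

Lemma rec_profile : profile alpha (fun x => sg (rec_phi x)) rec_phi rec_d.
Proof.
have cphi := lipschitz_continuous rec_lip.
have cs b : continuous (fun x => pvel (1 - b ^+ 2) (rec_phi x)).
  move=> x; apply: (@continuous_comp _ _ _ rec_phi (pvel (1 - b ^+ 2))); first exact: cphi.
  exact: isd_continuous (isdB (isd_cst 1 _) (isdZ _ (is_derive_kap _))).
split.
- apply: continuous_measurable_fun => x.
  by apply: (@continuous_comp _ _ _ rec_phi sg); [exact: cphi|exact: isd_continuous (is_derive_sg _)].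
- by move=> x; have := sg01 (rec_phi x); lra.
- have -> : rec_d = (fun x => pvel (1 - b1 ^+ 2) (rec_phi x) * \1_(`[z, z + T1]%classic) x +
      pvel (1 - b2 ^+ 2) (rec_phi x) * \1_(`[z - T2, z[%classic) x).
    apply/funext => x; rewrite /rec_d !indicE !mem_setE !in_itv/=.
    case: ifPn => [/andP[h1 h2]|_].
      by rewrite [X in _ && X]ltNge h1 andbF mulr1 mulr0 addr0.
    by case: ifPn => _; rewrite ?mulr0 ?mulr1 add0r.
  by apply: measurable_funD; apply: measurable_funM => //; exact: continuous_measurable_fun.
- move=> x; rewrite /rec_d; case: ifPn => _.
    by have := pvel01 alpha01 (theta01 alpha01 hb1) (rec_phi_bound x); lra.
  case: ifPn => _; last by rewrite lexx ler01.
  by have := pvel01 alpha01 (theta01 alpha01 hb2) (rec_phi_bound x); lra.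
- exact: rec_lip.
- by move=> x y /rec_phi_mono_lip; lra.
- exact: rec_phi_bound.
- exists [set z; z + T1; z - T2]; split.
  + by apply: measurableU => //; apply: measurableU.
  + by apply: countable_lebesgue_measure0; apply: finite_set_countable.
  + move=> x /= nd; apply: contrapT => h; apply: nd.
    apply: rec_der; apply/eqP => e; apply: h; rewrite e; [left; left|left; right|right] => //.
Qed.

Lemma itg_eq_oo (f h : R -> R) x y : (forall t, x < t < y -> f t = h t) -> I x y f = I x y h.
Proof.
move=> fh; rewrite /Rintegral; congr fine.
apply: (@integral_null_eq _ _ R mu _ [set x; y]).
- exact: measurableU.
- by apply: countable_lebesgue_measure0; apply: finite_set_countable.
move=> t /=; rewrite in_itv/= => /andP[t1 t2] nt; rewrite fh//.
rewrite !lt_neqAle t1 t2 !andbT; apply/andP; split; apply/eqP => e; apply: nt; [left|right] => //.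
Qed.

(** In the calibrated form at [p = 0] the entropy of [u] vanishes on both sides, and [kap] is
    even. *)
Lemma g_end : g (um alpha) (- c) 0 = g (up alpha) c 0.
Proof.
pull; have ht : 0 < (1 - alpha ^+ 2) / 2 < 1 - alpha ^+ 2 by lra.
have hc : `|- c| <= c by rewrite normrN ger0_norm// ltW.
have hc' : `|c| <= c by rewrite ger0_norm// ltW.
have := g_calibrated alpha01 (um alpha) 0 ht hc.
have := g_calibrated alpha01 (up alpha) 0 ht hc'.
rewrite sg_phim// sg_phip// !ent_diag !mul0r /pvel kapN; lra.
Qed.

Lemma rec_action l : - l <= z - T2 -> z + T1 <= l ->
  I (- l) l (lag alpha (fun x => sg (rec_phi x)) rec_phi rec_d) =
  (halfmin alpha b1 - energy alpha (1 - b1 ^+ 2) * T1) +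
  (halfmin alpha b2 - energy alpha (1 - b2 ^+ 2) * T2).
Proof.
move=> lz zl; pull.
have t1 : 0 < T1 by exact: period_gt0.
have t2 : 0 < T2 by exact: period_gt0.
have bl := bmeas_lag alpha01 rec_profile.
rewrite (itg_cat (b := z - T2) bl)//; last by lra.
rewrite (itg_cat (a := z - T2) (b := z) bl); [|lra|lra].
rewrite (itg_cat (a := z) (b := z + T1) bl); [|lra|lra].
have zero x y (f : R -> R) : x <= y -> (forall t, x < t < y -> f t = 0) -> I x y f = 0.
  by move=> xy f0; rewrite (itg_eq_oo (h := fun=> 0))// itg_cst// mul0r.
have -> : I (- l) (z - T2) (lag alpha (fun x => sg (rec_phi x)) rec_phi rec_d) = 0.
  apply: zero => // t ht; rewrite /lag /rec_d rec_phi_bot; last by lra.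
  rewrite ifF; last by apply/negbTE; rewrite negb_and -!ltNge; apply/orP; left; lra.
  rewrite ifF; last by apply/negbTE; rewrite negb_and -!ltNge; apply/orP; left; lra.
  by rewrite sg_phim// g_end subrr.
have -> : I (z + T1) l (lag alpha (fun x => sg (rec_phi x)) rec_phi rec_d) = 0.
  apply: zero => // t ht; rewrite /lag /rec_d rec_phi_top; last by lra.
  rewrite ifF; last by apply/negbTE; rewrite negb_and -!ltNge; apply/orP; right; lra.
  rewrite ifF; last by apply/negbTE; rewrite negb_and -!ltNge -leNgt; apply/orP; right; lra.
  by rewrite sg_phip// subrr.
have ht1 := theta01 alpha01 hb1; have ht2 := theta01 alpha01 hb2.
rewrite (itg_lag alpha01 rec_profile ht2); last by lra.
rewrite (itg_lag alpha01 rec_profile ht1); last by lra.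
rewrite zero; [|lra|]; last first.
  move=> t ht; rewrite ent_diag /rec_d ifF; last first.
    by apply/negbTE; rewrite negb_and -!ltNge; apply/orP; left; lra.
  by rewrite ifT ?ent_diag ?addr0//; lra.
rewrite zero; [|lra|]; last first.
  by move=> t ht; rewrite ent_diag /rec_d ifT ?ent_diag ?addr0//; lra.
rewrite rec_phi_z (rec_phi_top (lexx (z + T1))) (rec_phi_bot (lexx (z - T2))).
rewrite (action_half alpha01 ht2) /halfmin /halfact; ring.
Qed.

End Extremals.

(** * Elements of the phase space with prescribed profile *)

Section MkMfun.
Context {R : realType}.
Local Notation mu := (@lebesgue_measure R).
Variables (u : R -> R) (mu_ : measurable_fun setT u).

Definition mk_mfun : {mfun measurableTypeR R >-> measurableTypeR R} :=
  mfun_Sub (mem_set mu_ : (u : measurableTypeR R -> measurableTypeR R) \in mfun).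

Lemma mk_mfunE : repr (\pi_({mfun_ mu, measurableTypeR R >-> measurableTypeR R})%qT mk_mfun)
   = u %[ae mu].
Proof.
have : \pi_({mfun_ mu, measurableTypeR R >-> measurableTypeR R})%qT
  (repr (\pi_({mfun_ mu, measurableTypeR R >-> measurableTypeR R})%qT mk_mfun)) =
  \pi_({mfun_ mu, measurableTypeR R >-> measurableTypeR R})%qT mk_mfun by rewrite reprK.
by move=> /eqmodP/asboolP.
Qed.

End MkMfun.

Section Elements.
Context {R : realType} (alpha : R) (alpha01 : 0 < alpha < 1).
Local Notation mu := (@lebesgue_measure R).

Lemma Linf01_exists (u : R -> R) : measurable_fun setT u -> (forall x, 0 <= u x <= 1) ->
  exists U : Linf01 R, \forall x \ae mu, Linf01_fun U x = u x.
Proof.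
move=> hu u01.
pose v := (\pi_({mfun_ mu, measurableTypeR R >-> measurableTypeR R})%qT (mk_mfun hu)).
have vE : \forall x \ae mu, (repr v) x = u x.
  by apply: ae_imp (mk_mfunE hu) => x; apply.
have hv : v \in [set u : {mfun_ mu, measurableTypeR R >-> measurableTypeR R} |
     \forall x \ae mu, 0 <= u x <= 1].
  by rewrite inE /=; apply: ae_imp vE => x vx; rewrite /aqEqMfun_to_fun vx; exact: u01.
by exists (exist _ v hv).
Qed.

Lemma lipschitz_lac (phi : R -> R) : (forall x y, `|phi x - phi y| <= 1 * `|x - y|) ->
  locally_absolutely_continuous phi.
Proof.
move=> lip a b ab e e0; exists e => // n c1 c1ab _ h.
apply: le_lt_trans h; apply: ler_sum => i _.
have [_ [le12 _]] := c1ab i.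
by have := lip (c1 i).2 (c1 i).1; rewrite mul1r => /le_trans; apply; rewrite ger0_norm//; lra.
Qed.

Lemma profile_in_C u phi d : profile alpha u phi d ->
  phi x @[x --> -oo] --> phim alpha -> phi x @[x --> +oo] --> phip alpha -> in_C alpha phi.
Proof.
move=> pr lm lp; split => //.
  exact: lipschitz_lac (prof_lip pr).
apply: ae_imp (prof_der pr) => x dx; have [h1 h2] := dx; split => //.
by rewrite derive1E h2; exact: (prof_d01 pr).
Qed.

Lemma X_exists u phi d : profile alpha u phi d -> in_C alpha phi ->
  exists x : X alpha, Xphi x = phi /\ \forall y \ae mu, Xu x y = u y.
Proof.
move=> pr hC; have [U UP] := Linf01_exists (prof_mu pr) (prof_u01 pr).
have hphi : (phi : {uniform R -> R}) \in C_set alpha by rewrite inE.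
by exists (U, exist _ (phi : {uniform R -> R}) hphi).
Qed.

Lemma rec_exists (b1 b2 z l : R) : alpha < b1 < 1 -> alpha < b2 < 1 ->
  - l <= z - period alpha b2 -> z + period alpha b1 <= l ->
  exists x : X alpha, [/\ domB l x, Xphi x = rec_phi alpha b1 b2 z,
    \forall y \ae mu, Xu x y = sg (Xphi x y) &
    G_ell l x = ((halfmin alpha b1 - energy alpha (1 - b1 ^+ 2) * period alpha b1) +
      (halfmin alpha b2 - energy alpha (1 - b2 ^+ 2) * period alpha b2))%:E].
Proof.
move=> hb1 hb2 lz zl.
have pr := rec_profile alpha01 z hb1 hb2.
have [|x [xphi xu]] := X_exists pr.
  apply: (profile_in_C pr).
    rewrite (phimE alpha01); apply: cvg_near_cst.
    exists (z - period alpha b2); split; first exact: num_real.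
    by move=> y /ltW; exact: rec_phi_bot.
  apply: cvg_near_cst; exists (z + period alpha b1); split; first exact: num_real.
  by move=> y /ltW; exact: rec_phi_top.
have dB : domB l x.
  split.
  - apply: ae_imp xu => y -> yl; rewrite rec_phi_bot//; last by lra.
    exact: sg_phim.
  - by move=> y yl; rewrite xphi rec_phi_bot ?phimE//; lra.
  - apply: ae_imp xu => y -> yl; rewrite rec_phi_top//; last by lra.
    exact: sg_phip.
  - by move=> y yl; rewrite xphi rec_phi_top//; lra.
exists x; split => //; first by rewrite xphi.
rewrite -(rec_action alpha01 hb1 hb2 lz zl) -itg_EFin; last exact: bmeas_lag.
rewrite -xphi; apply: G_ell_profile => //.
have [N1 [mN1 N10 N1P]] := xu.
have [N2 [mN2 N20 N2P]] := prof_der pr.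
exists (N1 `|` N2).
  split; first exact: measurableU.
  apply/eqP; rewrite eq_le measure_ge0 andbT.
  by apply: (le_trans (measureU2 _ mN1 mN2)); rewrite /= [X in (X + _)%E]N10 [X in (_ + X)%E]N20 adde0.
move=> y Ny; split.
  have -> : Xu x y = sg (rec_phi alpha b1 b2 z y).
    by apply: contrapT => h; apply: Ny; left; apply: N1P.
  by rewrite xphi.
have [h1 h2] : is_derive y (1 : R) (rec_phi alpha b1 b2 z) (rec_d alpha b1 b2 z y).
  by apply: contrapT => h; apply: Ny; right; apply: N2P.
by rewrite xphi derive1E h2.
Qed.

End Elements.

(** * The minimum of the limit functional *)

Section NullUnion.
Context d (T : measurableType d) (R : realType) (mu : {measure set T -> \bar R}).

Lemma null_setU (N1 N2 : set T) : measurable N1 -> measurable N2 -> mu N1 = 0%E -> mu N2 = 0%E ->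
  measurable (N1 `|` N2) /\ mu (N1 `|` N2) = 0%E.
Proof.
move=> mN1 mN2 N10 N20; split; first exact: measurableU.
apply/eqP; rewrite eq_le measure_ge0 andbT.
by apply: (le_trans (measureU2 _ mN1 mN2)); rewrite /= [X in (X + _)%E]N10 [X in (_ + X)%E]N20 adde0.
Qed.

End NullUnion.

Section Minimum.
Context {R : realType} (alpha : R) (alpha01 : 0 < alpha < 1).
Local Notation mu := (@lebesgue_measure R).
Local Notation c := (phip alpha).
Local Notation "'I' a b f" := (\int[mu]_(x in `[a, b]) (f x))%R (at level 10, a, b, f at level 9).
Local Ltac pull := have /andP[a0 a1] := alpha01; have al2 := alpha_sqr_lt1 alpha01;
  have c0 := phip_gt0 alpha01.

Lemma integral_supp (N : set R) (f : R -> \bar R) (h : R -> R) (l : R) :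
  measurable N -> mu N = 0%E -> bmeas h ->
  (forall y, ~ N y -> f y = if (- l <= y <= l) then (h y)%:E else 0%E) ->
  (\int[mu]_y f y)%E = (I (- l) l h)%:E.
Proof.
move=> mN N0 bh fh; rewrite -itg_EFin// [RHS]integral_mkcond.
apply: (@integral_null_eq _ _ R mu _ N _ _ mN N0) => y _ Ny.
rewrite patchE fh//; case: ifPn => hy.
  by rewrite mem_set//= in_itv.
by rewrite memNset//= in_itv/=; exact/negP.
Qed.

Lemma bmeas_step (am ap : R) : bmeas (step am ap).
Proof.
have -> : step am ap = (fun x => am + (ap - am) * \1_(`[0, +oo[%classic) x).
  apply/funext => x; rewrite /step indicE; case: ltP => x0.
    by rewrite memNset ?mulr0 ?addr0//= in_itv/= leNgt x0.
  by rewrite mem_set ?mulr1 ?subrKC//= in_itv/= x0.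
apply: bmeasD; first exact: bmeas_cst.
apply: bmeasM; first exact: bmeas_cst.
split; first exact: measurable_indic.
by exists 1 => x; rewrite indicE; case: (_ \in _); rewrite ?normr1 ?normr0.
Qed.

Lemma step_neg (am ap y : R) : y < 0 -> step am ap y = am.
Proof. by rewrite /step => ->. Qed.

Lemma step_pos (am ap y : R) : 0 <= y -> step am ap y = ap.
Proof. by rewrite /step ltNge => ->. Qed.

Lemma domB_out (x : X alpha) l : domB l x -> 0 < l -> exists2 N : set R, measurable N /\ mu N = 0%E &
  forall y, ~ N y -> ~~ (- l <= y <= l) ->
   [/\ Xu x y = step (um alpha) (up alpha) y, Xphi x y = step (phim alpha) c y &
      derive1 (Xphi x) y = 0].
Proof.
move=> [[N1 [mN1 N10 N1P]] hm [N2 [mN2 N20 N2P]] hp] l0.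
exists (N1 `|` N2); first exact: (@null_setU _ _ R mu N1 N2 mN1 mN2 N10 N20).
move=> y Ny; rewrite negb_and -!ltNge => /orP[yl|ly].
  have e1 : Xu x y = um alpha.
    apply: contrapT => h; apply: Ny; left; apply: N1P => /= h'; apply: h; apply: h'; lra.
  rewrite e1 hm; last by lra.
  rewrite !step_neg; [split => //|lra..].
  have [_] : is_derive y (1 : R) (Xphi x) 0.
    apply: (@isd_near _ (fun=> phim alpha) _ _ _ (- l - y)); first by lra.
    by move=> t; rewrite ltr_norml => ht; rewrite hm//; lra.
  by rewrite derive1E.
have e1 : Xu x y = up alpha.
  apply: contrapT => h; apply: Ny; right; apply: N2P => /= h'; apply: h; apply: h'; lra.
rewrite e1 hp; last by lra.
rewrite !step_pos; [split => //|lra..].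
have [_] : is_derive y (1 : R) (Xphi x) 0.
  apply: (@isd_near _ (fun=> c) _ _ _ (y - l)); first by lra.
  by move=> t; rewrite ltr_norml => ht; rewrite hp//; lra.
by rewrite derive1E.
Qed.

(** Outside [[- l, l]] the element agrees with the step functions, so both norms are integrals of
    bounded functions over a segment, and the integrand vanishes there. *)
Lemma domB_G (x : X alpha) l : domB l x -> 0 < l -> G x = G_ell l x.
Proof.
move=> dB l0; have [u [d [pr [N1 [mN1 N10] N1P]]]] := X_profile alpha01 x.
have [N2 [mN2 N20] N2P] := domB_out dB l0.
have [mN N0] := @null_setU _ _ R mu N1 N2 mN1 mN2 N10 N20.
have bphi : bmeas (Xphi x) by apply: (@bmeas_cphi _ _ _ _ _ pr id) => y; exact: cvg_id.
have fin2 : ('N[mu]_2%:E [EFin \o (fun y => Xu x y - step (um alpha) (up alpha) y)%R] < +oo)%E.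
  have n2 : (2 : R) != 0 by lra.
  have := powR_Lnorm mu (EFin \o (fun y => Xu x y - step (um alpha) (up alpha) y)%R) n2.
  set v := Lnorm _ _ _.
  rewrite (@integral_supp (N1 `|` N2) _ (fun y => (u y - step (um alpha) (up alpha) y) * (u y - step (um alpha) (up alpha) y)) l)//; last 2 first.
  - have b : bmeas (fun y => u y - step (um alpha) (up alpha) y).
      by apply: bmeasB; [exact: bmeas_u pr|exact: bmeas_step].
    exact: bmeasM.
  - move=> y Ny.
    have [eu _] := N1P y (fun h => Ny (or_introl h)).
    rewrite /= powR_mulrn// -expr2 real_normK ?num_real// -eu.
    case: ifPn => // hy.
    have [e1 _ _] := N2P y (fun h => Ny (or_intror h)) hy.
    by rewrite eu e1 subrr expr0n.
  have v0 : (0 <= v)%E by exact: Lnorm_ge0.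
  clearbody v; case: v v0 => [r||] //= _; first by rewrite ltry.
  by rewrite (negbTE n2).
have fin1 : ('N[mu]_1 [EFin \o (fun y => Xphi x y - step (phim alpha) c y)%R] < +oo)%E.
  rewrite Lnorm1 (@integral_supp (N1 `|` N2) _ (fun y => `|Xphi x y - step (phim alpha) c y|) l)// ?ltry//.
  - by apply: bmeas_norm; apply: bmeasB => //; exact: bmeas_step.
  - move=> y Ny; rewrite /=; case: ifPn => // hy.
    have [_ e1 _] := N2P y (fun h => Ny (or_intror h)) hy.
    by rewrite e1 subrr normr0.
rewrite /G asboolT; last by rewrite /domD lte_add_pinfty.
rewrite (@integral_supp (N1 `|` N2) _ (lag alpha u (Xphi x) d) l)//; last 2 first.
- exact: bmeas_lag pr.
- move=> y Ny; have [eu ed] := N1P y (fun h => Ny (or_introl h)).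
  case: ifPn => hy; first by rewrite /lag eu ed.
  have [e1 e2 e3] := N2P y (fun h => Ny (or_intror h)) hy.
  rewrite /integrand e1 e2 e3 /step (phimE alpha01); case: ifP => _; last by rewrite subrr.
  by rewrite g_end// subrr.
rewrite -itg_EFin; last exact: bmeas_lag pr.
by apply/esym/G_ell_profile => //; exists N1.
Qed.

(** Used with [a = 1 - alpha ^+ 2] and [b = alpha + del]: a density [En] of order [del] contributes
    at most [e] over a window of length [2 * l]. *)
Lemma energy_length_le (En L l a e del : R) : 0 <= En -> l <= L -> 0 < L -> 0 < a ->
  En * a <= 4 * del -> del * (8 * L) <= e * a -> En * (l + l) <= e.
Proof.
move=> En0 lL L0 a0 h1 h2; rewrite -(ler_pM2r a0).
have h3 : En * a * L <= 4 * del * L by rewrite ler_pM2r.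
have h4 : En * a * l <= En * a * L by apply: ler_wpM2l => //; apply: mulr_ge0 => //; exact: ltW.
lra.
Qed.

Lemma energy_le b d : alpha < b -> b - alpha <= d -> 4 * d <= 1 - alpha ^+ 2 ->
  [/\ b < 1, 0 <= energy alpha (1 - b ^+ 2), energy alpha (1 - b ^+ 2) <= 4 * d / (1 - alpha ^+ 2)
    & (1 - alpha ^+ 2) / 2 <= 1 - b ^+ 2].
Proof.
move=> ab bd d4; pull.
have b1 : b < 1 by nra.
have p : (1 - alpha ^+ 2) / 2 <= 1 - b ^+ 2 by nra.
have q : 1 - b ^+ 2 <= 1 - alpha ^+ 2 by nra.
have p0 : 0 < 1 - b ^+ 2 by lra.
split => //; rewrite /energy.
  by rewrite ln_ge0// ler_pdivlMr// mul1r.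
apply: (le_trans (ln_le_sub1 _)); first by rewrite divr_gt0.
have -> : (1 - alpha ^+ 2) / (1 - b ^+ 2) - 1 = (b ^+ 2 - alpha ^+ 2) / (1 - b ^+ 2) by field; lra.
rewrite ler_pdivrMr// mulrAC ler_pdivlMr//.
have h1 : b ^+ 2 - alpha ^+ 2 <= 2 * d by nra.
have d0 : 0 < d by lra.
nra.
Qed.

(** Uniform up to [theta = 1 - alpha ^+ 2], where [fvel] is unbounded below at the end values;
    completing a truncated transition needs an upper bound only. *)
Lemma fvel_ub theta t : (1 - alpha ^+ 2) / 2 <= theta -> theta < 1 - alpha ^+ 2 -> `|t| <= c ->
  fvel theta t <= ln (2 / (1 - alpha ^+ 2)).
Proof.
move=> h1 h2 hc; pull.
have ht : 0 < theta < 1 - alpha ^+ 2 by lra.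
have /andP[P0 P1] := pvel01 alpha01 ht hc.
have k1 := kap_ge1 t.
have tk : 0 < theta * kap t by nra.
have tk' : theta <= theta * kap t by rewrite ler_peMr//; lra.
rewrite ler_ln ?posrE ?divr_gt0//.
rewrite ler_pdivrMr// mulrAC ler_pdivlMr//; nra.
Qed.

Lemma fourth_bound {F : realFieldType} (M e t : F) : 0 <= M -> 0 < e ->
  t <= e / (4 * (M + 1)) -> M * t <= e / 4.
Proof.
move=> M0 e0; rewrite ler_pdivlMr; [|lra] => h.
have [t0|t0] := leP 0 t; first by nra.
by have : M * t <= 0; [nra|lra].
Qed.

Section Lower.
Variables (u phi d : R -> R).
Hypothesis pr : profile alpha u phi d.
Local Notation M := (ln (2 / (1 - alpha ^+ 2))).

Lemma action_ub theta x y : (1 - alpha ^+ 2) / 2 <= theta -> theta < 1 - alpha ^+ 2 ->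
  - c <= x -> x <= y -> y <= c -> action alpha theta y - action alpha theta x <= M * (y - x).
Proof.
move=> h1 h2 cx xy yc; pull.
have ht : 0 < theta < 1 - alpha ^+ 2 by lra.
have dA t : x <= t <= y -> is_derive t (1 : R) (action alpha theta) (cvel alpha theta t).
  by move=> h; apply: is_derive_action => //; lra.
have := isd_ge0_le xy (fun t h => isdB (isdZ M (isd_id t)) (dA t h)).
have bd t : x < t < y -> 0 <= M * 1 - cvel alpha theta t.
  move=> h; have tc : `|t| <= c by rewrite ler_norml; lra.
  by rewrite mulr1 subr_ge0 /cvel (clamp_id alpha01 tc); exact: fvel_ub.
move=> /(_ bd) /=; lra.
Qed.

(** Calibration on a window, with [b] so close to [alpha] that the energy term is at most [e]. The
    missing action, from [- c] to [phi (- L)] and from [phi L] to [c], is at most [M] times the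
    gaps. *)
Lemma lag_lower (L : R) : 0 <= L ->
  2 * mhalf alpha - M * (c - phi L) - M * (phi (- L) + c) <= I (- L) L (lag alpha u phi d).
Proof.
move=> L0; pull; apply/ler_addgt0Pl => e e0.
pose del := Num.min ((1 - alpha ^+ 2) / 4) (e * (1 - alpha ^+ 2) / (8 * (L + 1))).
have del0 : 0 < del by rewrite lt_min !divr_gt0 ?mulr_gt0//; lra.
pose b := alpha + del.
have h4 : 4 * del <= 1 - alpha ^+ 2.
  have : del <= (1 - alpha ^+ 2) / 4 by rewrite ge_min lexx.
  lra.
have [b1 E0 E1 th] := @energy_le b del ltac:(rewrite /b; lra) ltac:(rewrite /b; lra) h4.
have hb : alpha < b < 1 by rewrite b1 /b; lra.
have ht := theta01 alpha01 hb.
have pL := prof_bound pr L; have pL' := prof_bound pr (- L).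
rewrite ler_norml in pL; rewrite ler_norml in pL'.
have ge := itg_lag_ge alpha01 pr ht (_ : - L <= L).
have {}ge := ge ltac:(lra).
have u1 := @action_ub (1 - b ^+ 2) (phi L) c th ltac:(lra) ltac:(lra) ltac:(lra) (lexx c).
have u2 := @action_ub (1 - b ^+ 2) (- c) (phi (- L)) th ltac:(lra) (lexx _) ltac:(lra) ltac:(lra).
have hh := action_half alpha01 ht.
have hm := mhalf_le alpha01 hb.
rewrite /halfmin /halfact in hm; rewrite /halfact in hh.
have eL : energy alpha (1 - b ^+ 2) * (L - - L) <= e.
  have L1 : 0 < L + 1 by rewrite ltr_wpDl.
  rewrite opprK; apply: (energy_length_le E0 _ L1 al2 (del := del)); first by rewrite lerDl.
    by rewrite -ler_pdivlMr.
  by rewrite -ler_pdivlMr ?mulr_gt0// ge_min lexx orbT.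
lra.
Qed.

(** At [p = 0] the calibrated integrand is [ent u (sg phi) - ln ((1 - alpha ^+ 2) * kap phi)], and
    the logarithm is nonpositive because [kap] is largest at [c]. *)
Lemma lag_ge_s x : s (d x) <= lag alpha u phi d x.
Proof.
pull; have ht : 0 < (1 - alpha ^+ 2) / 2 < 1 - alpha ^+ 2 by lra.
have := g_calibrated alpha01 (u x) 0 ht (prof_bound pr x).
have P := pvel01 alpha01 ht (prof_bound pr x).
have e0 := @ent_ge0 _ (u x) (sg (phi x)) (prof_u01 pr x) (sg01 _).
have -> : lag alpha u phi d x = s (d x) + (g (u x) (phi x) 0 - g (up alpha) c 0).
  by rewrite /lag /g s0; ring.
move=> ->; rewrite mul0r addr0 {2}/ent s0.
have kc : kap (phi x) <= (1 - alpha ^+ 2)^-1.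
  rewrite -(kap_phip alpha01); apply: kap_le_norm; rewrite [leRHS]ger0_norm; last exact: ltW.
  exact: (prof_bound pr).
have k1 := kap_ge1 (phi x).
have : energy alpha ((1 - alpha ^+ 2) / 2) + ln (1 - pvel ((1 - alpha ^+ 2) / 2) (phi x)) <= 0.
  rewrite /energy /pvel subKr -lnM ?posrE; last 2 first.
  - by rewrite divr_gt0//; lra.
  - by rewrite mulr_gt0//; lra.
  rewrite -ln1 ler_ln ?posrE ?ltr01//; last by rewrite !mulr_gt0 ?invr_gt0//; lra.
  rewrite mulrA divfK; last by rewrite gt_eqF//; lra.
  by rewrite mulrC -ler_pdivlMr// mul1r.
lra.
Qed.

(** Young's inequality for [p ln p - p] and its conjugate [exp], at slope [- |x|]. It reduces the
    integrability of the negative part of the integrand to a first moment of [d]. *)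
Lemma s_ge (p x : R) : 0 <= p <= 1 -> - (p * `|x| + expR (- `|x|)) <= s p.
Proof.
move=> /andP[p0 p1]; have := @xlnx_ge _ (1 - p) ltac:(lra); rewrite /s.
have q0 := expR_gt0 (- `|x|).
suff : - (p * `|x|) - expR (- `|x|) <= p * ln p - p by lra.
move: p0; rewrite le_eqVlt => /predU1P[<-|p0]; first by rewrite !mul0r; lra.
have := @ln_le_sub1 _ (expR (- `|x|) / p) (divr_gt0 q0 p0).
rewrite ln_div ?posrE// expRK -(ler_pM2l p0) [leRHS]mulrBr [p * (_ / p)]mulrC divfK ?gt_eqF//.
rewrite mulrBr; lra.
Qed.


(** A bounded substitute for [|x|], used on [[- n, n]], where the two agree. *)
Definition trunc (n x : R) : R := Num.min `|x| n.

Lemma bmeas_trunc (n : R) : 0 <= n -> bmeas (trunc n).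
Proof.
move=> n0; split.
  apply: continuous_measurable_fun; apply: (@lipschitz_continuous _ _ 1) => x y; rewrite mul1r.
  apply: le_trans (ler_dist_dist x y); rewrite /trunc.
  by case: (leP `|x| n) => h1; case: (leP `|y| n) => h2; rewrite ?subrr ?normr0 //;
    rewrite ler_norml; apply/andP; split;
    have := ler_norm (`|x| - `|y|); have := ler_norm (- (`|x| - `|y|)); rewrite normrN; lra.
exists n => x; rewrite ger0_norm; first by rewrite /trunc ge_min lexx orbT.
by rewrite /trunc le_min normr_ge0.
Qed.

Let cphi : continuous phi := lipschitz_continuous (prof_lip pr).

Let bphi : bmeas phi.
Proof. by apply: (@bmeas_cphi _ _ _ _ _ pr id) => y; exact: cvg_id. Qed.

(* Integration by parts against [phi n - phi] shows that the first moment of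
   [d] is controlled by the L^1 distance of [phi] to the step function. *)
Lemma moment_right (n : R) : 0 <= n ->
  I 0 n (fun x => trunc n x * d x) = I 0 n (fun x => phi n - phi x).
Proof.
move=> n0.
have bT : bmeas (fun x => trunc n x * d x) by apply: bmeasM; [exact: bmeas_trunc|exact: bmeas_d pr].
have bD : bmeas (fun x => phi n - phi x) by apply: bmeasB => //; exact: bmeas_cst.
suff : I 0 n (fun x => (phi n - phi x) - trunc n x * d x) = 0 by rewrite itgB//; lra.
apply: EFin_inj; rewrite -itg_EFin; last exact: bmeasB.
rewrite (@lipschitz_FTC _ (fun x => x * (phi n - phi x)) _ (n + 1 + 2 * c) 0 n n0).
- by rewrite subrr mulr0 mul0r subrr.
- by move=> x; apply: cvgM; [exact: cvg_id|apply: cvgB; [exact: cvg_cst|exact: cphi]].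
- move=> x y hx hy.
  have -> : x * (phi n - phi x) - y * (phi n - phi y) =
    (x - y) * (phi n - phi x) + y * (phi y - phi x) by ring.
  apply: (le_trans (ler_normD _ _)); rewrite !normrM.
  have l1 := prof_lip pr y x; rewrite mul1r distrC in l1.
  have b1 := prof_bound pr n; have b2 := prof_bound pr x.
  have b3 : `|phi n - phi x| <= 2 * c by apply: (le_trans (ler_normB _ _)); lra.
  rewrite (ger0_norm (_ : 0 <= y)); last by lra.
  rewrite distrC (distrC y) in l1.
  rewrite mulrDl addrC; apply: lerD.
    by apply: ler_pM => //; lra.
  by rewrite mulrC; apply: ler_wpM2r.
- exact: (bmeasB bD bT).1.
- apply: ae_imp (prof_der pr) => x dx xn.
  have := isdM (isd_id x) (isdB (isd_cst (phi n) x) dx).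
  move=> /isd_cast; apply; rewrite /trunc ger0_norm; last by lra.
  by rewrite min_l; [ring|lra].
Qed.

Lemma moment_left (n : R) : 0 <= n ->
  I (- n) 0 (fun x => trunc n x * d x) = I (- n) 0 (fun x => phi x - phi (- n)).
Proof.
move=> n0.
have bT : bmeas (fun x => trunc n x * d x) by apply: bmeasM; [exact: bmeas_trunc|exact: bmeas_d pr].
have bD : bmeas (fun x => phi x - phi (- n)) by apply: bmeasB => //; exact: bmeas_cst.
suff : I (- n) 0 (fun x => (phi x - phi (- n)) - trunc n x * d x) = 0 by rewrite itgB//; lra.
apply: EFin_inj; rewrite -itg_EFin; last exact: bmeasB.
have n0' : - n <= 0 by lra.
rewrite (@lipschitz_FTC _ (fun x => x * (phi x - phi (- n))) _ (n + 1 + 2 * c) (- n) 0 n0').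
- by rewrite subrr mulr0 mul0r subrr.
- by move=> x; apply: cvgM; [exact: cvg_id|apply: cvgB; [exact: cphi|exact: cvg_cst]].
- move=> x y hx hy.
  have -> : x * (phi x - phi (- n)) - y * (phi y - phi (- n)) =
    (x - y) * (phi x - phi (- n)) + y * (phi x - phi y) by ring.
  apply: (le_trans (ler_normD _ _)); rewrite !normrM.
  have l1 := prof_lip pr x y; rewrite mul1r in l1.
  have b1 := prof_bound pr (- n); have b2 := prof_bound pr x.
  have b3 : `|phi x - phi (- n)| <= 2 * c by apply: (le_trans (ler_normB _ _)); lra.
  have b4 : `|y| <= n + 1 by rewrite ler_norml; lra.
  rewrite mulrDl addrC; apply: lerD.
    by apply: ler_pM.
  by rewrite mulrC; apply: ler_wpM2r.
- exact: (bmeasB bD bT).1.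
- apply: ae_imp (prof_der pr) => x dx xn.
  have := isdM (isd_id x) (isdB dx (isd_cst (phi (- n)) x)).
  move=> /isd_cast; apply; rewrite /trunc ler0_norm; last by lra.
  by rewrite min_l; [ring|lra].
Qed.

Lemma moment_le (n : R) : 0 <= n ->
  I (- n) n (fun x => trunc n x * d x) <= I (- n) n (fun x => `|phi x - step (- c) c x|).
Proof.
move=> n0.
have bT : bmeas (fun x => trunc n x * d x) by apply: bmeasM; [exact: bmeas_trunc|exact: bmeas_d pr].
have bS : bmeas (fun x => `|phi x - step (- c) c x|).
  by apply: bmeas_norm; apply: bmeasB => //; exact: bmeas_step.
have bD1 : bmeas (fun x => phi n - phi x) by apply: bmeasB => //; exact: bmeas_cst.
have bD2 : bmeas (fun x => phi x - phi (- n)) by apply: bmeasB => //; exact: bmeas_cst.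
rewrite !(itg_cat (b := 0) (a := - n) (c := n))//; try lra.
have bn := prof_bound pr n; have bn' := prof_bound pr (- n).
rewrite ler_norml in bn; rewrite ler_norml in bn'.
rewrite moment_right// moment_left//; apply: lerD.
  have -> : I (- n) 0 (fun x => `|phi x - step (- c) c x|) = I (- n) 0 (fun x => `|phi x + c|).
    by apply: itg_eq_oo => t ht; rewrite step_neg ?opprK//; lra.
  apply: itg_le.
  - by [].
  - by apply: bmeas_norm; apply: bmeasD => //; exact: bmeas_cst.
  - by move=> x _; apply: le_trans (ler_norm _); lra.
apply: itg_le => // x xn; rewrite step_pos; last by lra.
by rewrite distrC; apply: le_trans (ler_norm _); lra.
Qed.

Lemma itg_exp_le (n : R) : 0 <= n -> I (- n) n (fun x => expR (- `|x|)) <= 2.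
Proof.
move=> n0.
have cN : continuous (fun x : R => expR (- `|x|)).
  move=> x; apply: (@continuous_comp _ _ _ (fun x : R => - `|x|) expR); last exact: continuous_expR.
  by apply: cvgN; exact: norm_continuous.
have bE : bmeas (fun x : R => expR (- `|x|)).
  split; first exact: continuous_measurable_fun.
  by exists 1 => x; rewrite ger0_norm ?expR_ge0.
rewrite (itg_cat (b := 0) (a := - n) (c := n))//; try lra.
have n0' : - n <= 0 by lra.
have -> : I (- n) 0 (fun x => expR (- `|x|)) = expR 0 - expR (- n).
  apply: EFin_inj; rewrite -itg_EFin//.
  apply: (@lipschitz_FTC _ expR _ (expR 1) (- n) 0 n0').
  - exact: continuous_expR.
  - move=> x y hx hy; wlog xy : x y hx hy / x <= y => [h|].
      case: (leP x y) => [xy|/ltW xy]; first exact: h.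
      by rewrite distrC (distrC x); exact: h.
    rewrite distrC (distrC x) !ger0_norm ?subr_ge0 ?ler_expR//.
    have := isd_ge0_le xy (fun t _ => isdB (isdZ (expR 1) (isd_id t)) (isd_exp t)).
    move=> h; have := h _; move=> {}h.
    suff : expR 1 * x - expR x <= expR 1 * y - expR y by lra.
    by apply: h => t ht; rewrite mulr1 subr_ge0 ler_expR; lra.
  - exact: bE.1.
  - apply: ae_all => x hx; rewrite ler0_norm ?opprK; last by lra.
    exact: isd_exp.
have -> : I 0 n (fun x => expR (- `|x|)) = - expR (- n) - - expR (- 0).
  apply: EFin_inj; rewrite -itg_EFin//.
  apply: (@lipschitz_FTC _ (fun x => - expR (- x)) _ 1 0 n n0).
  - move=> x; apply: cvgN; apply: (@continuous_comp _ _ _ (fun x : R => - x) expR); last exact: continuous_expR.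
    exact: continuousN.
  - move=> x y hx hy; wlog xy : x y hx hy / x <= y => [h|].
      case: (leP x y) => [xy|/ltW xy]; first exact: h.
      by rewrite distrC (distrC x); exact: h.
    have e1 : expR (- y) <= expR (- x) by rewrite ler_expR; lra.
    rewrite distrC (distrC x) !ger0_norm; [|lra..].
    have dE (t : R) := isd_comp (isd_exp (- t)) (isdN (isd_id t)).
    have h := isd_ge0_le xy (fun t _ => isdD (isdZ 1 (isd_id t)) (dE t)).
    suff : 1 * x + expR (- x) <= 1 * y + expR (- y) by lra.
    apply: h => t ht; have : expR (- t) <= 1 by rewrite -[leRHS]expR0 ler_expR; lra.
    lra.
  - exact: bE.1.
  - apply: ae_all => x hx; rewrite ger0_norm; last by lra.
    have := isdN (isd_comp (isd_exp (- x)) (isdN (isd_id x))).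
    by move=> /isd_cast; apply; ring.
have := expR_gt0 (- n); rewrite oppr0 expR0; lra.
Qed.


(** Positive and negative parts written algebraically, so that [bmeas] is inherited from [f]. *)
Definition posp (f : R -> R) x : R := (`|f x| + f x) / 2.
Definition negp (f : R -> R) x : R := (`|f x| - f x) / 2.

Lemma bmeas_posp f : bmeas f -> bmeas (posp f).
Proof.
by move=> bf; apply: bmeasM; [apply: bmeasD => //; exact: bmeas_norm|exact: bmeas_cst].
Qed.

Lemma bmeas_negp f : bmeas f -> bmeas (negp f).
Proof.
by move=> bf; apply: bmeasM; [apply: bmeasB => //; exact: bmeas_norm|exact: bmeas_cst].
Qed.

Lemma posp_ge0 f x : 0 <= posp f x.
Proof. by rewrite /posp divr_ge0//; have := ler_norm (- f x); rewrite normrN; lra. Qed.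

Lemma negp_ge0 f x : 0 <= negp f x.
Proof. by rewrite /negp divr_ge0//; have := ler_norm (f x); lra. Qed.

Lemma funepos_EFin f : (EFin \o f)^\+%E = EFin \o posp f.
Proof.
apply/funext => x; rewrite funeposE /posp /=; have [h|h] := leP 0 (f x).
  by rewrite max_l ?lee_fin// ger0_norm//; congr EFin; field.
by rewrite max_r ?lee_fin ?ltW// ltr0_norm// addNr mul0r.
Qed.

Lemma funeneg_EFin f : (EFin \o f)^\-%E = EFin \o negp f.
Proof.
apply/funext => x; rewrite funenegE /negp /=; have [h|h] := leP 0 (f x).
  by rewrite (ger0_norm h) subrr mul0r max_r// lee_fin oppr_le0.
by rewrite (ltr0_norm h) max_l ?lee_fin ?oppr_ge0 ?ltW//; congr EFin; field.
Qed.

Lemma itv_exhaust (f : R -> R) : bmeas f -> (forall x, 0 <= f x) ->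
  (I (- n%:R) (n%:R) f)%:E @[n --> \oo] --> (\int[mu]_x (f x)%:E)%E.
Proof.
move=> bf f0.
have := @ge0_nondecreasing_set_cvg_integral _ _ R (fun n : nat => `[- (n%:R : R), n%:R]%classic : set (measurableTypeR R)) (EFin \o f) mu.
have -> : \bigcup_(n : nat) `[- (n%:R : R), n%:R]%classic = [set: R].
  apply/seteqP; split => // x _.
  exists (Num.truncn `|x|).+1 => //=; rewrite in_itv/= -ler_norml.
  by apply/ltW; exact: truncnS_gt.
move=> h; under eq_fun do rewrite -itg_EFin//; apply: h.
- move=> m n mn; apply/subsetPset => x /=; rewrite !in_itv/= => /andP[h1 h2].
  have : (m%:R : R) <= n%:R by rewrite ler_nat.
  by move: (m%:R : R) (n%:R : R) h1 h2 => p q; lra.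
- by move=> n; exact: measurable_itv.
- by move=> n; apply/measurable_EFinP; exact: measurable_funS bf.1.
- by move=> n x _; rewrite lee_fin.
Qed.

(** The integral is a difference of two possibly infinite integrals. The L^1 distance of [phi] to
    the step function makes the negative part integrable; then the window bounds [lag_lower] pass to
    the limit. *)
Lemma lag_integral_ge : phi x @[x --> -oo] --> - c -> phi x @[x --> +oo] --> c ->
  (\int[mu]_x `|phi x - step (- c) c x|%:E < +oo)%E ->
  ((2 * mhalf alpha)%:E <= \int[mu]_x (lag alpha u phi d x)%:E)%E.
Proof.
move=> lm lp Wfin; pull.
have bl := bmeas_lag alpha01 pr.
have bS : bmeas (fun x => `|phi x - step (- c) c x|).
  by apply: bmeas_norm; apply: bmeasB => //; exact: bmeas_step.
rewrite integralE; rewrite -/(EFin \o lag alpha u phi d) funepos_EFin funeneg_EFin.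
set A := integral _ _ _; set B := integral _ _ _.
have cA : (I (- n%:R) (n%:R) (posp (lag alpha u phi d)))%:E @[n --> \oo] --> A.
  by apply: itv_exhaust; [exact: bmeas_posp|exact: posp_ge0].
have cB : (I (- n%:R) (n%:R) (negp (lag alpha u phi d)))%:E @[n --> \oo] --> B.
  by apply: itv_exhaust; [exact: bmeas_negp|exact: negp_ge0].
have W0 : (0 <= \int[mu]_x `|phi x - step (- c) c x|%:E)%E by apply: integral_ge0.
have [W WE] : exists W : R, (\int[mu]_x `|phi x - step (- c) c x|%:E = W%:E)%E.
  by exists (fine (\int[mu]_x `|phi x - step (- c) c x|%:E)%E); rewrite fineK// ge0_fin_numE.
(* The negative part is at most [|x| * d x + expR (- |x|)]; the moment contributes at most [W], the
   exponential at most 2. *)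
have BW : (B <= (W + 2)%:E)%E.
  apply: (cvge_le _ cB); apply: nearW => n; rewrite lee_fin.
  have n0 : 0 <= n%:R :> R by [].
  have bT : bmeas (fun x => trunc n%:R x * d x).
    by apply: bmeasM; [exact: bmeas_trunc|exact: bmeas_d pr].
  have bE : bmeas (fun x : R => expR (- `|x|)).
    split.
      apply: continuous_measurable_fun => x.
      apply: (@continuous_comp _ _ _ (fun x : R => - `|x|) expR); last exact: continuous_expR.
      by apply: cvgN; exact: norm_continuous.
    by exists 1 => x; rewrite ger0_norm ?expR_ge0.
  have h1 : I (- n%:R) n%:R (fun x => `|phi x - step (- c) c x|) <= W.
    rewrite -lee_fin -itg_EFin// -WE; apply: ge0_subset_integral => //.
    by apply/measurable_EFinP; exact: bS.1.
  apply: (@le_trans _ _ (I (- n%:R) n%:R (fun x => trunc n%:R x * d x + expR (- `|x|)))); last first.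
    rewrite itgD//; have := moment_le n0; have := itg_exp_le n0; lra.
  apply: itg_le; [exact: bmeas_negp|exact: bmeasD|] => x xn.
  have d01 := prof_d01 pr x.
  have := lag_ge_s x; have := s_ge x d01.
  have : `|x| <= n%:R by rewrite ler_norml.
  move=> xn'; rewrite /trunc min_l// => h2 h3.
  have p0 : 0 <= `|x| * d x + expR (- `|x|).
    by apply: addr_ge0; [apply: mulr_ge0 => //; lra|exact: expR_ge0].
  rewrite /negp; case: (leP 0 (lag alpha u phi d x)) => h4.
    by rewrite (ger0_norm h4) subrr mul0r.
  rewrite (ltr0_norm h4); rewrite mulrC in h2; lra.
have B0 : (0 <= B)%E by apply: integral_ge0 => x _; rewrite lee_fin; exact: negp_ge0.
have [r BE] : exists r : R, B = r%:E.
  by exists (fine B); rewrite fineK// ge0_fin_numE//; apply: le_lt_trans BW (ltry _).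
have main : ((2 * mhalf alpha + r)%:E <= A)%E.
  suff core (e : R) : 0 < e -> ((2 * mhalf alpha + r)%:E <= A + e%:E)%E by apply/lee_addgt0Pr.
  move=> e0; have Mpos : 0 <= M.
    rewrite ln_ge0// ler_pdivlMr//; nra.
  have e3 : 0 < e / (4 * (M + 1)) by rewrite divr_gt0//; lra.
  have near1 : \forall n \near \oo, c - e / (4 * (M + 1)) < phi n%:R.
    have /(cvgr_gt _ lp) [K [_ KP]] : c - e / (4 * (M + 1)) < c by lra.
    by near=> n; apply: KP; near: n; exact: nbhs_infty_gtr.
  have near2 : \forall n \near \oo, phi (- n%:R) < - c + e / (4 * (M + 1)).
    have /(cvgr_lt _ lm) [K [_ KP]] : - c < - c + e / (4 * (M + 1)) by lra.
    by near=> n; apply: KP; rewrite ltrNl; near: n; exact: nbhs_infty_gtr.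
  have near3 : \forall n \near \oo, r - e / 2 < I (- n%:R) (n%:R) (negp (lag alpha u phi d)).
    move: cB; rewrite BE => /fine_cvgP[_ /cvgr_gt]; apply; lra.
  (* On this window [phi] is close to its end values and nearly all of the negative part is
     collected. *)
  have [n [h1 [h2 h3]]] := filter_ex (filterI near1 (filterI near2 near3)).
  have n0 : 0 <= n%:R :> R by [].
  have low := lag_lower n0.
  have split_lag : I (- n%:R) n%:R (posp (lag alpha u phi d)) =
      I (- n%:R) n%:R (lag alpha u phi d) + I (- n%:R) n%:R (negp (lag alpha u phi d)).
    rewrite -itgD//; last exact: bmeas_negp.
    by congr Rintegral; apply/funext => x; rewrite /posp /negp; field.
  have An : ((I (- n%:R) n%:R (posp (lag alpha u phi d)))%:E <= A)%E.
    rewrite -itg_EFin; last exact: bmeas_posp.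
    apply: ge0_subset_integral => //.
    - by apply/measurable_EFinP; exact: (bmeas_posp bl).1.
    - by move=> x _; rewrite lee_fin; exact: posp_ge0.
  apply: (@le_trans _ _ ((I (- n%:R) n%:R (posp (lag alpha u phi d)))%:E + e%:E)%E); last first.
    by rewrite leeD2r.
  rewrite -EFinD lee_fin split_lag.
  have q1 : M * (c - phi n%:R) <= e / 4.
    apply: (fourth_bound Mpos e0); have := prof_bound pr n%:R; rewrite ler_norml; lra.
  have q2 : M * (phi (- n%:R) + c) <= e / 4.
    apply: (fourth_bound Mpos e0); have := prof_bound pr (- n%:R); rewrite ler_norml; lra.
  lra.
rewrite BE; case: A main {cA} => [q||] //; last by move=> _; rewrite addye// leey.
by rewrite -EFinB !lee_fin lerBrDr.
Unshelve. all: by end_near. Qed.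

End Lower.

Lemma G_ge (x : X alpha) : ((2 * mhalf alpha)%:E <= G x)%E.
Proof.
rewrite /G; case: asboolP => [dD|_]; last by rewrite leey.
have [u [d [pr [N1 [mN1 N10] N1P]]]] := X_profile alpha01 x.
have [_ _ lm lp] : in_C alpha (Xphi x) by exact: (set_valP x.2).
have -> : (\int[mu]_y (integrand x y)%:E = \int[mu]_y (lag alpha u (Xphi x) d y)%:E)%E.
  apply: (@integral_null_eq _ _ R mu _ N1 _ _ mN1 N10) => y _ Ny.
  by have [eu ed] := N1P y Ny; rewrite /lag eu ed.
apply: (lag_integral_ge pr) => //; first by rewrite -(phimE alpha01).
move: dD; rewrite /domD Lnorm1 -(phimE alpha01) => h.
apply: le_lt_trans h; rewrite leeDr//; exact: Lnorm_ge0.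
Qed.

(** For the upper bound two extremals of the same parameter are glued at 0, on an interval just long
    enough; the energy term only lowers their cost. *)
Lemma minGE : minG alpha = (2 * mhalf alpha)%:E.
Proof.
pull; apply/eqP; rewrite eq_le; apply/andP; split; last first.
  by apply: le_ereal_inf_tmp => _ [x _ <-]; exact: G_ge.
apply/lee_addgt0Pr => e e0.
have e2 : 0 < (e : R) / 2 by rewrite divr_gt0.
have [b hb lt] := mhalf_adherent alpha01 e2.
have T0 := period_gt0 alpha01 hb.
pose l := period alpha b.
have [x [dB _ _ GE]] := @rec_exists _ _ alpha01 b b 0 l hb hb ltac:(rewrite /l; lra) ltac:(rewrite /l; lra).
apply: (@le_trans _ _ (G x)); first by apply: ereal_inf_lbound; exists x.
rewrite (domB_G dB T0) GE -EFinD lee_fin.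
have ht := theta01 alpha01 hb.
have E0 : 0 <= energy alpha (1 - b ^+ 2).
  by rewrite /energy ln_ge0// ler_pdivlMr ?mul1r; lra.
have := mulr_ge0 E0 (ltW T0); lra.
Qed.

End Minimum.

(** * Asymptotics of the excess energy *)

Section Asymptotics.
Context {R : realType} (alpha : R) (alpha01 : 0 < alpha < 1).
Local Notation mu := (@lebesgue_measure R).
Local Ltac pull := have /andP[a0 a1] := alpha01; have al2 := alpha_sqr_lt1 alpha01;
  have c0 := phip_gt0 alpha01.
Implicit Types (T K e b l z : R).

(** The calibrated lower bound for one half of the transition, in time [T], relative to half the
    minimum. *)
Definition excess b T : R := halfmin alpha b - mhalf alpha - energy alpha (1 - b ^+ 2) * T.

(** The coefficient of [expR (- (alpha * T))] in the optimal excess of one half of the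
    transition. *)
Definition rate : R := 4 * alpha / (1 - alpha ^+ 2).

(** [expR (alpha * T)] is the square of a number at least [1 + alpha * T / 2], hence it dominates
    [(1 + T) * T * alpha ^+ 2 / 4]. *)
Lemma exp_decay K e T : 0 < K -> 0 < e -> 0 < T -> 4 * K / (alpha ^+ 2 * e) <= T ->
  K * ((1 + T) * expR (- (alpha * T))) <= e.
Proof.
move=> K0 e0 T0 TK; pull.
have E : expR (- (alpha * T)) = (expR (alpha * T / 2) ^+ 2)^-1.
  by rewrite expRN -expRM_natl; congr (expR _)^-1; field.
have h : 1 + alpha * T / 2 <= expR (alpha * T / 2) by exact: expR_ge1Dx.
have g0 := expR_gt0 (alpha * T / 2).
rewrite E; move: g0 h; set t := expR (alpha * T / 2) => g0 h.
have aT : 0 < alpha * T by exact: mulr_gt0.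
have t2 : 0 < t ^+ 2 by exact: exprn_gt0.
rewrite mulrA ler_pdivrMr//.
rewrite ler_pdivrMr in TK; last by rewrite mulr_gt0// exprn_gt0.
have s1 : (1 + alpha * T / 2) ^+ 2 <= t ^+ 2 by nra.
have s2 : (1 + T) * (alpha * T) * alpha / 4 <= (1 + alpha * T / 2) ^+ 2 by nra.
have s3 : K * (1 + T) <= e * ((1 + T) * (alpha * T) * alpha / 4).
  have -> : e * ((1 + T) * (alpha * T) * alpha / 4) = (T * (alpha ^+ 2 * e)) / 4 * (1 + T) by ring.
  by apply: ler_wpM2r; lra.
apply: (le_trans s3); rewrite ler_pM2l//; lra.
Qed.

Lemma energy_ub b : alpha < b < 1 ->
  energy alpha (1 - b ^+ 2) <= (b ^+ 2 - alpha ^+ 2) / (1 - b ^+ 2).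
Proof.
move=> hb; pull; have h := theta01 alpha01 hb; rewrite /energy.
apply: (le_trans (ln_le_sub1 _)); first by rewrite divr_gt0//; lra.
by rewrite le_eqVlt; apply/orP; left; apply/eqP; field; lra.
Qed.

Lemma energy_lb b : alpha < b < 1 ->
  (b ^+ 2 - alpha ^+ 2) / (1 - alpha ^+ 2) <= energy alpha (1 - b ^+ 2).
Proof.
move=> hb; pull; have h := theta01 alpha01 hb; rewrite /energy.
have := @ln_le_sub1 _ ((1 - b ^+ 2) / (1 - alpha ^+ 2)).
rewrite divr_gt0//; last by lra.
move=> /(_ isT); rewrite !ln_div ?posrE; [|lra..].
have -> : (1 - b ^+ 2) / (1 - alpha ^+ 2) - 1 = - ((b ^+ 2 - alpha ^+ 2) / (1 - alpha ^+ 2)) by field; lra.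
lra.
Qed.

(* This [b] makes the logarithm in [barrier_low] equal to [alpha * T] up to a constant. *)
Lemma excess_lower_bound T : 0 < T -> 8 * alpha * expR (- (alpha * T)) <= 1 - alpha ^+ 2 ->
  let b := alpha + 2 * alpha * expR (- (alpha * T)) in
  alpha < b < 1 /\
  rate - 56 / (1 - alpha ^+ 2) ^+ 2 * ((1 + T) * expR (- (alpha * T))) <=
  expR (alpha * T) * excess b T.
Proof.
move=> T0 h8 b; pull.
have E0 := expR_gt0 (alpha * T).
have Einv : expR (- (alpha * T)) = (expR (alpha * T))^-1 by rewrite expRN.
pose del := 2 * alpha * expR (- (alpha * T)).
have del0 : 0 < del by rewrite /del !mulr_gt0// expR_gt0.
have bE : b = alpha + del by [].
have [b1 EN E1 th] := @energy_le _ _ alpha01 b del ltac:(lra) ltac:(lra) ltac:(rewrite /del; lra).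
have hb : alpha < b < 1 by lra.
split => //.
have lnd : ln del = ln (2 * alpha) - alpha * T.
  by rewrite /del lnM ?posrE ?mulr_gt0 ?expR_gt0// expRK; ring.
have low := halfmin_low alpha01 hb.
rewrite /barrier_low /barrier (_ : b - alpha = del) in low; last by rewrite bE; ring.
rewrite lnd in low.
have eub := energy_ub hb.
have Edel : expR (alpha * T) * del = 2 * alpha.
  by rewrite /del Einv mulrCA mulfV ?mulr1// gt_eqF.
have low2 : del * (2 / (1 - alpha ^+ 2) * (alpha * T + 1)) - (del * (2 * alpha + del) / (1 - b ^+ 2)) * T <= excess b T.
  rewrite /excess.
  have e2 : energy alpha (1 - b ^+ 2) * T <= (del * (2 * alpha + del) / (1 - b ^+ 2)) * T.
    apply: ler_wpM2r; first exact: ltW.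
    by apply: (le_trans eub); rewrite le_eqVlt; apply/orP; left; apply/eqP; congr (_ / _); rewrite bE; ring.
  have -> : del * (2 / (1 - alpha ^+ 2) * (alpha * T + 1)) =
    2 / (1 - alpha ^+ 2) * (del * (ln (2 * alpha) - (ln (2 * alpha) - alpha * T)) + del) by ring.
  lra.
apply: (@le_trans _ _ (expR (alpha * T) * (del * (2 / (1 - alpha ^+ 2) * (alpha * T + 1)) - (del * (2 * alpha + del) / (1 - b ^+ 2)) * T))); last first.
  by rewrite ler_pM2l.
have -> : expR (alpha * T) * (del * (2 / (1 - alpha ^+ 2) * (alpha * T + 1)) - (del * (2 * alpha + del) / (1 - b ^+ 2)) * T)
  = (expR (alpha * T) * del) * ((2 / (1 - alpha ^+ 2) * (alpha * T + 1)) - ((2 * alpha + del) / (1 - b ^+ 2)) * T) by ring.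
rewrite Edel.
(* The coefficient at [b] is compared with its value at [alpha]. The numerator of the error is at
   most 7, and 14 accounts for [1 - b ^+ 2] being at least half of [1 - alpha ^+ 2]. *)
have dd : (2 * alpha + del) / (1 - b ^+ 2) <= 2 * alpha / (1 - alpha ^+ 2) + del * (14 / (1 - alpha ^+ 2) ^+ 2).
  have -> : (2 * alpha + del) / (1 - b ^+ 2) =
    2 * alpha / (1 - alpha ^+ 2) + del * (((1 - alpha ^+ 2) + 2 * alpha * (2 * alpha + del)) / ((1 - b ^+ 2) * (1 - alpha ^+ 2))).
    by rewrite bE; field; apply/andP; split; [lra|move: th; rewrite bE; lra].
  rewrite lerD2l ler_pM2l//.
  rewrite ler_pdivrMr; last by rewrite mulr_gt0//; lra.
  have -> : 14 / (1 - alpha ^+ 2) ^+ 2 * ((1 - b ^+ 2) * (1 - alpha ^+ 2)) = 14 * (1 - b ^+ 2) / (1 - alpha ^+ 2) by field; lra.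
  rewrite ler_pdivlMr//.
  have d1 : del <= 1 by rewrite /del; nra.
  have : (1 - alpha ^+ 2) + 2 * alpha * (2 * alpha + del) <= 7 by nra.
  nra.
have dd2 : (2 * alpha + del) / (1 - b ^+ 2) * T <= (2 * alpha / (1 - alpha ^+ 2) + del * (14 / (1 - alpha ^+ 2) ^+ 2)) * T.
  by apply: ler_wpM2r => //; exact: ltW.
have c14 : 0 < 14 / (1 - alpha ^+ 2) ^+ 2 by rewrite divr_gt0// exprn_gt0.
have last : 2 * alpha * (del * (14 / (1 - alpha ^+ 2) ^+ 2) * T) <=
   56 / (1 - alpha ^+ 2) ^+ 2 * ((1 + T) * expR (- (alpha * T))).
  have -> : 56 / (1 - alpha ^+ 2) ^+ 2 * ((1 + T) * expR (- (alpha * T))) =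
    (4 * expR (- (alpha * T)) * (14 / (1 - alpha ^+ 2) ^+ 2)) * (1 + T) by ring.
  have -> : 2 * alpha * (del * (14 / (1 - alpha ^+ 2) ^+ 2) * T) =
    (2 * alpha * del * (14 / (1 - alpha ^+ 2) ^+ 2)) * T by ring.
  have := expR_gt0 (- (alpha * T)) => En.
  apply: ler_pM; [|exact: ltW| |lra].
    exact: mulr_ge0 (mulr_ge0 (mulr_ge0 (ler0n _ 2) (ltW a0)) (ltW del0)) (ltW c14).
  apply: ler_wpM2r; first exact: ltW.
  by rewrite /del; nra.
have dd3 := ler_wpM2l (mulr_ge0 (ler0n R 2) (ltW a0)) dd2.
(* The terms linear in [T] without [del] cancel, and [rate] is what remains. *)
have eqr : 2 * alpha * ((2 / (1 - alpha ^+ 2)) * (alpha * T + 1) -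
   (2 * alpha / (1 - alpha ^+ 2) + del * (14 / (1 - alpha ^+ 2) ^+ 2)) * T) =
   rate - 2 * alpha * (del * (14 / (1 - alpha ^+ 2) ^+ 2) * T) by rewrite /rate; ring.
lra.
Qed.

Lemma excess_lower e : 0 < e -> exists2 T0 : R, 0 < T0 & forall T, T0 <= T ->
  exists2 b, alpha < b < 1 & rate - e <= expR (alpha * T) * excess b T.
Proof.
move=> e0; pull.
pose K := 56 / (1 - alpha ^+ 2) ^+ 2.
have K0 : 0 < K by rewrite divr_gt0// exprn_gt0.
pose K' := 8 * alpha.
have K'0 : 0 < K' by rewrite mulr_gt0.
(* The second summand makes the error of [excess_lower_bound] at most [e], the third ensures its
   smallness hypothesis. *)
exists (1 + 4 * K / (alpha ^+ 2 * e) + 4 * K' / (alpha ^+ 2 * (1 - alpha ^+ 2))).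
  by apply: addr_gt0; [apply: addr_gt0 => //|]; apply: divr_gt0; apply: mulr_gt0 => //; exact: exprn_gt0.
move=> T hT.
have p1 : 0 < 4 * K / (alpha ^+ 2 * e) by apply: divr_gt0; apply: mulr_gt0 => //; exact: exprn_gt0.
have p2 : 0 < 4 * K' / (alpha ^+ 2 * (1 - alpha ^+ 2)) by apply: divr_gt0; apply: mulr_gt0 => //; exact: exprn_gt0.
have T0 : 0 < T by lra.
have h1 := @exp_decay K e T K0 e0 T0 ltac:(lra).
have h2 := @exp_decay K' (1 - alpha ^+ 2) T K'0 al2 T0 ltac:(lra).
have En := expR_gt0 (- (alpha * T)).
have [|hb le] := @excess_lower_bound T T0.
  apply: le_trans h2; rewrite /K' ler_pM2l//.
  by rewrite mulrDl mul1r lerDl mulr_ge0// ltW.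
eexists; first exact: hb.
apply: le_trans le; rewrite -/K; lra.
Qed.

Lemma excess_mono b T T' : alpha < b < 1 -> T <= T' -> excess b T' <= excess b T.
Proof.
move=> hb TT; pull; rewrite /excess.
have h := theta01 alpha01 hb.
have E0 : 0 <= energy alpha (1 - b ^+ 2).
  by rewrite /energy ln_ge0// ler_pdivlMr ?mul1r; lra.
by have := ler_wpM2l E0 TT; lra.
Qed.

Lemma excess_almost_ge0 T e : 0 <= T -> 0 < e -> exists2 b, alpha < b < 1 & - e <= excess b T.
Proof.
move=> T0 e0; pull.
pose del := Num.min ((1 - alpha ^+ 2) / 4) (e * (1 - alpha ^+ 2) / (4 * (T + 1))).
have del0 : 0 < del by rewrite lt_min !divr_gt0 ?mulr_gt0//; lra.
have d1 : del <= (1 - alpha ^+ 2) / 4 by rewrite ge_min lexx.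
have d2 : del <= e * (1 - alpha ^+ 2) / (4 * (T + 1)) by rewrite ge_min lexx orbT.
have [b1 E0 E1 _] := @energy_le _ _ alpha01 (alpha + del) del ltac:(lra) ltac:(lra) ltac:(lra).
have hb : alpha < alpha + del < 1 by lra.
exists (alpha + del) => //; rewrite /excess.
have := mhalf_le alpha01 hb.
rewrite ler_pdivlMr in d2; last by lra.
rewrite ler_pdivlMr// in E1.
have : energy alpha (1 - (alpha + del) ^+ 2) * T <= e by nra.
lra.
Qed.

End Asymptotics.

(** * The cost of a glued extremal *)

Section RecoveryCost.
Context {R : realType} (alpha : R) (alpha01 : 0 < alpha < 1).
Local Notation mu := (@lebesgue_measure R).
Local Notation excess := (excess alpha).
Local Notation rate := (rate alpha).
Implicit Types (T K e b l z : R).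

(* [del] is such that the extremal of parameter [b] reaches [phip] before time [T]. *)
Section Recovery.
Variables (T del b : R).
Hypotheses (T0 : 0 < T) (del0 : 0 < del) (del1 : del <= 1) (bE : b = alpha + del)
  (hb : alpha < b < 1) (hb2 : (1 - alpha ^+ 2) / 2 <= 1 - b ^+ 2)
  (hdel : del * (expR (alpha * T) - 1) = 2 * alpha).

Let E1 : 0 < expR (alpha * T) - 1.
Proof. have /andP[a0 _] := alpha01; by rewrite subr_gt0 expR_gt1 mulr_gt0. Qed.

(** The equation [period b = T] has no explicit solution. [hdel] solves [(b + alpha) / (b - alpha) =
    expR (alpha * T)] instead, which shortens the period by the harmless factor [alpha / b]. *)
Lemma period_rec : period alpha b = alpha * T / b.
Proof.
have /andP[a0 _] := alpha01.
rewrite /period (_ : (b + alpha) / (b - alpha) = expR (alpha * T)); first by rewrite expRK mulrC.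
have -> : b - alpha = del by rewrite bE; ring.
have -> : b + alpha = del * (expR (alpha * T) - 1) + del by rewrite hdel bE; ring.
by field; rewrite gt_eqF.
Qed.

Lemma period_rec_le : period alpha b <= T.
Proof.
have /andP[a0 _] := alpha01; have /andP[ab _] := hb.
by rewrite period_rec ler_pdivrMr ?(lt_trans a0 ab)// mulrC ler_pM2l// ltW.
Qed.

Lemma ln_rec_le : ln (2 * b) - ln del <= del / alpha + alpha * T.
Proof.
have /andP[a0 _] := alpha01.
have -> : ln del = ln (2 * alpha) - ln (expR (alpha * T) - 1).
  by rewrite -hdel lnM ?posrE//; ring.
have l1 : ln (expR (alpha * T) - 1) <= alpha * T.
  by rewrite -[leRHS]expRK ler_ln ?posrE ?expR_gt0// gerBl.
have l2 : ln (2 * b) - ln (2 * alpha) <= del / alpha.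
  have b0 : 0 < b by rewrite bE addr_gt0.
  rewrite -ln_div ?posrE ?mulr_gt0//.
  apply: (le_trans (ln_le_sub1 _)); first by rewrite divr_gt0 ?mulr_gt0.
  by rewrite le_eqVlt; apply/orP; left; apply/eqP; rewrite bE; field; rewrite gt_eqF.
lra.
Qed.

Lemma halfmin_rec_le : halfmin alpha b - mhalf alpha <=
  (2 / (1 - alpha ^+ 2) + del * (12 / (1 - alpha ^+ 2) ^+ 2)) * (del * (del / alpha + alpha * T + 1)).
Proof.
have al2 := alpha_sqr_lt1 alpha01.
have th0 : 0 < 1 - b ^+ 2 by apply: lt_le_trans hb2; rewrite divr_gt0.
(* The 12 is [2 * (2 * alpha + del) <= 6], doubled because of [hb2]. *)
have inv1 : 2 / (1 - b ^+ 2) <= 2 / (1 - alpha ^+ 2) + del * (12 / (1 - alpha ^+ 2) ^+ 2).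
  have -> : 2 / (1 - b ^+ 2) = 2 / (1 - alpha ^+ 2) + del * (2 * (2 * alpha + del) / ((1 - b ^+ 2) * (1 - alpha ^+ 2))).
    by move: th0; rewrite bE => th0; field; rewrite !gt_eqF.
  rewrite lerD2l ler_pM2l// ler_pdivrMr; last by rewrite mulr_gt0.
  have -> : 12 / (1 - alpha ^+ 2) ^+ 2 * ((1 - b ^+ 2) * (1 - alpha ^+ 2)) = 12 * (1 - b ^+ 2) / (1 - alpha ^+ 2).
    by field; rewrite gt_eqF.
  rewrite ler_pdivlMr//.
  have /andP[_ a1] := alpha01; have := del1; have := hb2; have := del0; nra.
have up := halfmin_up alpha01 hb.
rewrite /barrier_up /barrier (_ : b - alpha = del) in up; last by rewrite bE; ring.
have lnb := ln_rec_le.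
apply: (le_trans up); apply: ler_pM => //.
- by rewrite divr_ge0// ltW.
- have /andP[a0 _] := alpha01.
  have l3 : ln del <= ln (2 * b).
    have b0 : 0 < b by rewrite bE addr_gt0.
    rewrite ler_ln ?posrE ?mulr_gt0// bE.
    by have := del0; lra.
  by rewrite addr_ge0 ?mulr_ge0 ?subr_ge0// ltW.
- have -> : del * (del / alpha + alpha * T + 1) = del * (del / alpha + alpha * T) + del by ring.
  by rewrite lerD2r ler_pM2l.
Qed.

Lemma energy_rec_ge :
  del * ((2 - del / alpha) / (1 - alpha ^+ 2)) * (alpha * T) <=
  energy alpha (1 - b ^+ 2) * period alpha b.
Proof.
have /andP[a0 _] := alpha01; have al2 := alpha_sqr_lt1 alpha01; have /andP[ab _] := hb.
have b0 : 0 < b := lt_trans a0 ab.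
have aT : 0 <= alpha * T by rewrite mulr_ge0// ltW.
rewrite period_rec.
apply: (@le_trans _ _ ((b ^+ 2 - alpha ^+ 2) / (1 - alpha ^+ 2) * (alpha * T / b))); last first.
  rewrite ler_wpM2r//; first by rewrite divr_ge0// ltW.
  exact: (energy_lb alpha01 hb).
have -> : (b ^+ 2 - alpha ^+ 2) / (1 - alpha ^+ 2) * (alpha * T / b) =
   del * ((2 - del / b) / (1 - alpha ^+ 2)) * (alpha * T).
  by move: b0; rewrite bE => b0; field; rewrite !gt_eqF.
apply: ler_wpM2r => //; rewrite ler_pM2l// ler_pM2r ?invr_gt0// lerD2l lerN2 ler_pM2l//.
by rewrite lef_pV2 ?posrE// ltW.
Qed.

Definition rec_const : R :=
  12 / (1 - alpha ^+ 2) ^+ 2 * (1 + alpha^-1) + 4 / (alpha * (1 - alpha ^+ 2)).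

(** The terms of order [del * T] of [halfmin_rec_le] and [energy_rec_ge] cancel; the remainder is
    quadratic in [del]. *)
Lemma excess_rec_le : excess b (period alpha b) <=
  del * (2 / (1 - alpha ^+ 2) + del * ((1 + T) * rec_const)).
Proof.
have := halfmin_rec_le; have := energy_rec_ge; rewrite /excess.
move: (halfmin _ _ - mhalf _) (energy _ _ * period _ _) => H G hG hH.
have /andP[a0 a1] := alpha01; have al2 := alpha_sqr_lt1 alpha01.
apply: (le_trans (lerB hH hG)).
pose q := 12 / (1 - alpha ^+ 2) ^+ 2; pose q' := 4 / (alpha * (1 - alpha ^+ 2)).
have q0 : 0 < q by rewrite divr_gt0 ?exprn_gt0.
have q'0 : 0 < q' by rewrite divr_gt0 ?mulr_gt0.
have -> : (2 / (1 - alpha ^+ 2) + del * (12 / (1 - alpha ^+ 2) ^+ 2)) * (del * (del / alpha + alpha * T + 1)) -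
   del * ((2 - del / alpha) / (1 - alpha ^+ 2)) * (alpha * T) =
   del * (2 / (1 - alpha ^+ 2) + del * (q * (1 + alpha * T + del / alpha) + q' / 4 * (2 + alpha * T))).
  by rewrite /q /q'; field; rewrite !gt_eqF.
rewrite ler_pM2l// lerD2l ler_pM2l// /rec_const -/q -/q'.
have r2 : del / alpha <= alpha^-1 by rewrite ler_piMl// ltW// invr_gt0.
have ai : 0 < alpha^-1 by rewrite invr_gt0.
have aT : alpha * T <= T by rewrite ler_piMl// ltW.
have aT0 : 0 < alpha * T by exact: mulr_gt0.
have Tai : 0 < T * alpha^-1 by exact: mulr_gt0.
have -> : (1 + T) * (q * (1 + alpha^-1) + q') = q * ((1 + T) * (1 + alpha^-1)) + q' * (1 + T) by ring.
apply: lerD; first by rewrite ler_pM2l// mulrDl mul1r mulrDr mulr1; lra.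
by rewrite -mulrA ler_pM2l//; have := T0; lra.
Qed.

End Recovery.

Lemma recovery_cost : exists K T0 : R, [/\ 0 < K, 0 < T0 & forall T, T0 <= T ->
  exists2 b, alpha < b < 1 & period alpha b <= T /\
    expR (alpha * T) * excess b (period alpha b) <=
    rate + K * ((1 + T) * expR (- (alpha * T)))].
Proof.
have /andP[a0 a1] := alpha01; have al2 := alpha_sqr_lt1 alpha01.
have C20 : 0 < rec_const.
  by rewrite addr_gt0// ?mulr_gt0 ?divr_gt0 ?exprn_gt0 ?addr_gt0 ?invr_gt0 ?mulr_gt0.
(* From [del <= 4 * E^-1] and [2 * alpha + del <= 3], with [E = expR (alpha * T)]. *)
pose K := 4 * (2 / (1 - alpha ^+ 2) + 3 * rec_const).
have q3 : 0 < 2 / (1 - alpha ^+ 2) by rewrite divr_gt0.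
have p2 : 0 < 4 * 16 / (alpha ^+ 2 * (1 - alpha ^+ 2)).
  by apply: divr_gt0; apply: mulr_gt0 => //; exact: exprn_gt0.
exists K, (1 + 4 * 16 / (alpha ^+ 2 * (1 - alpha ^+ 2))); split.
- by rewrite mulr_gt0// addr_gt0// mulr_gt0.
- by rewrite addr_gt0.
move=> T hT.
have T0 : 0 < T by lra.
(* With [del <= 4 * E^-1], the 16 yields the hypothesis [4 * del <= 1 - alpha ^+ 2] of
   [energy_le]. *)
have h2 := @exp_decay _ _ alpha01 16 (1 - alpha ^+ 2) T (ltr0n R 16) al2 T0 ltac:(lra).
clear hT p2.
have E0 := expR_gt0 (alpha * T).
have EnE : expR (- (alpha * T)) = (expR (alpha * T))^-1 by rewrite expRN.
rewrite EnE in h2; rewrite EnE.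
have E1 : 0 < expR (alpha * T) - 1 by rewrite subr_gt0 expR_gt1 mulr_gt0.
pose del := 2 * alpha / (expR (alpha * T) - 1).
have del0 : 0 < del by rewrite divr_gt0 ?mulr_gt0.
have hdel : del * (expR (alpha * T) - 1) = 2 * alpha by rewrite divfK// gt_eqF.
have := excess_rec_le T0 del0 _ erefl _ _ hdel.
have := period_rec_le T0 del0 erefl _ hdel.
move: E0 E1 hdel h2; clear EnE; set E := expR _ => E0 E1 hdel h2 hper hex.
have small : 16 * E^-1 <= 1 - alpha ^+ 2.
  apply: le_trans h2; rewrite ler_pM2l// ler_peMl ?invr_ge0 ?(ltW E0)//.
  by rewrite lerDl ltW.
have Ei : 0 < E^-1 by rewrite invr_gt0.
have a2 : 0 <= alpha ^+ 2 by exact: sqr_ge0.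
have Ei2 : E^-1 <= 2^-1 by lra.
have E2 : 2 <= E by move: Ei2; rewrite lef_pV2 ?posrE.
have del4 : del <= 4 * E^-1.
  rewrite /del ler_pdivrMr//.
  have -> : 4 * E^-1 * (E - 1) = 4 - 4 * E^-1 by field; rewrite gt_eqF.
  lra.
have [b1 _ _ th] := @energy_le _ _ alpha01 (alpha + del) del ltac:(lra) ltac:(lra) ltac:(lra).
have hb : alpha < alpha + del < 1 by rewrite b1 andbT; lra.
have d1 : del <= 1 by lra.
exists (alpha + del) => //; split; first exact: hper.
have {hex} := hex d1 hb th.
have {hper b1 th hb} Ed : E * del = 2 * alpha + del by rewrite -hdel; ring.
move=> hex; apply: (@le_trans _ _ (E * (del * (2 / (1 - alpha ^+ 2) + del * ((1 + T) * rec_const))))).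
  by rewrite ler_pM2l.
rewrite mulrA Ed.
have -> : (2 * alpha + del) * (2 / (1 - alpha ^+ 2) + del * ((1 + T) * rec_const)) =
  rate + del * (2 / (1 - alpha ^+ 2) + (2 * alpha + del) * ((1 + T) * rec_const)) by rewrite /rate; ring.
rewrite lerD2l.
apply: (@le_trans _ _ ((4 * E^-1) * ((2 / (1 - alpha ^+ 2) + 3 * rec_const) * (1 + T)))); last first.
  by rewrite le_eqVlt; apply/orP; left; apply/eqP; rewrite /K; ring.
have TC : 0 < (1 + T) * rec_const by rewrite mulr_gt0// addr_gt0.
have ad : 0 < 2 * alpha + del by rewrite addr_gt0// mulr_gt0.
apply: ler_pM => //; first exact: ltW.
  by apply: ltW; rewrite addr_gt0// mulr_gt0.
have w1 : 2 / (1 - alpha ^+ 2) <= 2 / (1 - alpha ^+ 2) * (1 + T) by rewrite ler_peMr// ?lerDl ltW.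
have w2 : (2 * alpha + del) * ((1 + T) * rec_const) <= 3 * ((1 + T) * rec_const).
  by rewrite ler_pM2r//; lra.
have -> : (2 / (1 - alpha ^+ 2) + 3 * rec_const) * (1 + T) =
  2 / (1 - alpha ^+ 2) * (1 + T) + 3 * ((1 + T) * rec_const) by ring.
exact: lerD.
Qed.

End RecoveryCost.

(** * Topology of the phase space *)

Section Compactness.
Context {T : topologicalType}.

Lemma continuous_inj_hausdorff (Y : topologicalType) (f : T -> Y) :
  continuous f -> injective f -> hausdorff_space Y -> hausdorff_space T.
Proof.
move=> cf inj hY p q pq; apply: inj; apply: hY => A B hA hB.
have [x [Ax Bx]] := pq _ _ (cf p _ hA) (cf q _ hB).
by exists (f x).
Qed.

Lemma hausdorff_prod (Y : topologicalType) :
  hausdorff_space T -> hausdorff_space Y -> hausdorff_space (T * Y)%type.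
Proof.
move=> hT hY [p1 p2] [q1 q2] pq; congr pair.
- apply: hT => A B hA hB.
  have [[x y] [/= Ax Bx]] := pq (A `*` setT) (B `*` setT)
    ltac:(exists (A, setT) => //; split => //; exact: filterT)
    ltac:(exists (B, setT) => //; split => //; exact: filterT).
  by exists x; split; [case: Ax|case: Bx].
- apply: hY => A B hA hB.
  have [[x y] [/= Ax Bx]] := pq (setT `*` A) (setT `*` B)
    ltac:(exists (setT, A) => //; split => //; exact: filterT)
    ltac:(exists (setT, B) => //; split => //; exact: filterT).
  by exists y; split; [case: Ax|case: Bx].
Qed.

(** Leads from convergent subsequences to topological compactness without a metric. If a filter has
    no cluster point in [W], the closure of one of its sets avoids [W], so that set contains terms
    of finitely many indices only. *)
Lemma compact_setU_range (W : set T) (x_ : nat -> T) : compact W ->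
  (forall O, open O -> W `<=` O -> \forall n \near \oo, O (x_ n)) ->
  compact (W `|` range x_).
Proof.
move=> cW tail F PF FK.
have [[p [Wp pF]]|noW] := pselect (exists p, W p /\ cluster F p).
  by exists p; split => //; left.
have [B FB BW] : exists2 B, F B & W `<=` ~` closure B.
  have PFF := powerset_filter_from_filter PF.
  (* Compactness of [W], in near-covering form, makes one [B] serve all its points. *)
  have near_W : \forall B \near powerset_filter_from F, W `<=` [set p | ~ closure B p].
    apply: ((compact_near_coveringP W).1 cW) => p Wp.
    have : ~ cluster F p by move=> h; apply: noW; exists p.
    move=> /existsNP[A /existsNP[V /not_implyP[FA /not_implyP[pV AV]]]].
    exists (V^°, [set B | B `<=` A]) => /=.
      by split; [exact: nbhs_interior|exact: small_set_sub].
    move=> [x B] /= [Vx BA] /(_ V Vx)[y [By Vy]].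
    by apply: AV; exists y; split => //; exact: BA.
  have [B [BW FB]] := filter_ex (filterI near_W (near_small_set PF)).
  by exists B.
have [N _ NP] := tail _ (closed_openC (@closed_closure _ B)) BW.
have cN : compact (x_ @` `I_N) by apply: finite_compact; exact/finite_image/finite_II.
have FN : F (x_ @` `I_N).
  apply: filterS (filterI FB FK) => y [By [Wy|[n _ yE]]].
    by case: (BW y Wy); exact: subset_closure.
  exists n => //=; rewrite ltnNge; apply/negP => Nn; apply: (NP n Nn).
  by rewrite yE; exact: subset_closure.
by have [p [[n _ nE] pF]] := cN F PF FN; exists p; split => //; right; exists n.
Qed.

End Compactness.

(** * The weak-star topology and convergence criteria *)

Section WeakStar.
Context {R : realType}.
Local Notation mu := (@lebesgue_measure R).
Local Notation L1 := (LfunType mu (@lexx _ _ 1%E)).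

Lemma cvg_initial (S : choiceType) (T : topologicalType) (f : S -> T) (J : Type)
    (F : set_system J) (FF : Filter F) (x_ : J -> S) (x : S) :
  f (x_ j) @[j --> F] --> f x ->
  x_ j @[j --> F] --> (x : initial_topology f).
Proof.
move=> h A /=; rewrite nbhsE => -[B [[C oC <-] Cx] CA].
have : nbhs (f x) C by exact: open_nbhs_nbhs.
by move=> /h; rewrite /nbhs /=; apply: filterS => j; exact: CA.
Qed.

Lemma cvg_ptws (S : choiceType) (T : uniformType) (J : Type)
    (F : set_system J) (FF : Filter F) (f_ : J -> S -> T) (f : S -> T) :
  (forall s, f_ j s @[j --> F] --> f s) ->
  f_ j @[j --> F] --> (f : {ptws S -> T}).
Proof.
move=> h; apply/cvg_sup => s; apply: cvg_initial; exact: h.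
Qed.

Lemma cvg_Linf01 (J : Type) (F : set_system J) (FF : Filter F)
    (u_ : J -> Linf01 R) (u : Linf01 R) :
  (forall f : L1, pairing (u_ j) f @[j --> F] --> pairing u f) ->
  u_ j @[j --> F] --> u.
Proof.
by move=> h; apply: (@cvg_initial _ _ (@pairing R)); exact: cvg_ptws.
Qed.

Lemma L1_integrable (f : L1) : mu.-integrable setT (EFin \o f).
Proof. exact: (Lfun1_integrable mu f).1 (LfunP f). Qed.

Lemma L1_exists (f : R -> R) : mu.-integrable setT (EFin \o f) ->
  exists h : L1, forall x, h x = f x.
Proof.
move=> fi; have hf : f \in Lfun mu 1 by apply/Lfun1_integrable.
by exists (Lfun_Sub (@lexx _ _ 1%E) hf).
Qed.

(** Testing against the difference of the two functions on [[- n, n]] makes its L^2 norm there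
    vanish. This gives the Hausdorff property, hence uniqueness of limits. *)
Lemma pairing_inj : injective (@pairing R).
Proof.
move=> u v uv; apply/val_inj.
pose f := Linf01_fun u; pose h := Linf01_fun v.
have mf : measurable_fun setT f by exact: measurable_funPT (repr (val u)).
have mh : measurable_fun setT h by exact: measurable_funPT (repr (val v)).
suff fh : \forall x \ae mu, f x = h x.
  rewrite -[val u]reprK -[val v]reprK; apply/eqmodP/asboolP.
  by apply: ae_imp fh => x.
have f01 : \forall x \ae mu, 0 <= f x <= 1 by exact: set_valP u.
have h01 : \forall x \ae mu, 0 <= h x <= 1 by exact: set_valP v.
have key n : \forall x \ae mu, `|x| <= n%:R -> f x = h x.
  (* [cut] makes the representatives bounded everywhere and changes them only on null sets. *)
  pose cut (k : R -> R) (x : R) := Num.max 0 (Num.min 1 (k x)).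
  have cutE (k : R -> R) x : 0 <= k x <= 1 -> cut k x = k x.
    by move=> /andP[k0 k1]; rewrite /cut min_r// max_r.
  have bcut (k : R -> R) : measurable_fun setT k -> bmeas (cut k).
    move=> mk; split; first by apply: measurable_maxr => //; exact: measurable_minr.
    exists 1 => x; rewrite /cut ger0_norm ?le_max ?lexx//.
    by rewrite ge_max ler01 ge_min lexx.
  pose g0 x := cut f x - cut h x.
  have bg : bmeas g0 by apply: bmeasB; exact: bcut.
  pose D : set R := `[(- n%:R)%R, n%:R]%classic.
  have mD : measurable D by exact: measurable_itv.
  have [k kE] : exists k : L1, forall x, k x = (g0 \_ D) x.
    apply: L1_exists; rewrite -restrict_EFin.
    apply: (@integrable_mkcond _ _ R mu D (EFin \o g0) mD).1; exact: bmeas_integrable.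
  have pE (w : R -> R) : measurable_fun setT w -> (\forall x \ae mu, 0 <= w x <= 1) ->
      \int[mu]_x (w x * k x) = \int[mu]_(x in D) (cut w x * g0 x).
    move=> mw w01; transitivity (\int[mu]_(x in D) (w x * g0 x)).
      rewrite [RHS]Rintegral_mkcond; congr Rintegral; apply/funext => x.
      by rewrite kE /patch; case: ifP => // _; rewrite mulr0.
    rewrite /Rintegral; congr fine; apply: ae_eq_integral => //.
    - by apply/measurable_EFinP; apply: measurable_funTS; exact: measurable_funM mw bg.1.
    - apply/measurable_EFinP; apply: measurable_funTS.
      exact: measurable_funM (bcut _ mw).1 bg.1.
    - by apply: ae_imp w01 => x wx _; rewrite cutE.
  have := congr1 (fun p => p k) uv; rewrite /pairing !pE// => e0.
  have I0 : \int[mu]_(x in D) (g0 x ^+ 2) = 0.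
    have -> : (fun x => g0 x ^+ 2) = (fun x => cut f x * g0 x - cut h x * g0 x).
      by apply/funext => x; rewrite -mulrBl -expr2.
    by rewrite itgB ?e0 ?subrr//; apply: bmeasM => //; exact: bcut.
  have bg2 : bmeas (fun x => g0 x ^+ 2) by apply: bmeasM.
  have : ae_eq mu D (fun x => (g0 x ^+ 2)%:E) (cst 0%E).
    apply/ae_eq_integral_abs => //.
      by apply/measurable_EFinP; apply: measurable_funTS; exact: bg2.1.
    under eq_integral do rewrite gee0_abs ?lee_fin ?sqr_ge0//.
    by rewrite itg_EFin// I0.
  move=> ae0; have : \forall x \ae mu, `|x| <= n%:R -> cut f x = cut h x.
    apply: ae_imp ae0 => x h0 xn; have : D x by rewrite /D /= in_itv /= -ler_norml.
    by move=> /h0 [] /eqP; rewrite sqrf_eq0 subr_eq0 => /eqP.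
  move=> cutfh; have fh01 := ae_imp2 (fun x a b => conj a b) f01 h01.
  apply: (ae_imp2 _ fh01 cutfh) => x [hf hh] eq xn.
  by rewrite -(cutE f)// eq// cutE.
have : \forall x \ae mu, forall n : nat, `|x| <= n%:R -> f x = h x.
  by apply: (@ae_foralln _ _ _ mu).
apply: ae_imp => x hx.
exact: (hx _ (ltW (archi_boundP (normr_ge0 x)))).
Qed.

Lemma hausdorff_Linf01 : hausdorff_space (Linf01 R).
Proof.
apply: (@continuous_inj_hausdorff _ _ (@pairing R)).
- exact: initial_continuous.
- exact: pairing_inj.
- by apply: hausdorff_product => f; exact: Rhausdorff.
Qed.

Lemma hausdorff_X (alpha : R) : hausdorff_space (X alpha).
Proof.
apply: hausdorff_prod; first exact: hausdorff_Linf01.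
apply: (@continuous_inj_hausdorff _ _ (fun f : C_set alpha => val f : {uniform R -> R})).
- exact: initial_continuous.
- exact: val_inj.
- move=> p q pq; apply/funext => x; apply: Rhausdorff => A B hA hB.
  have ev (w : {uniform R -> R}) (C : set R) : nbhs (w x) C -> nbhs w [set w' | C (w' x)].
    rewrite -nbhs_entourageE => -[E entE EC]; apply/uniform_nbhs.
    by exists E; split => // w' wE; apply: EC; apply/xsectionP; exact: wE.
  by have [w [Aw Bw]] := pq _ _ (ev p A hA) (ev q B hB); exists (w x).
Qed.


(** If [w > del] then [w <= w ^+ 2 / del], and [a] is split at height [K]. This lets an L^2 bound on
    [w] act against a merely integrable [a]. *)
Lemma weight_split (a w del K : R) : 0 <= a -> 0 <= w <= 1 -> 0 < del ->
  0 <= K -> w * a <= del * a + (K * w ^+ 2 + Num.max 0 (a - K)) / del.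
Proof.
move=> a0 /andP[w0 w1] d0 K0.
have m0 : 0 <= Num.max 0 (a - K) by rewrite le_max lexx.
have m1 : a - K <= Num.max 0 (a - K) by rewrite le_max lexx orbT.
set m := Num.max _ _ in m0 m1 *.
have [wd|dw] := leP w del.
  apply: (@le_trans _ _ (del * a)); first exact: ler_wpM2r.
  by rewrite lerDl divr_ge0 ?(ltW d0)// addr_ge0// mulr_ge0// sqr_ge0.
apply: (@le_trans _ _ ((K * w ^+ 2 + m) / del)); last by rewrite lerDr mulr_ge0// ltW.
rewrite ler_pdivlMr//.
have w2 : w ^+ 2 <= 1 by rewrite expr_le1.
have : w * a * del <= w ^+ 2 * a by rewrite expr2 -!mulrA ler_wpM2l// mulrC ler_wpM2r// ltW.
have : w ^+ 2 * a <= w ^+ 2 * (K + m) by apply: ler_wpM2l; [exact: sqr_ge0|lra].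
have : w ^+ 2 * m <= m by rewrite ler_piMl.
lra.
Qed.

Lemma Linf01_repr (U : Linf01 R) : exists u : R -> R, [/\ measurable_fun setT u,
  (forall x, 0 <= u x <= 1) & \forall x \ae mu, Linf01_fun U x = u x].
Proof.
exists (fun x => Num.max 0 (Num.min 1 (Linf01_fun U x))); split.
- apply: measurable_maxr => //; apply: measurable_minr => //.
  exact: measurable_funPT (repr (val U)).
- by move=> x; rewrite le_max lexx ge_max ler01 ge_min lexx.
- have : \forall x \ae mu, 0 <= Linf01_fun U x <= 1 by exact: set_valP U.
  by apply: ae_imp => x /andP[k0 k1]; rewrite min_r// max_r.
Qed.

Lemma pairing_repr (U : Linf01 R) (u : R -> R) (f : L1) : measurable_fun setT u ->
  (\forall x \ae mu, Linf01_fun U x = u x) -> pairing U f = \int[mu]_x (u x * f x).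
Proof.
move=> mu_ Uu; rewrite /pairing /Rintegral; congr fine.
have mf : measurable_fun setT f by apply/measurable_EFinP; exact: measurable_int (L1_integrable f).
apply: ae_eq_integral => //.
- apply/measurable_EFinP; apply: measurable_funM mf; exact: measurable_funPT (repr (val U)).
- by apply/measurable_EFinP; exact: measurable_funM.
- by apply: ae_imp Uu => x ->.
Qed.

Lemma pairing_dist (U V : Linf01 R) (f : L1) (w : R -> R) (e del K : R) :
  measurable_fun setT w -> (forall x, 0 <= w x <= 1) -> 0 <= e -> 0 < del -> 0 <= K ->
  mu.-integrable setT (fun x => (w x ^+ 2)%:E) ->
  (\forall x \ae mu, `|Linf01_fun U x - Linf01_fun V x| <= e + w x) ->
  `|pairing U f - pairing V f| <= (e + del) * (\int[mu]_x `|f x|) +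
    (K * (\int[mu]_x (w x ^+ 2)) + \int[mu]_x Num.max 0 (`|f x| - K)) / del.
Proof.
move=> mw w01 e0 d0 K0 iw UV.
have fi := L1_integrable f.
have mf : measurable_fun setT f by apply/measurable_EFinP; exact: measurable_int fi.
have fai : mu.-integrable setT (EFin \o (fun x => `|f x|)) by exact: integrable_abse fi.
have dom (h : R -> R) : measurable_fun setT h -> (forall x, `|h x| <= `|f x|) ->
    mu.-integrable setT (EFin \o h).
  move=> mh hf; apply: (le_integrable _ _ _ fi) => //; first exact/measurable_EFinP.
  by move=> x _; rewrite lee_fin.
have [u [mu_ u01 Uu]] := Linf01_repr U.
have [v [mv v01 Vv]] := Linf01_repr V.
have scale (h : R -> R) x : 0 <= h x <= 1 -> `|h x * f x| <= `|f x|.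
  by move=> /andP[h0 h1]; rewrite normrM ger0_norm// ler_piMl.
have iu : mu.-integrable setT (EFin \o (fun x => u x * f x)).
  by apply: dom => [|x]; [exact: measurable_funM|exact: scale].
have iv : mu.-integrable setT (EFin \o (fun x => v x * f x)).
  by apply: dom => [|x]; [exact: measurable_funM|exact: scale].
rewrite (pairing_repr f mu_ Uu) (pairing_repr f mv Vv) -RintegralB//.
pose m x := Num.max 0 (`|f x| - K).
have mn : measurable_fun setT (fun x => `|f x|) by apply: measurableT_comp mf.
have mm : measurable_fun setT m.
  by apply: measurable_maxr => //; apply: measurable_funB.
have im : mu.-integrable setT (EFin \o m).
  apply: dom => // x; rewrite /m ger0_norm ?le_max ?lexx// ge_max normr_ge0/=.
  by rewrite lerBlDr lerDl.
have iB : mu.-integrable setT (EFin \o (fun x => u x * f x - v x * f x)).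
  by have := integrableB measurableT iu iv.
apply: (le_trans (le_normr_Rintegral _ iB)) => //.
have i1 : mu.-integrable setT (EFin \o (fun x => (e + del) * `|f x|)).
  by have := integrableZl measurableT (e + del) fai.
have i2 : mu.-integrable setT (EFin \o (fun x => K * w x ^+ 2)).
  by have := integrableZl measurableT K iw.
have i3 : mu.-integrable setT (EFin \o (fun x => K * w x ^+ 2 + m x)).
  by have := integrableD measurableT i2 im.
have i4 : mu.-integrable setT (EFin \o (fun x => (K * w x ^+ 2 + m x) / del)).
  by have := integrableZr measurableT del^-1 i3.
have i5 : mu.-integrable setT (EFin \o (fun x => (e + del) * `|f x| + (K * w x ^+ 2 + m x) / del)).
  by have := integrableD measurableT i1 i4.
have -> : (e + del) * (\int[mu]_x `|f x|) +
    (K * (\int[mu]_x (w x ^+ 2)) + \int[mu]_x Num.max 0 (`|f x| - K)) / del =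
    \int[mu]_x ((e + del) * `|f x| + (K * w x ^+ 2 + m x) / del).
  by rewrite RintegralD// RintegralZl// RintegralZr// RintegralD// RintegralZl.
rewrite /Rintegral; apply: fine_le.
- by apply: integrable_fin_num => //; exact: integrable_abse iB.
- by apply: integrable_fin_num => //; exact: i5.
have H0 x : 0 <= (e + del) * `|f x| + (K * w x ^+ 2 + m x) / del.
  apply: addr_ge0; first by rewrite mulr_ge0// addr_ge0// ltW.
  apply: divr_ge0; last exact: ltW.
  have m0 : 0 <= m x by rewrite /m le_max lexx.
  by rewrite addr_ge0// mulr_ge0// sqr_ge0.
apply: ae_ge0_le_integral => //.
- apply/measurable_EFinP; apply: measurableT_comp => //.
  by apply: measurable_funB; apply: measurable_funM.
- by move=> x _; rewrite lee_fin.
- exact: measurable_int i5.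
- apply: (ae_imp2 _ UV (ae_imp2 (fun x a b => conj a b) Uu Vv)) => x le [ux vx] _.
  rewrite lee_fin -mulrBl normrM -ux -vx.
  apply: (le_trans (ler_wpM2r (normr_ge0 _) le)).
  have := weight_split (normr_ge0 (f x)) (w01 x) d0 K0; rewrite -/(m x).
  by rewrite !mulrDl; lra.
Qed.

Lemma tail_cvg0 (f : L1) : \int[mu]_x Num.max 0 (`|f x| - n%:R) @[n --> \oo] --> (0 : R).
Proof.
have fi := L1_integrable f.
have mf : measurable_fun setT f by apply/measurable_EFinP; exact: measurable_int fi.
have mn : measurable_fun setT (fun x => `|f x|) by apply: measurableT_comp mf.
have [| | | | |_ _ /=] := @dominated_convergence _ _ _ mu setT measurableT
  (fun n x => (Num.max 0 (`|f x| - n%:R))%:E) (cst 0%E) (fun x => `|f x|%:E).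
- by move=> n; apply/measurable_EFinP; apply: measurable_maxr => //; exact: measurable_funB.
- exact: measurable_cst.
- apply: ae_all => x _; apply: cvg_near_cst; near=> n.
  congr EFin; apply/max_idPl; rewrite subr_le0; near: n; exact: nbhs_infty_ger.
- exact: integrable_abse fi.
- apply: ae_all => x n _; rewrite lee_fin ger0_norm ?le_max ?lexx//.
  by rewrite ge_max normr_ge0/= lerBlDr lerDl.
by rewrite integral0 => /fine_cvg.
Unshelve. all: by end_near. Qed.

(** The hypothesis has the form that the energy provides: a uniform error, from [phi], plus an L^2
    error, from the entropy of [u]. *)
Lemma cvg_pairing (J : Type) (F : set_system J) (FF : Filter F)
    (U_ : J -> Linf01 R) (V : Linf01 R) :
  (forall e : R, 0 < e -> \forall j \near F, exists w : R -> R,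
     [/\ measurable_fun setT w, (forall x, 0 <= w x <= 1),
      mu.-integrable setT (fun x => (w x ^+ 2)%:E),
      \int[mu]_x (w x ^+ 2) <= e &
      \forall x \ae mu, `|Linf01_fun (U_ j) x - Linf01_fun V x| <= e + w x]) ->
  U_ j @[j --> F] --> V.
Proof.
move=> h; apply: cvg_Linf01 => f; apply/cvgrPdist_le => eps eps0.
pose A : R := \int[mu]_x `|f x|.
have A0 : 0 <= A by apply: Rintegral_ge0.
(* The parameters are chosen in this order: [del] for the uniform terms, [K] for the tail of [f],
   then [e] for the L^2 term. *)
pose del := eps / (4 * (A + 1)).
have d0 : 0 < del by rewrite divr_gt0//; lra.
have dA : del * (A + 1) = eps / 4 by rewrite /del; field; lra.
have dA' : del * A <= eps / 4 by lra.
have [N _ NP] : \forall n \near \oo, `|0 - \int[mu]_x Num.max 0 (`|f x| - n%:R)| <= del * (eps / 4).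
  by move: (tail_cvg0 f) => /cvgrPdist_le; apply; rewrite mulr_gt0//; lra.
have := NP N (leqnn N); rewrite sub0r normrN => tl.
have {}tl := le_trans (ler_norm _) tl.
pose K : R := N%:R.
have K0 : 0 <= K by [].
pose e := Num.min del (del * (eps / 4) / (K + 1)).
have e0 : 0 < e.
  rewrite lt_min d0/=; apply: divr_gt0; last by lra.
  by apply: mulr_gt0 => //; exact: divr_gt0.
apply: filterS (h e e0) => j [w [mw w01 iw we UV]].
rewrite distrC; apply: (le_trans (pairing_dist f mw w01 (ltW e0) d0 K0 iw UV)).
rewrite -/A.
have e1 : e <= del by rewrite ge_min lexx.
have e2 : e <= del * (eps / 4) / (K + 1) by rewrite ge_min lexx orbT.
rewrite ler_pdivlMr in e2; last by lra.
have b1 : (e + del) * A <= eps / 2 by nra.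
have b2 : (K * (\int[mu]_x (w x ^+ 2)) + \int[mu]_x Num.max 0 (`|f x| - K)) / del <= eps / 2.
  rewrite ler_pdivrMr//.
  have : K * (\int[mu]_x (w x ^+ 2)) <= K * e by exact: ler_wpM2l.
  rewrite -/K in tl; lra.
lra.
Qed.

Lemma cvg_X (alpha : R) (J : Type) (F : set_system J) (FF : Filter F)
    (x_ : J -> X alpha) (x : X alpha) :
  (forall e : R, 0 < e -> \forall j \near F, (forall y, `|Xphi (x_ j) y - Xphi x y| <= e) /\
    exists w : R -> R,
     [/\ measurable_fun setT w, (forall x, 0 <= w x <= 1),
      mu.-integrable setT (fun x => (w x ^+ 2)%:E),
      \int[mu]_x (w x ^+ 2) <= e &
      \forall y \ae mu, `|Xu (x_ j) y - Xu x y| <= e + w y]) ->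
  x_ j @[j --> F] --> x.
Proof.
move=> h; have E (y : X alpha) : y = (y.1, y.2) by case: y.
rewrite [x]E (_ : (fun j => x_ j) = (fun j => ((x_ j).1, (x_ j).2))); last exact/funext.
apply: (@cvg_pair _ _ _ F (nbhs x.1) (nbhs x.2)).
  by apply: cvg_pairing => e e0; apply: filterS (h e e0) => j [].
apply: (@cvg_initial _ _ (fun f : C_set alpha => val f : {uniform R -> R})) => A.
move=> /uniform_nbhs[E1 [entE EA]].
move: entE; rewrite -entourage_ballE => -[e /= e0 eE].
change (F (fun j => A (val (x_ j).2))).
have e2 : 0 < e / 2 by exact: divr_gt0.
apply: filterS (h (e / 2) e2) => j [hj _]; apply: EA => y _.
apply: eE; rewrite /ball /=; apply: le_lt_trans (_ : e / 2 < e); last by move: e0 => /=; lra.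
by rewrite distrC; exact: hj.
Qed.

End WeakStar.

(** * Stability of the standing wave *)

Section Stability.
Context {R : realType} (alpha : R) (alpha01 : 0 < alpha < 1).
Local Notation mu := (@lebesgue_measure R).
Local Notation c := (phip alpha).
Local Notation "'I' a b f" := (\int[mu]_(x in `[a, b]) (f x))%R (at level 10, a, b, f at level 9).
Local Ltac pull := have /andP[a0 a1] := alpha01; have al2 := alpha_sqr_lt1 alpha01;
  have c0 := phip_gt0 alpha01.
Local Notation q := (pvel (1 - alpha ^+ 2)).
Local Notation W := (wave alpha).

(** Turns an entropy bound into an L^1 bound pointwise, with [lam] left to be chosen, in place of
    the Cauchy-Schwarz inequality. *)
Lemma norm_amgm (t lam e : R) : 0 < lam -> t ^+ 2 / 2 <= e -> `|t| <= lam / 2 + lam^-1 * e.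
Proof.
move=> lam0 te; apply: (@le_trans _ _ (lam / 2 + lam^-1 * (t ^+ 2 / 2))); last first.
  by rewrite lerD2l ler_pM2l ?invr_gt0.
have : 0 <= lam^-1 / 2 * (lam - `|t|) ^+ 2.
  by rewrite mulr_ge0 ?sqr_ge0// divr_ge0// invr_ge0 ltW.
rewrite -(real_normK (num_real t)).
have -> : lam^-1 / 2 * (lam - `|t|) ^+ 2 = lam / 2 + lam^-1 * (`|t| ^+ 2 / 2) - `|t|.
  by field; rewrite gt_eqF.
by rewrite subr_ge0.
Qed.

Lemma wave_le_phip x : W x <= c.
Proof.
have := @wave_y_bound _ alpha x; pull => /(_ a0); rewrite ltr_norml => /andP[y1 y2].
rewrite /wave /phip /ds ler_ln ?posrE ?divr_gt0//; last first; try by rewrite /up; lra.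
rewrite ler_pdivrMr; last by lra.
rewrite [leRHS]mulrAC ler_pdivlMr; last by rewrite /up; lra.
by rewrite /up; nra.
Qed.

Lemma wave_bound x : `|W x| <= c.
Proof.
rewrite ler_norml wave_le_phip andbT lerNl -(waveN x alpha01); exact: wave_le_phip.
Qed.

Lemma kap_sub_ge0 (a b : R) : 0 <= a -> 0 <= b -> 0 <= (a - b) * (kap a - kap b).
Proof.
move=> ha hb; have [ab|/ltW ba] := leP a b.
  by have h := kap_le ha ab; apply: mulr_le0; rewrite subr_le0.
by have h := kap_le hb ba; apply: mulr_ge0; rewrite subr_ge0.
Qed.

Lemma kap_sub_le0 (a b : R) : a <= 0 -> b <= 0 -> (a - b) * (kap a - kap b) <= 0.
Proof.
move=> ha hb; have := @kap_sub_ge0 (- a) (- b) ltac:(lra) ltac:(lra).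
by rewrite !kapN; lra.
Qed.

Section Profile.
Variables (u phi d : R -> R) (pr : profile alpha u phi d) (l z : R).
Hypotheses (phil : phi l = c) (phiNl : phi (- l) = - c) (phiz : phi z = 0) (zl : - l <= z <= l).

(** The two sides of the zero are calibrated independently of each other. *)
Lemma excess_le b1 b2 : alpha < b1 < 1 -> alpha < b2 < 1 ->
  excess alpha b1 (l - z) + excess alpha b2 (l + z) <=
  I (- l) l (lag alpha u phi d) - 2 * mhalf alpha.
Proof.
move=> hb1 hb2; have /andP[z1 z2] := zl.
have t1 := theta01 alpha01 hb1; have t2 := theta01 alpha01 hb2.
rewrite (itg_cat (bmeas_lag alpha01 pr) z1 z2).
have h1 := itg_lag_ge alpha01 pr t1 z2; have h2 := itg_lag_ge alpha01 pr t2 z1.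
rewrite phil phiz in h1; rewrite phiNl phiz (action_half alpha01 t2) in h2.
rewrite /excess /halfmin {1}/halfact; lra.
Qed.

(** Calibration at [alpha] itself is excluded, since [pvel] vanishes at the end values. The
    entropies are controlled at a nearby [b], the velocities are compared, and the error [e] is sent
    to 0. *)
Lemma itg_phase_le (eta lam : R) : I (- l) l (lag alpha u phi d) - 2 * mhalf alpha <= eta ->
  0 < lam ->
  I (- l) l (fun x => (u x - sg (phi x)) ^+ 2) <= 2 * eta /\
  I (- l) l (fun x => `|d x - q (phi x)|) <= lam * l + eta / lam.
Proof.
move=> Ile lam0; pull.
have l0 : - l <= l by have /andP[] := zl; exact: le_trans.
have bphi h : continuous h -> bmeas (fun x => h (phi x)) := bmeas_cphi pr (h := h).
have bq : bmeas (fun x => q (phi x)).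
  by apply: bphi => x; exact: isd_continuous (isdB (isd_cst 1 _) (isdZ _ (is_derive_kap x))).
have bsg : bmeas (fun x => sg (phi x)) by apply: bphi => x; exact: isd_continuous (is_derive_sg x).
have bk : bmeas (fun x => kap (phi x)) by apply: bphi => x; exact: isd_continuous (is_derive_kap x).
have bu : bmeas u by exact: bmeas_u pr.
have bd : bmeas d by exact: bmeas_d pr.
have bu2 : bmeas (fun x => (u x - sg (phi x)) ^+ 2).
  by apply: bmeasM; apply: bmeasB.
have bdq : bmeas (fun x => `|d x - q (phi x)|) by apply: bmeas_norm; apply: bmeasB.
pose k := (1 - alpha ^+ 2)^-1.
have kk x : kap (phi x) <= k.
  rewrite /k -(kap_phip alpha01); apply: kap_le_norm.
  by rewrite [leRHS]ger0_norm; [exact: prof_bound pr x|exact: ltW].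
have k0 : 0 < k by rewrite invr_gt0.
have key (e : R) : 0 < e ->
  I (- l) l (fun x => (u x - sg (phi x)) ^+ 2) <= 2 * (eta + e) /\
  I (- l) l (fun x => `|d x - q (phi x)|) <= lam * l + (eta + e) / lam + e.
  move=> e0.
  pose L := l + 1.
  have L0 : 0 < L by rewrite /L; lra.
  pose del := Num.min ((1 - alpha ^+ 2) / 4) (e * (1 - alpha ^+ 2) / (8 * L)).
  have del0 : 0 < del by rewrite lt_min !divr_gt0 ?mulr_gt0.
  have d1 : del <= (1 - alpha ^+ 2) / 4 by rewrite ge_min lexx.
  have d2 : del <= e * (1 - alpha ^+ 2) / (8 * L) by rewrite ge_min lexx orbT.
  rewrite ler_pdivlMr in d2; last by rewrite mulr_gt0.
  have [b1 E0 E1 _] := @energy_le _ _ alpha01 (alpha + del) del ltac:(lra) ltac:(lra) ltac:(lra).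
  pose b := alpha + del.
  have hb : alpha < b < 1 by rewrite /b; lra.
  have th := theta01 alpha01 hb.
  have b2 : 0 <= b ^+ 2 - alpha ^+ 2 by have /andP[_ h] := th; rewrite subr_ge0 -lerN2 -(lerD2l 1) ltW.
  have be : bmeas (fun x => ent (u x) (sg (phi x))) by exact: bmeas_entu pr.
  have bed := bmeas_entd alpha01 pr th.
  have := itg_lag alpha01 pr th l0.
  have entD : I (- l) l (fun x => ent (u x) (sg (phi x)) + ent (d x) (pvel (1 - b ^+ 2) (phi x))) =
    I (- l) l (fun x => ent (u x) (sg (phi x))) +
    I (- l) l (fun x => ent (d x) (pvel (1 - b ^+ 2) (phi x))) by exact: itgD.
  rewrite phil phiNl opprK entD => lagE.
  have half := action_half alpha01 th.
  have mb := mhalf_le alpha01 hb.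
  have En : energy alpha (1 - b ^+ 2) * (l + l) <= e.
    apply: (energy_length_le E0 _ L0 al2 _ d2); [by rewrite /L; lra|by rewrite -ler_pdivlMr].
  have tot : I (- l) l (fun x => ent (u x) (sg (phi x))) +
     I (- l) l (fun x => ent (d x) (pvel (1 - b ^+ 2) (phi x))) <= eta + e.
    by move: half mb; rewrite /halfmin /halfact; lra.
  have pos1 : 0 <= I (- l) l (fun x => ent (u x) (sg (phi x))).
    by apply: Rintegral_ge0 => x _; apply: ent_ge0; [exact: prof_u01 pr x|exact: sg01].
  have pv x : 0 < pvel (1 - b ^+ 2) (phi x) < 1 by exact: pvel01 alpha01 _ _ th (prof_bound pr x).
  have pos2 : 0 <= I (- l) l (fun x => ent (d x) (pvel (1 - b ^+ 2) (phi x))).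
    by apply: Rintegral_ge0 => x _; apply: ent_ge0; [exact: prof_d01 pr x|exact: pv].
  have leA : I (- l) l (fun x => ent (u x) (sg (phi x))) <= eta + e.
    by apply: le_trans tot; rewrite lerDl.
  have leB : I (- l) l (fun x => ent (d x) (pvel (1 - b ^+ 2) (phi x))) <= eta + e.
    by apply: le_trans tot; rewrite lerDr.
  split.
    apply: (@le_trans _ _ (2 * I (- l) l (fun x => ent (u x) (sg (phi x))))); last by rewrite ler_pM2l.
    rewrite -itgZ//; apply: itg_le => //; first by apply: bmeasZ.
    by move=> x _; rewrite mulrC -ler_pdivrMr//; exact: ent_ge (prof_u01 pr x) (sg01 _).
  pose r x := lam / 2 + lam^-1 * ent (d x) (pvel (1 - b ^+ 2) (phi x)) + (b ^+ 2 - alpha ^+ 2) * k.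
  have br : bmeas r by apply: bmeasD; [apply: bmeasD; [exact: bmeas_cst|exact: bmeasZ]|exact: bmeas_cst].
  apply: (@le_trans _ _ (I (- l) l r)).
    apply: itg_le => // x _.
    have h1 := ent_ge (prof_d01 pr x) (pv x).
    have -> : d x - q (phi x) = (d x - pvel (1 - b ^+ 2) (phi x)) + (b ^+ 2 - alpha ^+ 2) * kap (phi x).
      by rewrite /pvel; ring.
    apply: (le_trans (ler_normD _ _)); apply: lerD; first exact: norm_amgm.
    rewrite ger0_norm; first by apply: ler_wpM2l.
    by apply: mulr_ge0 => //; apply: le_trans (kap_ge1 _).
  rewrite itgD//; [|by apply: bmeasD; [exact: bmeas_cst|exact: bmeasZ]|exact: bmeas_cst].
  rewrite itgD//; [|exact: bmeas_cst|exact: bmeasZ].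
  rewrite !itg_cst// itgZ//.
  have s1 : lam^-1 * I (- l) l (fun x => ent (d x) (pvel (1 - b ^+ 2) (phi x))) <= (eta + e) / lam.
    by rewrite mulrC ler_pM2r ?invr_gt0.
  have s2 : (b ^+ 2 - alpha ^+ 2) * k * (l - - l) <= e.
    rewrite opprK; apply: (energy_length_le _ _ L0 al2 _ d2).
    - by rewrite mulr_ge0// ltW.
    - by rewrite /L lerDl.
    - rewrite /k divfK ?gt_eqF// /b.
      have -> : (alpha + del) ^+ 2 - alpha ^+ 2 = del * (2 * alpha + del) by ring.
      by rewrite mulrC ler_pM2r//; have := sqr_ge0 alpha; lra.
  have -> : lam / 2 * (l - - l) = lam * l by field.
  by apply: lerD => //; apply: lerD.
split.
  apply/ler_addgt0Pr => e e0; have [h _] := key (e / 2) (divr_gt0 e0 (ltr0n R 2)).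
  apply: (le_trans h); rewrite mulrDr lerD2l.
  by rewrite mulrCA mulfV ?mulr1// pnatr_eq0.
apply/ler_addgt0Pr => e e0.
have li : 0 < lam^-1 by rewrite invr_gt0.
have e2 : 0 < e / (1 + lam^-1) by rewrite divr_gt0// addr_gt0.
have [_ h] := key _ e2.
apply: (le_trans h); rewrite -!addrA lerD2l mulrDl -addrA lerD2l.
have -> : e / (1 + lam^-1) / lam + e / (1 + lam^-1) = e / (1 + lam^-1) * (1 + lam^-1) by ring.
by rewrite divfK// gt_eqF// addr_gt0.
Qed.

(* [pvel] decreases in [|phi|], so the drift drives [(phi - W)^2] to [0] away from the zero. *)
Lemma dist_wave kappa : (forall x, x <= - l -> phi x = - c) -> (forall x, l <= x -> phi x = c) ->
  I (- l) l (fun x => `|d x - q (phi x)|) <= kappa ->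
  forall x, (phi x - W (x - z)) ^+ 2 <= 4 * c * kappa.
Proof.
move=> lo hi Ile; pull; have /andP[z1 z2] := zl.
pose Wz x := W (x - z); pose D x := phi x - Wz x.
have dW x : is_derive x (1 : R) Wz (q (Wz x)).
  have := @isd_comp _ W (fun x => x - z) x _ _ (is_derive_wave (x - z) alpha01) (isdB (isd_id x) (isd_cst z x)).
  by move=> /isd_cast; apply; rewrite subr0 mulr1.
have wlip x y : x <= y -> 0 <= Wz y - Wz x <= y - x.
  by move=> xy; have := @wave_mono_lip _ alpha (x - z) (y - z) alpha01 ltac:(lra); rewrite /Wz; lra.
have W0 : Wz z = 0 by rewrite /Wz subrr wave0.
have phib x := prof_bound pr x.
have Dlip x y : `|D x - D y| <= 2 * `|x - y|.
  have h1 := prof_lip pr x y; rewrite mul1r in h1.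
  have h2 : `|Wz x - Wz y| <= `|x - y|.
    have [xy|/ltW xy] := leP x y; first rewrite [leLHS]distrC [leRHS]distrC.
      by have /andP[w1 w2] := wlip _ _ xy; rewrite !ger0_norm ?subr_ge0// -subr_ge0.
    by have /andP[w1 w2] := wlip _ _ xy; rewrite !ger0_norm ?subr_ge0// -subr_ge0.
  have -> : D x - D y = (phi x - phi y) - (Wz x - Wz y) by rewrite /D; ring.
  by apply: (le_trans (ler_normB _ _)); lra.
have Db x : `|D x| <= 2 * c.
  by apply: (le_trans (ler_normB _ _)); have := phib x; have := wave_bound (x - z); rewrite /Wz; lra.
have cD : continuous D by exact: lipschitz_continuous Dlip.
have cW : continuous Wz by move=> x; exact: isd_continuous (dW x).
have cq : continuous q.
  by move=> x; exact: isd_continuous (isdB (isd_cst 1 _) (isdZ _ (is_derive_kap x))).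
have bd : bmeas d by exact: bmeas_d pr.
have bq : bmeas (fun x => q (phi x)) by exact: bmeas_cphi pr _ cq.
have bD : bmeas D.
  by split; [exact: continuous_measurable_fun|exists (2 * c)].
have bqW : bmeas (fun x => q (Wz x)).
  split; first by apply: continuous_measurable_fun => x; apply: continuous_comp; [exact: cW|exact: cq].
  by exists 1 => x; have := pvel_wave (x - z) alpha01; rewrite ler_norml -/(Wz x); lra.
pose r x := `|d x - q (phi x)|.
have br : bmeas r by apply: bmeas_norm; exact: bmeasB.
have r0 x : 0 <= r x by exact: normr_ge0.
(* The derivative of [D ^+ 2]. Its growth away from [z] is bounded by the defect [r] times [4 * c],
   because [|D| <= 2 * c]. *)
pose F x := 2 * D x * (d x - q (Wz x)).
have bF : bmeas F by apply: bmeasM; [exact: bmeasZ|exact: bmeasB].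
have ftc a b : a <= b -> I a b F = D b ^+ 2 - D a ^+ 2.
  move=> ab; apply: EFin_inj; rewrite -itg_EFin//.
  apply: (@lipschitz_FTC _ (fun x => D x ^+ 2) F (8 * c)) => //.
  - by move=> x; apply: (@continuous_comp _ _ _ D (fun y : R => y ^+ 2)); [exact: cD|exact: exprn_continuous].
  - move=> x y _ _; rewrite subr_sqr normrM mulrC.
    have := Db x; have := Db y; have := Dlip x y; have := ler_normD (D x) (D y).
    have := normr_ge0 (D x + D y); have := normr_ge0 (D x - D y); have := normr_ge0 (x - y).
    by move: `|D x + D y| `|D x - D y| `|x - y| => A B C; nra.
  - exact: bF.1.
  - apply: ae_imp (prof_der pr) => x dphi _.
    have dD := isdB dphi (dW x).
    by apply: isd_cast (isdM dD dD) _; rewrite /F /D; ring.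
have Fle x : z <= x -> F x <= 4 * c * r x.
  move=> zx.
  have p0 : 0 <= phi x by rewrite -phiz; exact: prof_mono pr _ _ zx.
  have w0 : 0 <= Wz x by have := wlip _ _ zx; rewrite W0; lra.
  have := kap_sub_ge0 p0 w0 => s0.
  have -> : F x = 2 * (D x * (d x - q (phi x))) - 2 * ((1 - alpha ^+ 2) * ((phi x - Wz x) * (kap (phi x) - kap (Wz x)))).
    by rewrite /F /D /pvel; ring.
  have s1 := mulr_ge0 (ltW al2) s0.
  have : D x * (d x - q (phi x)) <= 2 * c * r x.
    by apply: (le_trans (ler_norm _)); rewrite normrM; apply: ler_wpM2r.
  lra.
have Fge x : x <= z -> - F x <= 4 * c * r x.
  move=> zx.
  have p0 : phi x <= 0 by rewrite -phiz; exact: prof_mono pr _ _ zx.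
  have w0 : Wz x <= 0 by have := wlip _ _ zx; rewrite W0; lra.
  have := kap_sub_le0 p0 w0 => s0.
  have -> : - F x = 2 * (- (D x * (d x - q (phi x)))) + 2 * ((1 - alpha ^+ 2) * ((phi x - Wz x) * (kap (phi x) - kap (Wz x)))).
    by rewrite /F /D /pvel; ring.
  have s1 := mulr_ge0_le0 (ltW al2) s0.
  have : - (D x * (d x - q (phi x))) <= 2 * c * r x.
    by apply: (le_trans (ler_norm _)); rewrite normrN normrM; apply: ler_wpM2r.
  lra.
have Dz : D z = 0 by rewrite /D phiz W0 subrr.
have pos a b : 0 <= I a b r by apply: Rintegral_ge0.
have c4 : 0 <= 4 * c by lra.
have right x : z <= x <= l -> D x ^+ 2 <= 4 * c * kappa.
  move=> /andP[zx xl]; have := ftc _ _ zx; rewrite Dz expr0n subr0 => <-.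
  apply: (@le_trans _ _ (I z x (fun x => 4 * c * r x))).
    by apply: itg_le => //; [exact: bmeasZ|move=> y /andP[zy _]; exact: Fle].
  rewrite itgZ//; apply: ler_wpM2l => //; apply: le_trans Ile.
  rewrite (itg_cat br z1 z2) (itg_cat br zx xl) -/r.
  by rewrite addrCA lerDl addr_ge0.
have left x : - l <= x <= z -> D x ^+ 2 <= 4 * c * kappa.
  move=> /andP[lx xz]; have := ftc _ _ xz; rewrite Dz expr0n sub0r => e.
  have {e} -> : D x ^+ 2 = I x z (fun y => -1 * F y) by rewrite itgZ// e; ring.
  apply: (@le_trans _ _ (I x z (fun x => 4 * c * r x))).
    apply: itg_le; [exact: bmeasZ|exact: bmeasZ|].
    by move=> y /andP[_ yz]; rewrite mulN1r; exact: Fge.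
  rewrite itgZ//; apply: ler_wpM2l => //; apply: le_trans Ile.
  rewrite (itg_cat br z1 z2) (itg_cat br lx xz) -/r.
  by rewrite addrAC lerDr addr_ge0.
move=> x; rewrite -/(Wz x) -/(D x).
(* Beyond the interval [phi] rests at its end value while the wave still moves towards it, so the
   distance only decreases. *)
have [xl|xl] := leP x (- l).
  apply: (@le_trans _ _ (D (- l) ^+ 2)); last by apply: left; rewrite lexx.
  have : D x <= 0 /\ D (- l) <= D x.
    have h1 := wlip _ _ xl; have := wave_bound (x - z); rewrite ler_norml -/(Wz x) => /andP[h2 _].
    by rewrite /D phiNl lo//; lra.
  by move=> [h1 h2]; nra.
have [lx|lx] := leP l x.
  apply: (@le_trans _ _ (D l ^+ 2)); last by apply: right; rewrite lexx andbT.
  have : 0 <= D x /\ D x <= D l.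
    have h1 := wlip _ _ lx; have := wave_bound (x - z); rewrite ler_norml -/(Wz x) => /andP[_ h2].
    by rewrite /D phil hi//; lra.
  by move=> [h1 h2]; nra.
have [zx|xz] := leP z x; first by apply: right; rewrite zx ltW.
by apply: left; rewrite !ltW.
Qed.

End Profile.

End Stability.

(** * Compactness of low-energy sequences *)

Section Subsequences.

Lemma increasing_seq_of (k : nat -> nat) : (forall n, k n < k n.+1)%N -> increasing_seq k.
Proof. by move=> h; apply/increasing_seqP. Qed.

Lemma increasing_ge (k : nat -> nat) : increasing_seq k -> forall n, (n <= k n)%N.
Proof.
move=> h; elim => // n IH; apply: (leq_ltn_trans IH).
have /increasing_seqP := h; exact.
Qed.

Lemma increasing_cvg (k : nat -> nat) : increasing_seq k -> k n @[n --> \oo] --> \oo.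
Proof.
move=> h A [N _ NA]; exists N => // n /= Nn; apply: NA => /=.
exact: leq_trans Nn (increasing_ge h n).
Qed.

Lemma extract_subseq (P : nat -> nat -> Prop) :
  (forall m N, exists n, (N <= n)%N /\ P m n) ->
  exists k : nat -> nat, increasing_seq k /\ forall m, P m (k m).
Proof.
move=> h; pose nx m N := sval (cid (h m N)).
have nxP m N : (N <= nx m N)%N /\ P m (nx m N) := svalP (cid (h m N)).
pose k := fix k m := if m is m'.+1 then nx m (k m').+1 else nx 0%N 0%N.
exists k; split; last by case=> [|m]; exact: (nxP _ _).2.
by apply: increasing_seq_of => n; exact: (nxP n.+1 _).1.
Qed.

Lemma bounded_subseq_cvg {R : realType} (z_ : nat -> R) (Z : R) (N : nat) :
  (forall n, (N <= n)%N -> `|z_ n| <= Z) ->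
  exists (k : nat -> nat) (z : R), increasing_seq k /\ z_ (k n) @[n --> \oo] --> z.
Proof.
move=> zZ.
have [] := @segment_compact R (- Z) Z (z_ @ \oo).
  by exists N => // n /= Nn; rewrite in_itv/= -ler_norml; exact: zZ.
move=> /= z0 [_]; set z : R := z0 => cz.
have [k [ki kP]] : exists k : nat -> nat, increasing_seq k /\ forall m, `|z - z_ (k m)| < m.+1%:R^-1.
  apply: (@extract_subseq (fun m n => `|z - z_ n| < m.+1%:R^-1)) => m M.
  have m0 : 0 < m.+1%:R^-1 :> R by rewrite invr_gt0.
  have [y [[n Mn <-] hy]] := cz (z_ @` [set n | (M <= n)%N]) (ball z m.+1%:R^-1)
    (ex_intro2 _ _ M I (fun n Mn => ex_intro2 _ _ n Mn erefl))
    (nbhsx_ballx z _ m0).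
  by exists n.
exists k, z; split => //; apply/cvgrPdist_lt => e e0.
near=> n; apply: (lt_trans (kP n)).
near: n; exact: near_infty_natSinv_lt (PosNum e0).
Unshelve. all: by end_near. Qed.

End Subsequences.

Section LimSup.
Context {R : realType}.
Implicit Types (u : nat -> \bar R) (a : R).
Local Open Scope ereal_scope.

Lemma limn_esup_le_near u (a : \bar R) : (\forall n \near \oo, u n <= a) -> limn_esup u <= a.
Proof.
move=> [N _ uN]; rewrite /limn_esup /limf_esup.
apply: (le_trans (ereal_inf_lbound _)); first by exists [set n | (N <= n)%N] => //; exists N.
by apply: ge_ereal_sup => _ [n Nn <-]; exact: uN.
Qed.

Lemma limn_esup_lt_near u (a : \bar R) : limn_esup u < a -> \forall n \near \oo, u n <= a.
Proof.
rewrite /limn_esup /limf_esup => /ereal_inf_lt[_ [V hV <-] lt].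
apply: filterS hV => n Vn; apply: ltW; apply: le_lt_trans lt.
by apply: ereal_sup_ubound; exists n.
Qed.

Lemma limn_einf_lt_often u (a : \bar R) : limn_einf u < a -> forall N : nat,
  exists n, (N <= n)%N /\ u n < a.
Proof.
move=> lt N; apply: contrapT => h; move: lt; apply/negP; rewrite -leNgt.
rewrite /limn_einf leeNr; apply: limn_esup_le_near; exists N => // n /= Nn.
by rewrite leeN2 leNgt; apply/negP => un; apply: h; exists n.
Qed.

End LimSup.

Section Estimates.
Context {R : realType} (alpha : R) (alpha01 : 0 < alpha < 1).
Local Notation mu := (@lebesgue_measure R).
Local Notation c := (phip alpha).
Local Notation "'I' a b f" := (\int[mu]_(x in `[a, b]) (f x))%R (at level 10, a, b, f at level 9).
Local Ltac pull := have /andP[a0 a1] := alpha01; have al2 := alpha_sqr_lt1 alpha01;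
  have c0 := phip_gt0 alpha01.
Local Notation q := (pvel (1 - alpha ^+ 2)).
Local Notation W := (wave alpha).
Local Notation X := (X alpha).
Local Notation excess := (excess alpha).
Local Notation rate := (rate alpha).
Implicit Types (x : X) (z l e Lam : R).

(** Keeps the contributions of the two half-lines apart; the limit functional is
    [rate * two_cosh z]. *)
Definition two_cosh (z : R) : R := expR (alpha * z) + expR (- (alpha * z)).

Lemma rate_gt0 : 0 < rate.
Proof. by pull; rewrite /rate divr_gt0 ?mulr_gt0. Qed.

(** The zero is first kept at distance [T0] from both ends: a shorter piece has an excess bounded
    below independently of [l], which the factor [expR (alpha * l)] lifts above [Lam]. Then
    [excess_lower] applies on both sides. *)
Lemma zero_estimate e Lam : 0 < e < rate -> exists L : R, forall l z, L <= l -> - l <= z <= l ->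
  (forall b1 b2, alpha < b1 < 1 -> alpha < b2 < 1 ->
    expR (alpha * l) * (excess b1 (l - z) + excess b2 (l + z)) <= Lam) ->
  (rate - e) * two_cosh z <= Lam.
Proof.
move=> /andP[e0 er]; pull.
have [T0 T00 hT] := excess_lower alpha01 e0.
have re : 0 < rate - e by rewrite subr_gt0.
exists (T0 + `|Lam| / (rate - e) / alpha).
move=> l z Ll /andP[z1 z2] cost.
have gen (T T' : R) : 0 <= T -> 0 <= T' -> (forall b1 b2, alpha < b1 < 1 -> alpha < b2 < 1 ->
    expR (alpha * l) * (excess b1 T + excess b2 T') <= Lam) -> T0 <= T.
  move=> Tge T'ge cst; rewrite leNgt; apply/negP => TT0.
  have [b1 hb1 h1] := hT T0 (lexx _).
  have lo1 : (rate - e) * expR (- (alpha * T0)) <= excess b1 T.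
    apply: (@le_trans _ _ (excess b1 T0)); last by apply: (excess_mono alpha01 hb1); exact: ltW.
    by rewrite expRN ler_pdivrMr ?expR_gt0// mulrC.
  (* The length of the other piece is not yet known, so its excess is only bounded below by an
     arbitrarily small negative number. *)
  have all_e (f : R) : 0 < f -> expR (alpha * l) * ((rate - e) * expR (- (alpha * T0)) - f) <= Lam.
    move=> f0; have [b2 hb2 h2] := excess_almost_ge0 alpha01 T'ge f0.
    apply: le_trans (cst _ _ hb1 hb2); rewrite ler_pM2l ?expR_gt0//.
    exact: lerD.
  have lim : expR (alpha * l) * ((rate - e) * expR (- (alpha * T0))) <= Lam.
    apply/ler_addgt0Pr => f f0.
    have := all_e (f / expR (alpha * l)) (divr_gt0 f0 (expR_gt0 _)).
    by rewrite mulrBr lerBlDr [_ * (f / _)]mulrC divfK// gt_eqF// expR_gt0.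
  move: lim; rewrite mulrCA -expRD -mulrBr => lim.
  have h3 : 1 + alpha * (l - T0) <= expR (alpha * (l - T0)) by exact: expR_ge1Dx.
  have h4 : `|Lam| / (rate - e) <= alpha * (l - T0).
    by rewrite [leRHS]mulrC -ler_pdivrMr// lerBrDl.
  have h5 : (rate - e) * (1 + alpha * (l - T0)) <= Lam.
    by apply: le_trans lim; rewrite ler_pM2l.
  rewrite ler_pdivrMr// in h4.
  have := ler_norm Lam; lra.
have T1 : T0 <= l - z by apply: (gen _ (l + z)) => //; lra.
have T2 : T0 <= l + z.
  apply: (gen _ (l - z)) => [||b1 b2 hb1 hb2]; [lra|lra|].
  by rewrite addrC; exact: cost.
have [b1 hb1 h1] := hT _ T1; have [b2 hb2 h2] := hT _ T2.
apply: le_trans (cost _ _ hb1 hb2); rewrite /two_cosh mulrDr [leRHS]mulrDr.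
have E1 : expR (alpha * l) = expR (alpha * z) * expR (alpha * (l - z)).
  by rewrite -expRD; congr expR; ring.
have E2 : expR (alpha * l) = expR (- (alpha * z)) * expR (alpha * (l + z)).
  by rewrite -expRD; congr expR; ring.
apply: lerD; rewrite mulrC.
  by rewrite E1 -mulrA ler_pM2l ?expR_gt0.
by rewrite E2 -mulrA ler_pM2l ?expR_gt0.
Qed.

(** A crude bound, sufficient to keep the zeros of a bounded-cost sequence in a segment. *)
Lemma two_cosh_ge z : alpha * `|z| <= two_cosh z.
Proof.
have e1 := expR_gt0 (alpha * z); have e2 := expR_gt0 (- (alpha * z)).
have h1 : 1 + alpha * z <= expR (alpha * z) by exact: expR_ge1Dx.
have h2 : 1 + - (alpha * z) <= expR (- (alpha * z)) by exact: expR_ge1Dx.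
rewrite /two_cosh; have [z0|z0] := leP 0 z; [rewrite ger0_norm//|rewrite ltr0_norm//]; lra.
Qed.

Lemma low_cost_profile l x Lam : 0 < l -> (Ghat_ell l x <= Lam%:E)%E ->
  domB l x /\ exists u d, [/\ profile alpha u (Xphi x) d, \forall y \ae mu, Xu x y = u y &
    expR (alpha * l) * (I (- l) l (lag alpha u (Xphi x) d) - 2 * mhalf alpha) <= Lam].
Proof.
move=> l0; rewrite /Ghat_ell minGE//.
have [dB|ndB] := pselect (domB l x); last first.
  rewrite /G_ell asboolF// addye// gt0_muley ?lte_fin ?expR_gt0//.
move=> h; split => //; have [u [d [pr [N [mN N0] NP]]]] := X_profile alpha01 x.
exists u, d; split => //.
  by exists N; split => // y /= ny; apply: contrapT => /NP[uy _]; exact: ny.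
move: h; rewrite (G_ell_profile (ex_intro2 _ _ N (conj mN N0) NP) dB).
have bl := bmeas_lag alpha01 pr; rewrite itg_EFin//.
Qed.

Lemma low_cost_zero l x : 0 < l -> domB l x -> exists2 z, - l <= z <= l & Xphi x z = 0.
Proof.
move=> l0 [_ lo _ hi]; pull.
have hC : in_C alpha (Xphi x) by exact: (set_valP x.2).
have cphi := lipschitz_continuous (in_C_lip hC).
have lo1 := lo _ (lexx (- l)); have hi1 := hi _ (lexx l).
have [||z hz z0] := @IVT R (Xphi x) (- l) l 0 ltac:(lra).
- exact: continuous_subspaceT.
- by rewrite lo1 hi1 phimE// min_l ?max_r; lra.
by exists z.
Qed.

Lemma cost_decay Lam e : 0 <= Lam -> 0 < e -> exists L : R, forall l, L <= l ->
  (l + Lam) * expR (- (alpha * l / 2)) <= e /\ Lam * expR (- (alpha * l)) <= e.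
Proof.
move=> L0 e0; pull.
pose K := 2 + Lam.
have K0 : 0 < K by rewrite /K; lra.
have p0 : 0 < 4 * K / (alpha ^+ 2 * e) by apply: divr_gt0; apply: mulr_gt0 => //; exact: exprn_gt0.
exists (1 + 2 * (4 * K / (alpha ^+ 2 * e))) => l hl.
have l0 : 0 < l by lra.
have := @exp_decay _ _ alpha01 K e (l / 2) K0 e0 ltac:(lra) ltac:(lra).
rewrite mulrA -[alpha * (l / 2)]/(alpha * (l * 2^-1)) [alpha * (l * _)]mulrA => h.
have E0 := expR_gt0 (- (alpha * l / 2)).
have h1 : (l + Lam) * expR (- (alpha * l / 2)) <= e.
  apply: le_trans h; rewrite ler_pM2r// /K.
  by have := mulr_ge0 L0 (ltW l0); lra.
split => //; apply: le_trans h1; apply: ler_pM => //; [lra|].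
by rewrite ler_expR lerN2 ler_pdivrMr// ler_peMr ?mulr_ge0 ?ltW//; lra.
Qed.


Lemma sg_lip (a b : R) : `|sg a - sg b| <= `|a - b|.
Proof.
have gen (x y : R) : x <= y -> 0 <= sg y - sg x <= y - x.
  move=> xy.
  have s01 t := @sg01 R t.
  have ds t : x <= t <= y -> is_derive t (1 : R) sg (sg t * (1 - sg t)).
    by move=> _; exact: is_derive_sg.
  have h1 := isd_ge0_le xy ds (fun t _ => ltac:(have := s01 t; nra)).
  have h2 := isd_ge0_le xy (fun t h => isdB (isd_id t) (ds t h)) (fun t _ => ltac:(have := s01 t; nra)).
  by move: h1 h2 => /= h1 h2; apply/andP; split; lra.
have [ab|/ltW ba] := leP a b.
  by rewrite distrC [leRHS]distrC; have /andP[h1 h2] := gen _ _ ab; rewrite !ger0_norm ?subr_ge0// -subr_ge0.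
by have /andP[h1 h2] := gen _ _ ba; rewrite !ger0_norm ?subr_ge0// -subr_ge0.
Qed.

Lemma wave_lip (a b : R) : `|W a - W b| <= `|a - b|.
Proof.
have [ab|/ltW ba] := leP a b.
  rewrite distrC [leRHS]distrC; have /andP[h1 h2] := wave_mono_lip alpha01 ab.
  by rewrite !ger0_norm ?subr_ge0// -subr_ge0.
by have /andP[h1 h2] := wave_mono_lip alpha01 ba; rewrite !ger0_norm ?subr_ge0// -subr_ge0.
Qed.

Lemma low_cost_close l x Lam z e : 0 < l -> (Ghat_ell l x <= Lam%:E)%E -> 0 <= Lam ->
  - l <= z <= l -> Xphi x z = 0 ->
  4 * c * ((l + Lam) * expR (- (alpha * l / 2))) <= e ^+ 2 -> 2 * (Lam * expR (- (alpha * l))) <= e ->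
  0 <= e ->
  (forall y, `|Xphi x y - W (y - z)| <= e) /\
  exists w : R -> R, [/\ measurable_fun setT w, (forall y, 0 <= w y <= 1),
    mu.-integrable setT (fun y => (w y ^+ 2)%:E), \int[mu]_y (w y ^+ 2) <= e &
    \forall y \ae mu, `|Xu x y - sg (Xphi x y)| <= w y].
Proof.
move=> l0 hG L0 zl z0 small1 small2 e0.
have [dB [u [d [pr uE cost]]]] := low_cost_profile l0 hG.
have [um_ lo up_ hi] := dB.
have E0 := expR_gt0 (- (alpha * l / 2)).
have EE : expR (- (alpha * l)) = expR (- (alpha * l / 2)) ^+ 2.
  by rewrite -expRM_natl; congr expR; field.
have cost' : I (- l) l (lag alpha u (Xphi x) d) - 2 * mhalf alpha <= Lam * expR (- (alpha * l)).
  by rewrite expRN ler_pdivlMr ?expR_gt0// mulrC.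
have phil : Xphi x l = c by exact: hi.
have phiNl : Xphi x (- l) = - c by rewrite lo// phimE.
(* The weight [lam = expR (- (alpha * l / 2))] is of the order of the square root of the excess, so
   that [lam * l] and [eta / lam] both tend to 0 as [l] grows. *)
have [hu hd] := itg_phase_le alpha01 pr phil phiNl zl cost' E0.
have lo' y : y <= - l -> Xphi x y = - c by move=> yl; rewrite lo// phimE.
split.
  move=> y; have := dist_wave alpha01 pr phil phiNl z0 zl lo' hi hd y.
  have -> : expR (- (alpha * l / 2)) * l + Lam * expR (- (alpha * l)) / expR (- (alpha * l / 2)) =
    (l + Lam) * expR (- (alpha * l / 2)).
    by rewrite EE; field; rewrite gt_eqF.
  move=> h; have := le_trans h small1.
  by rewrite -[X in X <= _]real_normK ?num_real// ler_pXn2r ?nnegrE.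
pose D : set R := `[(- l)%R, l]%classic.
have mD : measurable D by exact: measurable_itv.
pose v y := `|u y - sg (Xphi x y)|.
have cphi := lipschitz_continuous (prof_lip pr).
have bsg : bmeas (fun y => sg (Xphi x y)).
  by apply: (bmeas_cphi pr) => y; exact: isd_continuous (is_derive_sg y).
have bv : bmeas v by apply: bmeas_norm; apply: bmeasB => //; exact: bmeas_u pr.
have bv2 : bmeas (fun y => v y ^+ 2) by apply: bmeasM.
have v01 y : 0 <= v y <= 1.
  by rewrite normr_ge0/= ler_norml; have := prof_u01 pr y; have := sg01 (Xphi x y); lra.
have sqE : (fun y => (v \_ D) y ^+ 2) = (fun y => v y ^+ 2) \_ D.
  by apply/funext => y; rewrite /patch; case: ifP => // _; rewrite expr0n.
(* Outside [[- l, l]] both [u] and [sg phi] take the end values, so nothing is lost by cutting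
   off. *)
exists (v \_ D); split.
- have : mu.-integrable setT (EFin \o (v \_ D)).
    rewrite -restrict_EFin; apply: (@integrable_mkcond _ _ R mu D (EFin \o v) mD).1.
    exact: bmeas_integrable.
  by move=> /measurable_int/measurable_EFinP.
- by move=> y; rewrite /patch; case: ifP => // _; rewrite lexx ler01.
- have -> : (fun y => ((v \_ D) y ^+ 2)%:E) = EFin \o ((fun y => v y ^+ 2) \_ D).
    by rewrite -sqE.
  rewrite -restrict_EFin; apply: (@integrable_mkcond _ _ R mu D (EFin \o (fun y => v y ^+ 2)) mD).1.
  exact: bmeas_integrable.
- rewrite sqE -Rintegral_mkcond; apply: le_trans small2; apply: le_trans hu.
  by under eq_Rintegral do rewrite /v real_normK ?num_real//.
- apply: (ae_imp2 _ uE (ae_imp2 (fun y a b => conj a b) um_ up_)) => y uy [umy upy].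
  rewrite /patch; case: ifPn => [_|]; first by rewrite uy.
  rewrite notin_setE /D /= in_itv/= => /negP; rewrite negb_and -!ltNge => /orP[yl|ly].
    change (`|Xu x y - sg (Xphi x y)| <= 0).
    by rewrite (umy (ltW yl)) (lo' _ (ltW yl)) sg_phim// subrr normr0.
  change (`|Xu x y - sg (Xphi x y)| <= 0).
  by rewrite (upy (ltW ly)) (hi _ (ltW ly)) sg_phip// subrr normr0.
Qed.

Lemma wave_XE z x : is_wave z x -> Xphi x = (fun y => W (y - z)) /\
  \forall y \ae mu, Xu x y = sg (Xphi x y).
Proof.
move=> [hu hphi]; have e : Xphi x = (fun y => W (y - z)).
  by rewrite hphi; apply/funext => y; rewrite /translate phibar_wave.
split => //; apply: ae_imp hu => y hy; rewrite hy // e /translate.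
by rewrite -sg_phibar// phibar_wave.
Qed.

Lemma cvg_wave (J : Type) (F : set_system J) (FF : Filter F) (x_ : J -> X) (z_ : J -> R) z x :
  is_wave z x -> z_ j @[j --> F] --> z ->
  (forall e, 0 < e -> \forall j \near F, (forall y, `|Xphi (x_ j) y - W (y - z_ j)| <= e) /\
    exists w : R -> R, [/\ measurable_fun setT w, (forall y, 0 <= w y <= 1),
    mu.-integrable setT (fun y => (w y ^+ 2)%:E), \int[mu]_y (w y ^+ 2) <= e &
    \forall y \ae mu, `|Xu (x_ j) y - sg (Xphi (x_ j) y)| <= w y]) ->
  x_ j @[j --> F] --> x.
Proof.
move=> hx zz h; have [ephi eu] := wave_XE hx.
apply: cvg_X => e e0.
have e2 : 0 < e / 2 by exact: divr_gt0.
have zc : \forall j \near F, `|z - z_ j| <= e / 2 by move/cvgrPdist_le : zz; exact.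
apply: filterS2 (h _ e2) zc => j [h1 [w [mw w01 iw we hw]]] zj.
have close y : `|Xphi (x_ j) y - Xphi x y| <= e.
  rewrite ephi; have -> : Xphi (x_ j) y - W (y - z) = (Xphi (x_ j) y - W (y - z_ j)) + (W (y - z_ j) - W (y - z)) by ring.
  apply: (le_trans (ler_normD _ _)); rewrite [leRHS]splitr; apply: lerD => //.
  apply: (le_trans (wave_lip _ _)).
  by have -> : y - z_ j - (y - z) = z - z_ j by ring.
split => //; exists w; split => //.
  by apply: le_trans we _; rewrite ler_pdivrMr// ler_peMr ?ltW// ltr1n.
apply: (ae_imp2 _ hw eu) => y hwy euy.
have -> : Xu (x_ j) y - Xu x y = (sg (Xphi (x_ j) y) - sg (Xphi x y)) + (Xu (x_ j) y - sg (Xphi (x_ j) y)).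
  by rewrite euy; ring.
apply: (le_trans (ler_normD _ _)); apply: lerD => //.
exact: le_trans (sg_lip _ _) (close y).
Qed.

Lemma low_cost_cvg (l : nat -> R) (x_ : nat -> X) (z_ : nat -> R) Lam z x :
  l n @[n --> \oo] --> +oo -> is_wave z x -> z_ n @[n --> \oo] --> z -> 0 <= Lam ->
  (\forall n \near \oo, [/\ 0 < l n, (Ghat_ell (l n) (x_ n) <= Lam%:E)%E,
     - l n <= z_ n <= l n & Xphi (x_ n) (z_ n) = 0]) ->
  x_ n @[n --> \oo] --> x.
Proof.
move=> loo hx zz L0 hn; pull.
apply: (cvg_wave _ hx zz) => e e0.
pose e' := Num.min (e ^+ 2 / (4 * c)) (e / 2).
have e'0 : 0 < e' by rewrite lt_min !divr_gt0 ?mulr_gt0 ?exprn_gt0.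
have [L LP] := cost_decay L0 e'0.
have ll : \forall n \near \oo, L <= l n by move/cvgryPge : loo; exact.
apply: filterS2 hn ll => n [l0 hG zl z0] Ll.
have [d1 d2] := LP _ Ll.
apply: (low_cost_close l0 hG L0 zl z0); last exact: ltW.
  by rewrite mulrC -ler_pdivlMr ?mulr_gt0//; apply: (le_trans d1); rewrite ge_min lexx.
by rewrite mulrC -ler_pdivlMr//; apply: (le_trans d2); rewrite ge_min lexx orbT.
Qed.


Lemma tanh_pinfty : (tanh x : R) @[x --> +oo] --> (1 : R).
Proof.
apply/cvgrPdist_le => e e0; exists (1 / e); split; first exact: num_real.
move=> x ex.
have x0 : 0 < x by apply: lt_trans ex; rewrite divr_gt0.
rewrite tanh_exp.
have g : 1 + (x + x) <= expR (x + x) by exact: expR_ge1Dx.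
have E0 := expR_gt0 (x + x).
have -> : 1 - (expR (x + x) - 1) / (expR (x + x) + 1) = 2 / (expR (x + x) + 1).
  by field; rewrite gt_eqF// addr_gt0.
rewrite gtr0_norm; last by rewrite divr_gt0// addr_gt0.
rewrite ler_pdivrMr ?addr_gt0//.
rewrite ltr_pdivrMr// in ex; nra.
Qed.

Lemma wave_pinfty : W x @[x --> +oo] --> c.
Proof.
pull; rewrite /wave /phip /ds.
have cy : 1 / 2 + wave_y alpha x / 2 @[x --> +oo] --> up alpha.
  rewrite (_ : up alpha = 1 / 2 + alpha * 1 / 2); last by rewrite /up; field.
  apply: cvgD; first exact: cvg_cst.
  apply: cvgMl; rewrite /wave_y; apply: cvgMr.
  have lin : alpha * x / 2 @[x --> +oo] --> +oo; last first.
    exact: (cvg_comp _ tanh lin tanh_pinfty).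
  apply/cvgryPge => A; exists (2 * A / alpha); split; first exact: num_real.
  by move=> x /ltW; rewrite ler_pdivrMr// ler_pdivlMr// mulrC [A * 2]mulrC [x * _]mulrC.
have cr : (1 / 2 + wave_y alpha x / 2) / (1 - (1 / 2 + wave_y alpha x / 2)) @[x --> +oo] -->
    up alpha / (1 - up alpha).
  have c1 : 1 - (1 / 2 + wave_y alpha x / 2) @[x --> +oo] --> 1 - up alpha.
    by apply: cvgB cy; exact: cvg_cst.
  apply: cvgM cy _; apply: cvgV c1.
  by rewrite gt_eqF// /up; lra.
have p : 0 < up alpha / (1 - up alpha) by rewrite divr_gt0// /up; lra.
exact: (cvg_comp _ (@ln R) cr (continuous_ln p)).
Qed.

Lemma wave_exists z : exists x, is_wave z x.
Proof.
pull.
pose phi y := W (y - z).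
have lipW (x y : R) : `|phi x - phi y| <= 1 * `|x - y|.
  by rewrite mul1r; apply: (le_trans (wave_lip _ _)); rewrite (_ : x - z - (y - z) = x - y)//; ring.
have cphi := lipschitz_continuous lipW.
have csg : continuous (sg : R -> R) by move=> t; exact: isd_continuous (is_derive_sg t).
have cq : continuous q.
  by move=> x; exact: isd_continuous (isdB (isd_cst 1 _) (isdZ _ (is_derive_kap x))).
have pr : profile alpha (fun y => sg (phi y)) phi (fun y => q (phi y)).
  split => //.
  - by apply: continuous_measurable_fun => y; apply: continuous_comp; [exact: cphi|exact: csg].
  - by move=> y; have := sg01 (phi y); lra.
  - by apply: continuous_measurable_fun => y; apply: continuous_comp; [exact: cphi|exact: cq].
  - by move=> y; have := pvel_wave (y - z) alpha01; rewrite -/(phi y); lra.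
  - move=> y y' yy; have /andP[h _] := @wave_mono_lip _ alpha (y - z) (y' - z) alpha01 ltac:(lra).
    by rewrite -subr_ge0.
  - by move=> y; exact: wave_bound.
  - apply: ae_all => y.
    have := @isd_comp _ W (fun t : R => t - z) y _ _ (is_derive_wave (y - z) alpha01) (isdB (isd_id y) (isd_cst z y)).
    by move=> /isd_cast; apply; rewrite subr0 mulr1.
have lim : phi y @[y --> +oo] --> phip alpha.
  have lin : y - z @[y --> +oo] --> +oo; last exact: (cvg_comp _ W lin wave_pinfty).
  apply/cvgryPge => A; exists (A + z); split; first exact: num_real.
  by move=> y /ltW; rewrite lerBrDr.
have limm : phi y @[y --> -oo] --> phim alpha.
  rewrite phimE//; have -> : phi = (fun y => - W (- y + z)).
    by apply/funext => y; rewrite /phi -waveN//; congr W; ring.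
  apply: cvgN; have lin : - y + z @[y --> -oo] --> +oo; last exact: (cvg_comp _ W lin wave_pinfty).
  apply/cvgryPge => A; exists (z - A); split; first exact: num_real.
  by move=> y /= yA; lra.
have [x [xphi xu]] := X_exists pr (profile_in_C pr limm lim).
exists x; split; last by rewrite xphi; apply/funext => y; rewrite /translate phibar_wave.
by apply: ae_imp xu => y -> _; rewrite /translate -sg_phibar// phibar_wave.
Qed.

Lemma wave_inj z z' x : is_wave z x -> is_wave z' x -> z = z'.
Proof.
move=> /wave_XE[e1 _] /wave_XE[e2 _].
have : W (z - z) = W (z - z') by have := congr1 (fun f => f z) e1; rewrite e2.
rewrite subrr => e; have [lt|gt|//] := ltgtP z z'.
  by have := @wave_lt _ alpha (z - z') 0 alpha01; rewrite subr_lt0 e ltxx => /(_ lt).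
by have := @wave_lt _ alpha 0 (z - z') alpha01; rewrite subr_gt0 e ltxx => /(_ gt).
Qed.

Lemma Ghat_wave z x : is_wave z x -> Ghat x = (rate * two_cosh z)%:E.
Proof.
move=> hx; rewrite /Ghat; case: pselect => [h|h]; last by case: h; exists z.
rewrite (wave_inj (svalP (cid h)) hx) /rate /two_cosh /cosh; congr EFin; field.
by pull; rewrite gt_eqF.
Qed.

Lemma Ghat_not_wave x : ~ (exists z, is_wave z x) -> Ghat x = +oo%E.
Proof. by rewrite /Ghat; case: pselect. Qed.

Lemma two_cosh_continuous : continuous two_cosh.
Proof.
move=> z; apply: cvgD.
  by apply: continuous_comp; [exact: mulrl_continuous|exact: continuous_expR].
apply: (@continuous_comp _ _ _ (fun z => - (alpha * z)) expR); last exact: continuous_expR.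
by apply: cvgN; exact: mulrl_continuous.
Qed.

(** Serves both compactness and the lower bound: the limit of the zeros inherits the cost inequality
    by continuity of [two_cosh]. *)
Lemma low_cost_subseq (l : nat -> R) (x_ : nat -> X) Lam :
  (forall n, 0 < l n) -> l n @[n --> \oo] --> +oo ->
  (forall n, (Ghat_ell (l n) (x_ n) <= Lam%:E)%E) ->
  exists (k : nat -> nat) z, [/\ increasing_seq k, rate * two_cosh z <= Lam &
    forall x, is_wave z x -> x_ (k n) @[n --> \oo] --> x].
Proof.
move=> l0 loo hG; pull; have r0 := rate_gt0.
have data n : exists z, - l n <= z <= l n /\ Xphi (x_ n) z = 0.
  have [dB _] := low_cost_profile (l0 n) (hG n).
  by have [z zl z0] := low_cost_zero (l0 n) dB; exists z.
pose z_ n := sval (cid (data n)).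
have zP n : - l n <= z_ n <= l n /\ Xphi (x_ n) (z_ n) = 0 := svalP (cid (data n)).
have est e : 0 < e < rate -> \forall n \near \oo, (rate - e) * two_cosh (z_ n) <= Lam.
  move=> he; have [L LP] := @zero_estimate e Lam he.
  have ll : \forall n \near \oo, L <= l n by move/cvgryPge : loo; exact.
  apply: filterS ll => n Ll; apply: (LP _ _ Ll (zP n).1) => b1 b2 hb1 hb2.
  have [dB [u [d [pr _ cost]]]] := low_cost_profile (l0 n) (hG n).
  have [_ lo _ hi] := dB.
  apply: le_trans cost; rewrite ler_pM2l ?expR_gt0//.
  have phiNl : Xphi (x_ n) (- l n) = - c by rewrite lo// phimE.
  exact: (excess_le alpha01 pr (hi _ (lexx _)) phiNl (zP n).2 (zP n).1 hb1 hb2).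
have r2 : 0 < rate / 2 < rate by apply/andP; split; lra.
have [N _ NP] := est _ r2.
have zb n : (N <= n)%N -> `|z_ n| <= Lam / (rate / 2) / alpha.
  move=> Nn; have h := NP n Nn; have h2 := two_cosh_ge (z_ n).
  rewrite ler_pdivlMr// ler_pdivlMr; last by lra.
  apply: le_trans h; rewrite mulrC [X in X * _](_ : _ = rate - rate / 2); last by lra.
  by rewrite ler_pM2l; [rewrite mulrC|lra].
have [k [z [ki kz]]] := bounded_subseq_cvg zb.
have koo := increasing_cvg ki.
have limest e : 0 < e < rate -> (rate - e) * two_cosh z <= Lam.
  move=> he.
  have c1 : two_cosh (z_ (k n)) @[n --> \oo] --> two_cosh z.
    exact: (cvg_comp _ two_cosh kz (@two_cosh_continuous z)).
  have c2 : (rate - e) * two_cosh (z_ (k n)) @[n --> \oo] --> (rate - e) * two_cosh z by exact: cvgMr c1.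
  exact: (ler_cvg_to c2 (cvg_cst Lam) (koo _ (est e he))).
have tc : 0 < two_cosh z by rewrite addr_gt0 ?expR_gt0.
have lim : rate * two_cosh z <= Lam.
  apply/ler_addgt0Pr => e e0.
  (* Small enough to lose at most [e], and below [rate] as [limest] requires. *)
  pose f := Num.min (rate / 2) (e / two_cosh z).
  have f0 : 0 < f < rate.
    apply/andP; split; first by rewrite lt_min; apply/andP; split; [lra|exact: divr_gt0].
    by have /andP[_] := r2; apply: le_lt_trans; rewrite ge_min lexx.
  have := limest f f0; rewrite mulrBl lerBlDr => h; apply: (le_trans h); rewrite lerD2l.
  by rewrite -ler_pdivlMr// ge_min lexx orbT.
exists k, z; split => // x hx.
have L0 : 0 <= Lam by apply: le_trans lim; rewrite ltW// mulr_gt0.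
apply: (@low_cost_cvg (l \o k) _ (z_ \o k) Lam z) => //.
  exact: cvg_comp koo loo.
by near=> n; have [h1 h2] := zP (k n); split => //=.
Unshelve. all: by end_near. Qed.

End Estimates.

(** * The Gamma-limit *)

Section GammaLimit.
Context {R : realType} (alpha : R) (alpha01 : 0 < alpha < 1).
Local Ltac pull := have /andP[a0 a1] := alpha01; have al2 := alpha_sqr_lt1 alpha01;
  have c0 := phip_gt0 alpha01.
Local Notation X := (X alpha).
Local Notation excess := (excess alpha).
Local Notation rate := (rate alpha).
Local Notation two_cosh := (two_cosh alpha).
Implicit Types (x : X) (z e Lam : R).

Variables (l : nat -> R) (l0 : forall n, 0 < l n) (loo : l n @[n --> \oo] --> +oo).

Lemma limsup_bound (x_ : nat -> X) :
  (limn_esup (fun n => Ghat_ell (l n) (x_ n)) < +oo)%E ->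
  exists Lam N, forall n, (N <= n)%N -> (Ghat_ell (l n) (x_ n) <= Lam%:E)%E.
Proof.
move=> h; have [r hr] : exists r : R, (limn_esup (fun n => Ghat_ell (l n) (x_ n)) < r%:E)%E.
  move: h; case: (limn_esup _) => [r _|//|_]; last by exists 0; exact: ltNyr.
  by exists (r + 1); rewrite lte_fin ltrDl.
by have [N _ NP] := limn_esup_lt_near hr; exists r, N.
Qed.

Lemma low_cost_subseq_near (x_ : nat -> X) Lam N :
  (forall n, (N <= n)%N -> (Ghat_ell (l n) (x_ n) <= Lam%:E)%E) ->
  exists (k : nat -> nat) z, [/\ increasing_seq k, rate * two_cosh z <= Lam &
    forall x, is_wave z x -> x_ (k n) @[n --> \oo] --> x].
Proof.
move=> h.
have [|k [z [ki zL kx]]] := @low_cost_subseq _ _ alpha01 (fun n => l (n + N)%N) (fun n => x_ (n + N)%N) Lam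
  (fun n => l0 _) _ (fun n => h _ (leq_addl _ _)).
  by apply/cvgryPge => A; have /cvgryPge/(_ A)[M _ MP] := loo; exists M => // n /= Mn;
     apply: MP; exact: leq_trans Mn (leq_addr _ _).
exists (fun n => (k n + N)%N), z; split => // m n.
by rewrite /= !leEnat leq_add2r; exact: ki.
Qed.

(** Continuity makes the waves with zero in a segment a compact set. *)
Lemma wave_path : exists w : R -> X, (forall z, is_wave z (w z)) /\ continuous w.
Proof.
pose w z := sval (cid (wave_exists alpha01 z)).
have wP z : is_wave z (w z) := svalP (cid (wave_exists alpha01 z)).
exists w; split => // z; apply: (cvg_wave alpha01 _ (wP z) (z_ := id)); first exact: cvg_id.
move=> e e0; near=> z'; have [ephi eu] := wave_XE alpha01 (wP z'); split.
  by move=> y; rewrite ephi subrr normr0 ltW.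
exists (fun=> 0); split => //.
- by move=> y; rewrite lexx ler01.
- by rewrite expr0n; exact: integrable0.
- by rewrite expr0n /= Rintegral_cst// mul0r ltW.
- by apply: ae_imp eu => y ->; rewrite subrr normr0.
Unshelve. all: by end_near. Qed.

Lemma two_cosh_norm z Lam : rate * two_cosh z <= Lam -> `|z| <= Lam / rate / alpha.
Proof.
pull; have r0 := rate_gt0 alpha01 => h.
rewrite ler_pdivlMr// ler_pdivlMr// mulrC; apply: le_trans h.
by rewrite ler_pM2l// mulrC; exact: two_cosh_ge.
Qed.

(** [K] contains every possible limit wave, by the bound on the zeros. If some neighbourhood of [K]
    were left infinitely often, [low_cost_subseq] along those indices would give a limit in [K]. *)
Lemma Ghat_equi_coercive : equi_coercive (fun n => @Ghat_ell R alpha (l n)).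
Proof.
move=> x_ /limsup_bound[Lam [N hN]].
have [w [wP cw]] := wave_path.
pose K := w @` `[(- (Lam / rate / alpha))%R, Lam / rate / alpha].
have cK : compact (K `|` range x_).
  apply: compact_setU_range; first by apply: continuous_compact; [exact: continuous_subspaceT|exact: segment_compact].
  move=> O oO KO; apply: contrapT => hO.
  have often (m M : nat) : exists n, (M <= n)%N /\ ~ O (x_ n) /\ (N <= n)%N.
    apply: contrapT => h; apply: hO; exists (maxn M N) => // n /=; rewrite geq_max => /andP[Mn Nn].
    by apply: contrapT => On; apply: h; exists n.
  have [k [ki kP]] := @extract_subseq (fun _ n => ~ O (x_ n) /\ (N <= n)%N) often.
  have kl : l (k n) @[n --> \oo] --> +oo by exact: cvg_comp (increasing_cvg ki) loo.
  have [j [z [ji zL jx]]] := @low_cost_subseq _ _ alpha01 (l \o k) (x_ \o k) Lam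
    (fun n => l0 _) kl (fun n => hN _ (kP n).2).
  have Ox : O (w z) by apply: KO; exists z => //=; rewrite in_itv/= -ler_norml; exact: two_cosh_norm.
  have : \forall n \near \oo, O (x_ (k (j n))) by apply: (jx _ (wP z)); exact: open_nbhs_nbhs.
  by move=> /filter_ex[n On]; exact: (kP (j n)).1 On.
exists (K `|` range x_); first by move=> x hx; right.
by split => //; apply: compact_closed cK; exact: hausdorff_X.
Qed.

Lemma ereal_between (a b : \bar R) : (a < b)%E -> exists r : R, (a < r%:E)%E /\ (r%:E < b)%E.
Proof.
case: a b => [a||] [b||] //.
- by rewrite lte_fin => ab; exists ((a + b) / 2); rewrite !lte_fin; split; lra.
- by move=> _; exists (a + 1); rewrite lte_fin ltry; split => //; lra.
- by move=> _; exists (b - 1); rewrite lte_fin ltNyr; split => //; lra.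
- by move=> _; exists 0; rewrite ltNyr ltry.
Qed.

(** Otherwise a subsequence has cost below some [Lam < Ghat x] and converges to a wave of limit cost
    at most [Lam]; by uniqueness of limits that wave is [x]. This includes the case
    [Ghat x = +oo]. *)
Lemma gamma_liminf (x_ : nat -> X) x : x_ n @[n --> \oo] --> x ->
  (Ghat x <= limn_einf (fun n => Ghat_ell (l n) (x_ n)))%E.
Proof.
move=> xx; rewrite leNgt; apply/negP => lt.
have [Lam [lt1 lt2]] : exists Lam : R, (limn_einf (fun n => Ghat_ell (l n) (x_ n)) < Lam%:E)%E /\ (Lam%:E < Ghat x)%E.
  exact: ereal_between.
have [k [ki kP]] := @extract_subseq (fun _ n => (Ghat_ell (l n) (x_ n) < Lam%:E)%E)
  (fun _ => limn_einf_lt_often lt1).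
have kl : l (k n) @[n --> \oo] --> +oo by exact: cvg_comp (increasing_cvg ki) loo.
have [j [z [ji zL jx]]] := @low_cost_subseq _ _ alpha01 (l \o k) (x_ \o k) Lam
  (fun n => l0 _) kl (fun n => ltW (kP n)).
have [x' hx'] := wave_exists alpha01 z.
have e : x = x'.
  apply: (cvg_unique (@hausdorff_X _ alpha) _ (jx x' hx')).
  exact: (cvg_comp _ x_ (cvg_comp _ k (increasing_cvg ji) (increasing_cvg ki)) xx).
by move: lt2; rewrite e (Ghat_wave alpha01 hx') lte_fin ltNge zL.
Qed.

Lemma recovery_element z : exists K T0 : R, [/\ 0 < K, 0 < T0 &
  forall h : R, 0 < h -> T0 <= h - z -> T0 <= h + z ->
  exists x, [/\ - h <= z <= h, Xphi x z = 0 & (Ghat_ell h x <= (rate * two_cosh z +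
    K * expR (alpha * z) * ((1 + (h - z)) * expR (- (alpha * (h - z)))) +
    K * expR (- (alpha * z)) * ((1 + (h + z)) * expR (- (alpha * (h + z)))))%:E)%E]].
Proof.
have [K [T0 [K0 T00 hK]]] := recovery_cost alpha01.
exists K, T0; split => // h h0 h1 h2.
have [b1 hb1 [p1 c1]] := hK _ h1; have [b2 hb2 [p2 c2]] := hK _ h2.
have q1 := period_gt0 alpha01 hb1; have q2 := period_gt0 alpha01 hb2.
have [x [dB ephi eu eG]] := @rec_exists _ _ alpha01 b1 b2 z h hb1 hb2 ltac:(lra) ltac:(lra).
exists x; split.
- by apply/andP; split; lra.
- by rewrite ephi rec_phi_z.
rewrite /Ghat_ell minGE// eG -EFinB -EFinM lee_fin.
have E1 : expR (alpha * h) = expR (alpha * z) * expR (alpha * (h - z)).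
  by rewrite -expRD; congr expR; ring.
have E2 : expR (alpha * h) = expR (- (alpha * z)) * expR (alpha * (h + z)).
  by rewrite -expRD; congr expR; ring.
rewrite (_ : _ - 2 * mhalf alpha = excess b1 (period alpha b1) + excess b2 (period alpha b2)); last first.
  by rewrite /excess; ring.
have d1 : expR (alpha * h) * excess b1 (period alpha b1) <=
    expR (alpha * z) * (rate + K * ((1 + (h - z)) * expR (- (alpha * (h - z))))).
  by rewrite E1 -mulrA ler_pM2l ?expR_gt0.
have d2 : expR (alpha * h) * excess b2 (period alpha b2) <=
    expR (- (alpha * z)) * (rate + K * ((1 + (h + z)) * expR (- (alpha * (h + z))))).
  by rewrite E2 -mulrA ler_pM2l ?expR_gt0.
rewrite mulrDr; apply: (le_trans (lerD d1 d2)).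
by rewrite le_eqVlt; apply/orP; left; apply/eqP; rewrite /two_cosh; ring.
Qed.

Lemma gamma_limsup z x : is_wave z x -> exists2 x_ : nat -> X, x_ n @[n --> \oo] --> x &
  (limn_esup (fun n => Ghat_ell (l n) (x_ n)) <= (rate * two_cosh z)%:E)%E.
Proof.
move=> hx; pull; have r0 := rate_gt0 alpha01.
have [K [T0 [K0 T00 hK]]] := recovery_element z.
(* For the finitely many [n] whose interval is too short, [x] itself serves as a default value. *)
have rec n : exists y : X, T0 <= l n - z -> T0 <= l n + z ->
    [/\ - l n <= z <= l n, Xphi y z = 0 & (Ghat_ell (l n) y <= (rate * two_cosh z +
    K * expR (alpha * z) * ((1 + (l n - z)) * expR (- (alpha * (l n - z)))) +
    K * expR (- (alpha * z)) * ((1 + (l n + z)) * expR (- (alpha * (l n + z)))))%:E)%E].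
  have [h1|h1] := leP T0 (l n - z); last by exists x.
  have [h2|h2] := leP T0 (l n + z); last by exists x.
  by have [y hy] := hK _ (l0 n) h1 h2; exists y.
pose x_ n := sval (cid (rec n)).
have xP n := svalP (cid (rec n)); rewrite -/(x_ _) in xP.
have K1 : 0 < K * expR (alpha * z) by rewrite mulr_gt0// expR_gt0.
have K2 : 0 < K * expR (- (alpha * z)) by rewrite mulr_gt0// expR_gt0.
have key e : 0 < e -> \forall n \near \oo, [/\ - l n <= z <= l n, Xphi (x_ n) z = 0 &
    (Ghat_ell (l n) (x_ n) <= (rate * two_cosh z + e)%:E)%E].
  move=> e0; have e2 : 0 < e / 2 by exact: divr_gt0.
  pose A := T0 + `|z| + 4 * (K * expR (alpha * z)) / (alpha ^+ 2 * (e / 2)) +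
    4 * (K * expR (- (alpha * z))) / (alpha ^+ 2 * (e / 2)).
  have pA1 : 0 < 4 * (K * expR (alpha * z)) / (alpha ^+ 2 * (e / 2)).
    by apply: divr_gt0; apply: mulr_gt0 => //; exact: exprn_gt0.
  have pA2 : 0 < 4 * (K * expR (- (alpha * z))) / (alpha ^+ 2 * (e / 2)).
    by apply: divr_gt0; apply: mulr_gt0 => //; exact: exprn_gt0.
  have lA : \forall n \near \oo, A <= l n by move/cvgryPge : loo; exact.
  apply: filterS lA => n; rewrite /A => lA.
  have n1 := ler_norm z; have n2 := ler_norm (- z); rewrite normrN in n2.
  have h1 : T0 <= l n - z by lra.
  have h2 : T0 <= l n + z by lra.
  have [zl z0 hG] := xP n h1 h2; split => //; apply: (le_trans hG); rewrite lee_fin.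
  have d1 := @exp_decay _ _ alpha01 _ (e / 2) (l n - z) K1 e2 ltac:(lra) ltac:(lra).
  have d2 := @exp_decay _ _ alpha01 _ (e / 2) (l n + z) K2 e2 ltac:(lra) ltac:(lra).
  lra.
exists x_.
  (* Bounded cost and a zero fixed at [z] already force convergence to the wave. *)
  apply: (@low_cost_cvg _ _ alpha01 l x_ (fun=> z) (rate * two_cosh z + 1) z x) => //.
  - exact: cvg_cst.
  - by rewrite addr_ge0// mulr_ge0 ?(ltW r0)// addr_ge0// expR_ge0.
  - by apply: filterS (key 1 ltr01) => n [h1 h2 h3]; split.
apply/lee_addgt0Pr => e e0; rewrite -EFinD; apply: limn_esup_le_near.
by apply: filterS (key e e0) => n [].
Qed.

Lemma Ghat_gamma_cvg : gamma_cvg (fun n => @Ghat_ell R alpha (l n)) (@Ghat R alpha).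
Proof.
move=> x; split; first by move=> x_; exact: gamma_liminf.
have [[z hx]|nx] := pselect (exists z, is_wave z x).
  by rewrite (Ghat_wave alpha01 hx); exact: gamma_limsup.
by exists (fun=> x); [exact: cvg_cst|rewrite Ghat_not_wave// leey].
Qed.

End GammaLimit.

Unset Implicit Arguments.

Theorem theorem4p1 (R : realType) (alpha : R) (alpha01 : 0 < alpha < 1) :
  (forall (l : nat -> R), (forall n, 0 < l n) -> l n @[n --> \oo] --> +oo ->
     (forall x_ : nat -> X alpha,
        (limn_esup (fun n => Ghat_ell (l n) (x_ n)) < +oo)%E ->
        exists (k : nat -> nat) (z : R) (x : X alpha),
          [/\ increasing_seq k, is_wave z x & x_ (k n) @[n --> \oo] --> x]) /\
     equi_coercive (fun n => @Ghat_ell R alpha (l n))) /\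
  (forall (l : nat -> R), (forall n, 0 < l n) -> l n @[n --> \oo] --> +oo ->
     gamma_cvg (fun n => @Ghat_ell R alpha (l n)) (@Ghat R alpha)).
Proof.
split=> l l0 loo; last exact: Ghat_gamma_cvg.
split; last exact: Ghat_equi_coercive.
move=> x_ /limsup_bound[Lam [N hN]].
have [k [z [ki _ kx]]] := low_cost_subseq_near alpha01 l0 loo hN.
by have [x hx] := wave_exists alpha01 z; exists k, z, x; split => //; exact: kx.
Qed.
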